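(* Let $\Phi\in H(\mathbb{C})$ be of finite exponential type, and suppose that the level set $\{z\in\mathbb{C}: |\Phi(z)|=1\}$ contains a non-trivial, strictly convex compact arc $\Gamma_1$ satisfying \[ \operatorname{conv}(\Gamma_1\cup\{0\})\setminus(\Gamma_1\cup\{0\})\subseteq \Phi^{-1}(\mathbb{D}). \] Then the set of entire functions $f\in H(\mathbb{C})$ that generate a hypercyclic algebra for the convolution operator $\Phi(D)$ is residual in $H(\mathbb{C})$.
   Context: $H(\mathbb{C})$ is the space of entire functions with the compact-open topology (a separable Fréchet algebra under pointwise multiplication). $D$ denotes complex differentiation $f\mapsto f'$. An entire function $\Phi(z)=\sum_{n\ge0}a_nz^n$ is of (finite) exponential type if $|a_n|\le M R^n/n!$ for all $n$, for some $M,R>0$; then $\Phi(D)f=\sum_{n\ge 0}a_nD^nf$ defines a continuous operator on $H(\mathbb{C})$. $\mathbb{D}$ is the open unit disc and $\operatorname{conv}(A)$ is the convex hull of $A\subseteq\mathbb{C}$. An arc $\mathcal{C}$ is strictly convex if for all $z_1,z_2\in\mathcal{C}$ the segment $\operatorname{conv}\{z_1,z_2\}$ meets $\mathcal{C}$ in at most two points. A vector $f$ is hypercyclic for an operator $T$ if $\{T^nf:n\ge0\}$ is dense. A function $f$ generates a hypercyclic algebra for $T$ if every nonzero element of the algebra generated by $f$ (i.e. every nonzero $P(f)$ with $P$ a polynomial with $P(0)=0$) is hypercyclic for $T$. *)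

(* Defs.v *)
From Stdlib Require Import Reals ClassicalEpsilon Factorial.
From Coquelicot Require Import Coquelicot.
Open Scope R_scope.

Definition Cderiv_at (f : C -> C) (z l : C) : Prop :=
  @is_derive C_AbsRing C_NormedModule f z l.

Definition entire (f : C -> C) : Prop :=
  forall z : C, @ex_derive C_AbsRing C_NormedModule f z.

(** D f = f' (chosen classically; for entire f it is the derivative). *)
Definition Dop (f : C -> C) : C -> C :=
  fun z => epsilon (inhabits (RtoC 0)) (fun l => Cderiv_at f z l).

Definition Csum (u : nat -> C) : C :=
  (Series (fun n => fst (u n)), Series (fun n => snd (u n))).

Definition Phi_eval (a : nat -> C) (z : C) : C :=
  Csum (fun n => (a n * Cpow z n)%C).

Definition exp_type (a : nat -> C) : Prop :=
  exists M Rr : R, 0 < M /\ 0 < Rr /\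
    forall n, Cmod (a n) <= M * Rr ^ n / INR (fact n).

Definition PhiD (a : nat -> C) (f : C -> C) : C -> C :=
  fun z => Csum (fun n => (a n * Nat.iter n Dop f z)%C).

(** Topology of H(C): uniform convergence on compacta (closed discs suffice). *)
Definition Hset := (C -> C) -> Prop.

Definition Hnbhd (f : C -> C) (Rr eps : R) (g : C -> C) : Prop :=
  entire g /\ forall z, Cmod z <= Rr -> Cmod (g z - f z)%C < eps.

Definition H_open (U : Hset) : Prop :=
  forall f, entire f -> U f ->
    exists Rr eps, 0 < Rr /\ 0 < eps /\ forall g, Hnbhd f Rr eps g -> U g.

Definition H_dense (U : Hset) : Prop :=
  forall f, entire f -> forall Rr eps, 0 < Rr -> 0 < eps ->
    exists g, Hnbhd f Rr eps g /\ U g.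

Definition H_residual (S : Hset) : Prop :=
  exists U : nat -> Hset, (forall n, H_open (U n) /\ H_dense (U n)) /\
    forall f, entire f -> (forall n, U n f) -> S f.

Definition hypercyclic (T : (C -> C) -> (C -> C)) (f : C -> C) : Prop :=
  entire f /\ H_dense (fun g => exists n : nat, g = Nat.iter n T f).

Definition poly0_eval (N : nat) (c : nat -> C) (w : C) : C :=
  sum_n_m (fun k => (c k * Cpow w k)%C) 1 N.

Definition generates_hc_algebra (T : (C -> C) -> (C -> C)) (f : C -> C) : Prop :=
  forall (N : nat) (c : nat -> C),
    (exists z, poly0_eval N c (f z) <> RtoC 0) ->
    hypercyclic T (fun z => poly0_eval N c (f z)).

Definition conv (A : C -> Prop) (z : C) : Prop :=
  exists (n : nat) (p : nat -> C) (w : nat -> R),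
    (forall i, (i <= n)%nat -> A (p i) /\ 0 <= w i) /\
    sum_n w n = 1 /\
    z = sum_n (fun i => (RtoC (w i) * p i)%C) n.

Definition segment (z1 z2 : C) (z : C) : Prop :=
  exists t : R, 0 <= t <= 1 /\ z = (RtoC (1 - t) * z1 + RtoC t * z2)%C.

(** Non-trivial compact arc: homeomorphic image of [0,1] (a continuous
    injective map on the compact interval [0,1]). *)
Definition compact_arc (G : C -> Prop) : Prop :=
  exists gam : R -> C,
    (forall t, 0 <= t <= 1 -> forall eps, 0 < eps -> exists del, 0 < del /\
       forall s, 0 <= s <= 1 -> Rabs (s - t) < del -> Cmod (gam s - gam t)%C < eps) /\
    (forall s t, 0 <= s <= 1 -> 0 <= t <= 1 -> gam s = gam t -> s = t) /\
    (forall z, G z <-> exists t, 0 <= t <= 1 /\ z = gam t).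

Definition strictly_convex (G : C -> Prop) : Prop :=
  forall z1 z2, G z1 -> G z2 ->
    forall u v w, G u -> G v -> G w ->
      segment z1 z2 u -> segment z1 z2 v -> segment z1 z2 w ->
      u = v \/ u = w \/ v = w.

(* Main.v *)
Require Import Defs.
From Stdlib Require Import Reals Factorial List Cantor Lra Lia Ranalysis5
  ClassicalEpsilon FunctionalExtensionality Classical.
From Coquelicot Require Import Coquelicot.
Open Scope R_scope.

(** Write [T = Phi(D)], so that [T e_l = Phi(l) e_l] for [e_l(z) = exp(l z)].
    By Baire, it suffices that for every degree [m] and every target [v] the
    functions [f] for which some iterate sends [f^k] near 0 for [1 <= k < m]
    and [f^m] near [v] are dense: for a polynomial of degree [m] the top term
    then decides the orbit.

    Near a given function take [f = sum x_i e_(b_i/m) + sum y_j e_(g_j/m)], with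
    [b_i] in the interior of the hull of the arc and 0, and [g_j] slightly
    outside a sub-arc, with [|Phi(g_j)| > 1] and [y_j^m = c_j Phi(g_j)^-q]; then
    [y_j -> 0] as [q] grows.  Expanding [f^k] over words of length [k], the
    constant words [g_j ... g_j] of length [m] reproduce the target
    [sum c_j e_(g_j)].  The exponent of any other word is close to a point of the
    interior of the hull or of an open chord of the arc, by strict convexity; there
    [|Phi| < 1], so [T^q] kills it.  Exponentials with exponents accumulating at a
    point span a dense subspace, which gives both approximations.

    Complex differentiability is only assumed pointwise: Goursat's theorem, by
    bisection of rectangles, yields Cauchy's estimate and hence Taylor expansions. *)

(** * Complex differentiation *)

(** The hypothesis on the hull leaves the modulus at 0 uncontrolled, so no exponent may fall on 0:
    all letters are kept in an open sector [cone A B] spanned by two arc points, and averages of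
    letters and their positive multiples stay there. The sector also provides a nondegenerate
    triangle 0, [A], [B], hence interior points of the hull on each of its rays. Division of the
    exponents by [m] makes the exponent of a word of length [m] the average of its letters, and that
    of a shorter word such an average pulled towards 0; one geometric statement thus covers the
    powers below [m] and the mixed terms of the power [m]. The [g_j] cannot lie on the arc, since
    the growth of [Phi(g_j)^q] is what makes the [y_j] vanish, and they cannot be chosen first: the
    word estimates are proved for arc points and pass to nearby points because only finitely many
    words occur. Hence the order of choices: arc points and coefficients, next the [g_j], last
    [q]. *)

Lemma Cderiv_at_eps (f : C -> C) (z l : C) :
  Cderiv_at f z l <->
  forall eps, 0 < eps -> exists del, 0 < del /\ forall h, Cmod h < del ->
    Cmod (f (z + h) - f z - l * h)%C <= eps * Cmod h.
Proof.
split.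
- intros [_ H] eps Heps.
  destruct (H z (fun P HP => HP) (mkposreal eps Heps)) as [del Hd].
  exists del; split; [apply cond_pos|intros h Hh].
  specialize (Hd (z + h)%C).
  assert (E : @minus C_AbelianGroup (z + h)%C z = h)
    by (unfold minus, plus, opp; simpl; ring).
  assert (B : @ball (AbsRing_UniformSpace C_AbsRing) z del (z + h)%C).
  { change (Cmod (@minus C_AbelianGroup (z + h)%C z) < del). now rewrite E. }
  specialize (Hd B). simpl in Hd.
  change (Cmod (@minus C_AbelianGroup (@minus C_AbelianGroup (f (z + h)%C) (f z))
     (Cmult (@minus C_AbelianGroup (z + h)%C z) l)) <=
     eps * Cmod (@minus C_AbelianGroup (z + h)%C z)) in Hd.
  rewrite E in Hd.
  replace (f (z + h) - f z - l * h)%C with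
   (@minus C_AbelianGroup (@minus C_AbelianGroup (f (z + h)%C) (f z)) (Cmult h l)).
  exact Hd. unfold minus, plus, opp; simpl; ring.
- intros H. split; [apply is_linear_scal_l|].
  intros x Hx eps.
  assert (x = z).
  { symmetry. apply (is_filter_lim_locally_unique (K := C_AbsRing) (V := AbsRing_NormedModule C_AbsRing) z x). exact Hx. }
  subst x.
  destruct (H eps (cond_pos eps)) as [del [Hd Hh]].
  exists (mkposreal del Hd). intros y Hy.
  change (Cmod (@minus C_AbelianGroup y z) < del) in Hy.
  specialize (Hh (@minus C_AbelianGroup y z) Hy).
  change (Cmod (@minus C_AbelianGroup (@minus C_AbelianGroup (f y) (f z))
     (Cmult (@minus C_AbelianGroup y z) l)) <=
     eps * Cmod (@minus C_AbelianGroup y z)).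
  assert (E : forall w : C, (z + @minus C_AbelianGroup w z)%C = w)
    by (intros w; unfold minus, plus, opp; simpl; ring).
  rewrite E in Hh.
  rewrite Cmult_comm. exact Hh.
Qed.

Lemma Cderiv_at_unique (f : C -> C) (z l l' : C) :
  Cderiv_at f z l -> Cderiv_at f z l' -> l = l'.
Proof.
intros H H'. transitivity (C_derive f z).
- symmetry. now apply is_C_derive_unique.
- now apply is_C_derive_unique.
Qed.

Lemma Dop_eq (f : C -> C) (z l : C) : Cderiv_at f z l -> Dop f z = l.
Proof.
intros H. apply (Cderiv_at_unique f z); [|exact H].
unfold Dop. apply epsilon_spec. now exists l.
Qed.

Lemma entire_Dop (f : C -> C) (z : C) : entire f -> Cderiv_at f z (Dop f z).
Proof.
intros H. destruct (H z) as [l Hl]. now rewrite (Dop_eq f z l).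
Qed.

Lemma entire_intro (f f' : C -> C) : (forall z, Cderiv_at f z (f' z)) -> entire f.
Proof. intros H z. exists (f' z). apply H. Qed.

Lemma Dop_intro (f f' : C -> C) : (forall z, Cderiv_at f z (f' z)) -> Dop f = f'.
Proof. intros H. apply functional_extensionality; intros z. now apply Dop_eq. Qed.

Lemma Cderiv_at_ext (f g : C -> C) (z l l' : C) :
  (forall w, f w = g w) -> l = l' -> Cderiv_at f z l -> Cderiv_at g z l'.
Proof.
intros H <- Hf. replace g with f; [exact Hf|].
now apply functional_extensionality.
Qed.

Lemma Cderiv_at_const (c z : C) : Cderiv_at (fun _ => c) z 0.
Proof. apply (is_derive_const (K := C_AbsRing) (V := C_NormedModule)). Qed.

Lemma Cderiv_at_id (z : C) : Cderiv_at (fun w => w) z 1.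
Proof.
apply Cderiv_at_eps. intros eps He. exists 1; split; [lra|].
intros h _. replace (z + h - z - 1 * h)%C with (RtoC 0) by ring.
rewrite Cmod_0. apply Rmult_le_pos; [lra|apply Cmod_ge_0].
Qed.

Lemma Cderiv_at_plus (f g : C -> C) (z df dg : C) :
  Cderiv_at f z df -> Cderiv_at g z dg ->
  Cderiv_at (fun w => f w + g w)%C z (df + dg)%C.
Proof. apply (is_derive_plus (K := C_AbsRing) (V := C_NormedModule)). Qed.

(** Product and chain rules see the field as a module over itself, while [Cderiv_at] uses
    [C_NormedModule]; the underlying operations and norms coincide up to conversion. *)
Lemma Cderiv_at_AbsRing (f : C -> C) (z l : C) :
  Cderiv_at f z l <->
  @is_derive C_AbsRing (AbsRing_NormedModule C_AbsRing) f z l.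
Proof.
split; intros [[H1 H2 H3] H]; (split; [split; assumption|exact H]).
Qed.

Lemma Cderiv_at_mult (f g : C -> C) (z df dg : C) :
  Cderiv_at f z df -> Cderiv_at g z dg ->
  Cderiv_at (fun w => f w * g w)%C z (df * g z + f z * dg)%C.
Proof.
rewrite 3!Cderiv_at_AbsRing. intros Hf Hg.
apply (is_derive_mult (K := C_AbsRing) f g z df dg Hf Hg Cmult_comm).
Qed.

Lemma Cderiv_at_comp (f g : C -> C) (z df dg : C) :
  Cderiv_at f (g z) df -> Cderiv_at g z dg ->
  Cderiv_at (fun w => f (g w)) z (df * dg)%C.
Proof.
rewrite (Cderiv_at_AbsRing g). intros Hf Hg. rewrite Cmult_comm.
apply (is_derive_comp (K := C_AbsRing) (V := C_NormedModule) f g z df dg Hf Hg).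
Qed.

Lemma Cderiv_at_scal (c : C) (f : C -> C) (z df : C) :
  Cderiv_at f z df -> Cderiv_at (fun w => c * f w)%C z (c * df)%C.
Proof.
intros H. refine (Cderiv_at_ext _ _ _ _ _ _ _
  (Cderiv_at_mult _ _ _ _ _ (Cderiv_at_const c z) H)); [reflexivity|ring].
Qed.

Lemma Cderiv_at_minus (f g : C -> C) (z df dg : C) :
  Cderiv_at f z df -> Cderiv_at g z dg ->
  Cderiv_at (fun w => f w - g w)%C z (df - dg)%C.
Proof.
intros Hf Hg. refine (Cderiv_at_ext _ _ _ _ _ _ _
  (Cderiv_at_plus _ _ _ _ _ Hf (Cderiv_at_scal (-1) _ _ _ Hg))).
intros w; ring. ring.
Qed.

Lemma Cderiv_at_pow (f : C -> C) (z df : C) (n : nat) :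
  Cderiv_at f z df ->
  Cderiv_at (fun w => f w ^ S n)%C z (INR (S n) * f z ^ n * df)%C.
Proof.
intros Hf. induction n as [|n IH].
- refine (Cderiv_at_ext _ _ _ _ _ _ _ Hf). intros w; simpl; ring. simpl. ring.
- refine (Cderiv_at_ext _ _ _ _ _ _ _ (Cderiv_at_mult _ _ _ _ _ Hf IH)).
  intros w; simpl; ring.
  rewrite (S_INR (S n)), RtoC_plus. simpl Cpow. ring.
Qed.

(** * The complex exponential *)

Definition Cexp (z : C) : C := (exp (fst z) * cos (snd z), exp (fst z) * sin (snd z)).

Lemma Cexp_plus (z w : C) : Cexp (z + w) = (Cexp z * Cexp w)%C.
Proof.
unfold Cexp. destruct z as [a b], w as [c d]; simpl.
unfold Cmult; simpl. rewrite exp_plus, cos_plus, sin_plus. f_equal; ring.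
Qed.

Lemma Cexp_0 : Cexp 0 = 1.
Proof. unfold Cexp; simpl. rewrite exp_0, cos_0, sin_0. unfold RtoC; f_equal; ring. Qed.

Lemma Cexp_neq_0 (z : C) : Cexp z <> 0.
Proof.
intros H. apply C1_nz. rewrite <- Cexp_0.
replace (RtoC 0) with (z + - z)%C by ring. rewrite Cexp_plus, H. ring.
Qed.

Lemma Cexp_opp (z : C) : Cexp (- z) = (/ Cexp z)%C.
Proof.
pose proof (Cexp_neq_0 z) as H.
assert (E : (Cexp z * Cexp (- z) = 1)%C).
{ rewrite <- Cexp_plus. replace (z + - z)%C with (RtoC 0) by ring. apply Cexp_0. }
replace (Cexp (- z)) with (/ Cexp z * (Cexp z * Cexp (- z)))%C.
rewrite E; ring. field; exact H.
Qed.

Lemma Cmod_Cexp (z : C) : Cmod (Cexp z) = exp (fst z).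
Proof.
unfold Cmod, Cexp; simpl fst; simpl snd.
replace ((exp (fst z) * cos (snd z)) ^ 2 + (exp (fst z) * sin (snd z)) ^ 2)
  with (exp (fst z) ^ 2 * (Rsqr (sin (snd z)) + Rsqr (cos (snd z)))) by (unfold Rsqr; ring).
rewrite sin2_cos2, Rmult_1_r. replace (exp (fst z) ^ 2) with (Rsqr (exp (fst z))) by (unfold Rsqr; ring).
apply sqrt_Rsqr. left; apply exp_pos.
Qed.

Lemma Cmod_pair_le (a b : R) : Cmod (a, b) <= Rabs a + Rabs b.
Proof.
replace (a, b) with (RtoC a + Ci * RtoC b)%C.
- eapply Rle_trans; [apply Cmod_triangle|].
  rewrite Cmod_mult, Cmod_Ci, 2!Cmod_R. lra.
- unfold RtoC, Ci, Cmult, Cplus; simpl. f_equal; ring.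
Qed.

Lemma Rabs_fst_le (z : C) : Rabs (fst z) <= Cmod z.
Proof. eapply Rle_trans; [apply Rmax_l|apply Rmax_Cmod]. Qed.

Lemma Rabs_snd_le (z : C) : Rabs (snd z) <= Cmod z.
Proof. eapply Rle_trans; [apply Rmax_r|apply Rmax_Cmod]. Qed.

Lemma RtoC_neq_0 (x : R) : x <> 0 -> RtoC x <> 0.
Proof. intros H E. now apply H, RtoC_inj. Qed.

Lemma Cmod_minus_self (z : C) : Cmod (z - z)%C = 0.
Proof. replace (z - z)%C with (RtoC 0) by ring. apply Cmod_0. Qed.

Lemma is_derive_eps_R (f : R -> R) (x l : R) : is_derive f x l ->
  forall eps, 0 < eps -> exists del, 0 < del /\ forall h, Rabs h < del ->
    Rabs (f (x + h) - f x - l * h) <= eps * Rabs h.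
Proof.
intros H eps He. apply is_derive_Reals in H.
destruct (H eps He) as [del Hd]. exists del; split; [apply cond_pos|].
intros h Hh. destruct (Req_dec h 0) as [->|Hn].
- rewrite Rplus_0_r, Rmult_0_r, Rabs_R0, Rmult_0_r.
  replace (f x - f x - 0) with 0 by ring. rewrite Rabs_R0; lra.
- specialize (Hd h Hn Hh).
  replace (f (x + h) - f x - l * h) with (((f (x + h) - f x) / h - l) * h) by (field; exact Hn).
  rewrite Rabs_mult. apply Rmult_le_compat_r; [apply Rabs_pos|lra].
Qed.

Lemma Cderiv_at_Cexp_0 : Cderiv_at Cexp 0 1.
Proof.
apply Cderiv_at_eps. intros eps He.
(* The total error splits into nine terms, each at most [e * m] with [e <= eps / 16]. *)
destruct (is_derive_eps_R exp 0 1) with (eps := Rmin 1 (eps / 16)) as [d1 [Hd1 H1]].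
{ auto_derive; [exact I|rewrite exp_0; ring]. }
{ apply Rmin_glb_lt; lra. }
destruct (is_derive_eps_R cos 0 0) with (eps := Rmin 1 (eps / 16)) as [d2 [Hd2 H2]].
{ auto_derive; [exact I|rewrite sin_0; ring]. }
{ apply Rmin_glb_lt; lra. }
destruct (is_derive_eps_R sin 0 1) with (eps := Rmin 1 (eps / 16)) as [d3 [Hd3 H3]].
{ auto_derive; [exact I|rewrite cos_0; ring]. }
{ apply Rmin_glb_lt; lra. }
exists (Rmin (Rmin d1 d2) (Rmin d3 (Rmin 1 (eps / 16)))). split.
{ repeat apply Rmin_glb_lt; lra. }
intros [x y] Hh.
pose proof (Rabs_fst_le (x, y)) as Hx. pose proof (Rabs_snd_le (x, y)) as Hy. simpl in Hx, Hy.
set (m := Cmod (x, y)) in *.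
pose proof (Rmin_l (Rmin d1 d2) (Rmin d3 (Rmin 1 (eps / 16)))).
pose proof (Rmin_r (Rmin d1 d2) (Rmin d3 (Rmin 1 (eps / 16)))).
pose proof (Rmin_l d1 d2). pose proof (Rmin_r d1 d2).
pose proof (Rmin_l d3 (Rmin 1 (eps / 16))). pose proof (Rmin_r d3 (Rmin 1 (eps / 16))).
pose proof (Rmin_l 1 (eps / 16)). pose proof (Rmin_r 1 (eps / 16)).
specialize (H1 x ltac:(lra)). specialize (H2 y ltac:(lra)). specialize (H3 y ltac:(lra)).
rewrite Rplus_0_l, exp_0 in H1. rewrite Rplus_0_l, cos_0 in H2. rewrite Rplus_0_l, sin_0 in H3.
set (e := Rmin 1 (eps / 16)) in *.
assert (He0 : 0 < e) by (apply Rmin_glb_lt; lra).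
set (u := exp x - 1 - 1 * x) in *. set (c := cos y - 1 - 0 * y) in *.
set (s := sin y - 0 - 1 * y) in *.
assert (Hm0 : 0 <= m) by apply Cmod_ge_0.
assert (Hu : Rabs u <= e * m) by (eapply Rle_trans; [exact H1|]; apply Rmult_le_compat_l; lra).
assert (Hc : Rabs c <= e * m) by (eapply Rle_trans; [exact H2|]; apply Rmult_le_compat_l; lra).
assert (Hs : Rabs s <= e * m) by (eapply Rle_trans; [exact H3|]; apply Rmult_le_compat_l; lra).
replace (Cexp (0 + (x, y)) - Cexp 0 - 1 * (x, y))%C
  with (u + c + u * c + x * c, s + u * s + x * s + u * y + x * y).
2:{ rewrite Cplus_0_l, Cexp_0. unfold Cexp, Cminus, Cplus, Copp, Cmult, RtoC; simpl.
    unfold u, c, s. f_equal; ring. }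
eapply Rle_trans; [apply Cmod_pair_le|].
assert (P : forall a b, Rabs a <= e * m -> Rabs b <= m -> Rabs (a * b) <= e * m * m).
{ intros a b Ha Hb. rewrite Rabs_mult. apply Rmult_le_compat; auto using Rabs_pos. }
assert (Hem : e * m <= m) by nra.
assert (Hm1 : m < e) by lra.
pose proof (P u c Hu ltac:(lra)). pose proof (P c x Hc ltac:(lra)).
pose proof (P u s Hu ltac:(lra)). pose proof (P s x Hs ltac:(lra)).
pose proof (P u y Hu ltac:(lra)).
assert (Rabs (x * y) <= e * m).
{ rewrite Rabs_mult. pose proof (Rabs_pos x). pose proof (Rabs_pos y). nra. }
assert (e * m * m <= e * m) by nra.
rewrite (Rmult_comm x c), (Rmult_comm x s).
pose proof (Rabs_triang (u + c + u * c) (c * x)).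
pose proof (Rabs_triang (u + c) (u * c)). pose proof (Rabs_triang u c).
pose proof (Rabs_triang (s + u * s + s * x + u * y) (x * y)).
pose proof (Rabs_triang (s + u * s + s * x) (u * y)).
pose proof (Rabs_triang (s + u * s) (s * x)). pose proof (Rabs_triang s (u * s)).
assert (9 * (e * m) <= 9 * (eps / 16 * m)) by nra.
nra.
Qed.

Lemma Cderiv_at_Cexp (z : C) : Cderiv_at Cexp z (Cexp z).
Proof.
refine (Cderiv_at_ext (fun w => Cexp z * Cexp (w + - z))%C _ _ _ _ _ _ _).
3:{ apply Cderiv_at_scal. apply (Cderiv_at_comp Cexp (fun w => w + - z)%C).
    2:{ apply Cderiv_at_plus; [apply Cderiv_at_id|apply Cderiv_at_const]. }
    replace (z + - z)%C with (RtoC 0) by ring. apply Cderiv_at_Cexp_0. }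
- intros w. rewrite <- Cexp_plus. f_equal. ring.
- ring.
Qed.

(** * Calculus of entire functions *)

Lemma entire_const (c : C) : entire (fun _ => c).
Proof. exact (entire_intro _ _ (Cderiv_at_const c)). Qed.

Lemma entire_id : entire (fun z => z).
Proof. exact (entire_intro _ _ Cderiv_at_id). Qed.

Lemma entire_plus (f g : C -> C) : entire f -> entire g -> entire (fun z => f z + g z)%C.
Proof.
intros Hf Hg. apply (entire_intro _ (fun z => Dop f z + Dop g z)%C); intros z.
now apply Cderiv_at_plus; apply entire_Dop.
Qed.

Lemma entire_minus (f g : C -> C) : entire f -> entire g -> entire (fun z => f z - g z)%C.
Proof.
intros Hf Hg. apply (entire_intro _ (fun z => Dop f z - Dop g z)%C); intros z.
now apply Cderiv_at_minus; apply entire_Dop.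
Qed.

Lemma entire_mult (f g : C -> C) : entire f -> entire g -> entire (fun z => f z * g z)%C.
Proof.
intros Hf Hg z. eexists. now apply Cderiv_at_mult; apply entire_Dop.
Qed.

Lemma entire_scal (c : C) (f : C -> C) : entire f -> entire (fun z => c * f z)%C.
Proof. intros Hf. apply entire_mult; [apply entire_const|exact Hf]. Qed.

Lemma entire_comp (f g : C -> C) : entire f -> entire g -> entire (fun z => f (g z)).
Proof.
intros Hf Hg z. eexists. now apply Cderiv_at_comp; apply entire_Dop.
Qed.

Lemma entire_Cpow (f : C -> C) (n : nat) : entire f -> entire (fun z => f z ^ n)%C.
Proof.
intros Hf. induction n as [|n IH]; simpl; [apply entire_const|now apply entire_mult].
Qed.

Lemma entire_Cexp : entire Cexp.
Proof. exact (entire_intro _ _ Cderiv_at_Cexp). Qed.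

Lemma Dop_plus (f g : C -> C) : entire f -> entire g ->
  Dop (fun z => f z + g z)%C = (fun z => Dop f z + Dop g z)%C.
Proof.
intros Hf Hg. apply Dop_intro; intros z. now apply Cderiv_at_plus; apply entire_Dop.
Qed.

Lemma Dop_minus (f g : C -> C) : entire f -> entire g ->
  Dop (fun z => f z - g z)%C = (fun z => Dop f z - Dop g z)%C.
Proof.
intros Hf Hg. apply Dop_intro; intros z. now apply Cderiv_at_minus; apply entire_Dop.
Qed.

Lemma Dop_scal (c : C) (f : C -> C) : entire f ->
  Dop (fun z => c * f z)%C = (fun z => c * Dop f z)%C.
Proof.
intros Hf. apply Dop_intro; intros z. now apply Cderiv_at_scal; apply entire_Dop.
Qed.

(** The bridge to real analysis: complex derivatives enter integrals and mean value arguments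
    through restrictions to real lines. *)
Lemma Cderiv_at_line (f : C -> C) (z d l : C) (t : R) :
  Cderiv_at f (z + t * d)%C l ->
  is_derive (fun s : R => fst (f (z + s * d)%C)) t (fst (l * d)%C) /\
  is_derive (fun s : R => snd (f (z + s * d)%C)) t (snd (l * d)%C).
Proof.
intros H. rewrite Cderiv_at_eps in H.
assert (K : forall eps, 0 < eps -> exists del, 0 < del /\ forall h : R, Rabs h < del ->
  Cmod (f (z + (t + h)%R * d) - f (z + t * d) - (l * d) * h)%C <= eps * Rabs h).
{ intros eps He. pose proof (Cmod_ge_0 d) as Hd0.
  destruct (H (eps / (1 + Cmod d))) as [del [Hdel Hh]].
  { apply Rdiv_lt_0_compat; lra. }
  exists (del / (1 + Cmod d)); split; [apply Rdiv_lt_0_compat; lra|].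
  intros h Hlt.
  assert (Hlt' : Rabs h * (1 + Cmod d) < del).
  { replace del with (del / (1 + Cmod d) * (1 + Cmod d)) by (field; lra).
    apply Rmult_lt_compat_r; lra. }
  pose proof (Rabs_pos h) as Hh0.
  specialize (Hh (h * d)%C). rewrite Cmod_mult, Cmod_R in Hh.
  specialize (Hh ltac:(nra)).
  replace (f (z + (t + h)%R * d) - f (z + t * d) - l * d * h)%C with
    (f (z + t * d + h * d) - f (z + t * d) - l * (h * d))%C.
  - eapply Rle_trans; [exact Hh|].
    replace (eps * Rabs h) with (eps / (1 + Cmod d) * (Rabs h * (1 + Cmod d))) by (field; lra).
    apply Rmult_le_compat_l; [left; apply Rdiv_lt_0_compat; lra|].
    apply Rmult_le_compat_l; lra.
  - rewrite RtoC_plus. replace (z + (t + h) * d)%C with (z + t * d + h * d)%C by ring. ring. }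
split; apply is_derive_Reals; intros eps He;
  destruct (K (eps / 2)) as [del [Hdel Hh]]; try lra;
  exists (mkposreal del Hdel); intros h Hn Hlt; simpl in Hlt; specialize (Hh h Hlt);
  pose proof (Rabs_pos_lt h Hn) as Hp.
1: pose proof (Rabs_fst_le (f (z + (t + h)%R * d) - f (z + t * d) - l * d * h)%C) as Q.
2: pose proof (Rabs_snd_le (f (z + (t + h)%R * d) - f (z + t * d) - l * d * h)%C) as Q.
all: match goal with |- Rabs ?e < _ => set (E := e) end.
1: assert (QE : fst (f (z + (t + h)%R * d) - f (z + t * d) - l * d * h)%C = E * h).
3: assert (QE : snd (f (z + (t + h)%R * d) - f (z + t * d) - l * d * h)%C = E * h).
1,3: unfold E; simpl; field; exact Hn.
all: rewrite QE, Rabs_mult in Q; apply Rmult_lt_reg_r with (Rabs h); nra.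
Qed.

(** * Bisection of intervals and rectangles *)

Lemma bisection_limit (a : nat -> R) (w : R) : 0 <= w ->
  (forall n, a n <= a (S n) <= a n + w / 2 ^ S n) ->
  exists p, forall n, a n <= p <= a n + w / 2 ^ n.
Proof.
intros Hw H.
assert (Hpow : forall n, 0 < 2 ^ n) by (intros n; apply pow_lt; lra).
assert (Hhalf : forall n, w / 2 ^ n = w / 2 ^ S n + w / 2 ^ S n).
{ intros n. simpl. field. specialize (Hpow n); lra. }
assert (Hnn : forall n, 0 <= w / 2 ^ n).
{ intros n. apply Rmult_le_pos; [lra|left; now apply Rinv_0_lt_compat]. }
assert (Hm : forall n k, a n <= a (n + k)%nat /\ a (n + k)%nat + w / 2 ^ (n + k) <= a n + w / 2 ^ n).
{ intros n k; induction k as [|k IH].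
  - rewrite Nat.add_0_r; lra.
  - rewrite Nat.add_succ_r. specialize (H (n + k)%nat). specialize (Hhalf (n + k)%nat). lra. }
assert (Hup : forall n k, a k <= a n + w / 2 ^ n).
{ intros n k. destruct (Nat.le_ge_cases n k) as [L|L].
  - replace k with (n + (k - n))%nat by lia. specialize (Hm n (k - n)%nat).
    specialize (Hnn (n + (k - n))%nat). lra.
  - replace n with (k + (n - k))%nat at 1 by lia. specialize (Hm k (n - k)%nat).
    specialize (Hnn n). lra. }
destruct (completeness (fun x => exists n, x = a n)) as [p [Hp1 Hp2]].
- exists (a 0%nat + w / 2 ^ 0). intros x [n ->]. apply Hup.
- exists (a 0%nat). now exists 0%nat.
- exists p. intros n; split.
  + apply Hp1. now exists n.
  + apply Hp2. intros x [k ->]. apply Hup.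
Qed.

(** A compactness principle: a bad rectangle has a bad quarter, and nested bad quarters shrink to a
    point that contradicts the local clause. It serves both Goursat's theorem and boundedness on
    discs. *)
Lemma rectangle_bisection (P : R -> R -> R -> R -> Prop) :
  (forall x y w h, 0 < w -> 0 < h ->
     P x y (w / 2) (h / 2) -> P (x + w / 2) y (w / 2) (h / 2) ->
     P x (y + h / 2) (w / 2) (h / 2) -> P (x + w / 2) (y + h / 2) (w / 2) (h / 2) ->
     P x y w h) ->
  (forall px py, exists del, 0 < del /\ forall x y w h,
     0 < w < del -> 0 < h < del -> x <= px <= x + w -> y <= py <= y + h -> P x y w h) ->
  forall x y w h, 0 < w -> 0 < h -> P x y w h.
Proof.
intros Hq Hloc x y w h Hw Hh. apply NNPP; intros Hbad.
assert (Hpow : forall n, 0 < 2 ^ n) by (intros n; apply pow_lt; lra).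
(* A quarter is stored by its lower-left corner, its size being known from [n]. The implication lets
   [next] be defined at every corner, bad or not. *)
assert (step : forall (n : nat) (p : R * R), exists p' : R * R,
  (~ P (fst p) (snd p) (w / 2 ^ n) (h / 2 ^ n) ->
   ~ P (fst p') (snd p') (w / 2 ^ S n) (h / 2 ^ S n)) /\
  (fst p' = fst p \/ fst p' = fst p + w / 2 ^ S n) /\
  (snd p' = snd p \/ snd p' = snd p + h / 2 ^ S n)).
{ intros n [a b]; simpl fst; simpl snd.
  assert (Ew : w / 2 ^ n / 2 = w / 2 ^ S n) by (simpl; field; specialize (Hpow n); lra).
  assert (Eh : h / 2 ^ n / 2 = h / 2 ^ S n) by (simpl; field; specialize (Hpow n); lra).
  specialize (Hq a b (w / 2 ^ n) (h / 2 ^ n)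
    (Rdiv_lt_0_compat _ _ Hw (Hpow n)) (Rdiv_lt_0_compat _ _ Hh (Hpow n))).
  rewrite Ew, Eh in Hq.
  destruct (classic (P a b (w / 2 ^ S n) (h / 2 ^ S n))) as [P1|P1].
  2:{ exists (a, b); simpl fst; simpl snd; tauto. }
  destruct (classic (P (a + w / 2 ^ S n) b (w / 2 ^ S n) (h / 2 ^ S n))) as [P2|P2].
  2:{ exists (a + w / 2 ^ S n, b); simpl fst; simpl snd; tauto. }
  destruct (classic (P a (b + h / 2 ^ S n) (w / 2 ^ S n) (h / 2 ^ S n))) as [P3|P3].
  2:{ exists (a, b + h / 2 ^ S n); simpl fst; simpl snd; tauto. }
  exists (a + w / 2 ^ S n, b + h / 2 ^ S n); simpl fst; simpl snd; tauto. }
assert (exists next : nat -> R * R -> R * R, forall n p,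
  (~ P (fst p) (snd p) (w / 2 ^ n) (h / 2 ^ n) ->
   ~ P (fst (next n p)) (snd (next n p)) (w / 2 ^ S n) (h / 2 ^ S n)) /\
  (fst (next n p) = fst p \/ fst (next n p) = fst p + w / 2 ^ S n) /\
  (snd (next n p) = snd p \/ snd (next n p) = snd p + h / 2 ^ S n)) as [next Hnext].
{ exists (fun n p => proj1_sig (constructive_indefinite_description _ (step n p))).
  intros n p. exact (proj2_sig (constructive_indefinite_description _ (step n p))). }
pose (q := fix q n := match n with O => (x, y) | S n => next n (q n) end).
assert (Hbadq : forall n, ~ P (fst (q n)) (snd (q n)) (w / 2 ^ n) (h / 2 ^ n)).
{ intros n; induction n as [|n IH].
  - simpl. now rewrite 2!Rdiv_1_r.
  - now apply (Hnext n (q n)). }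
assert (Hwp : forall n, 0 < w / 2 ^ n) by (intros n; now apply Rdiv_lt_0_compat).
assert (Hhp : forall n, 0 < h / 2 ^ n) by (intros n; now apply Rdiv_lt_0_compat).
destruct (bisection_limit (fun n => fst (q n)) w ltac:(lra)) as [px Hpx].
{ intros n. destruct (Hnext n (q n)) as [_ [H _]].
  specialize (Hwp (S n)). change (q (S n)) with (next n (q n)).
  destruct H as [->| ->]; lra. }
destruct (bisection_limit (fun n => snd (q n)) h ltac:(lra)) as [py Hpy].
{ intros n. destruct (Hnext n (q n)) as [_ [_ H]].
  specialize (Hhp (S n)).
  change (q (S n)) with (next n (q n)). destruct H as [->| ->]; lra. }
destruct (Hloc px py) as [del [Hdel Hd]].
assert (Hsmall : exists n, (w + h) / 2 ^ n < del).
{ destruct (Pow_x_infinity 2 ltac:(rewrite Rabs_pos_eq; lra) ((w + h) / del + 1)) as [N HN].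
  exists N. specialize (HN N (le_n N)). rewrite Rabs_pos_eq in HN by (left; apply Hpow).
  apply Rmult_lt_reg_r with (2 ^ N); [apply Hpow|].
  replace ((w + h) / 2 ^ N * 2 ^ N) with ((w + h) / del * del) by (field; specialize (Hpow N); repeat split; lra).
  rewrite (Rmult_comm del). apply Rmult_lt_compat_r; lra. }
destruct Hsmall as [n Hn]. unfold Rdiv in Hn. rewrite Rmult_plus_distr_r in Hn.
fold (w / 2 ^ n) in Hn. fold (h / 2 ^ n) in Hn.
apply (Hbadq n). specialize (Hwp n). specialize (Hhp n).
apply Hd; [lra|lra|apply Hpx|apply Hpy].
Qed.

(** * Goursat's theorem and Cauchy's estimate *)

Definition Ccont (f : R -> C) : Prop :=
  forall t, continuous (fun s => fst (f s)) t /\ continuous (fun s => snd (f s)) t.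

Definition CInt (f : R -> C) (a b : R) : C :=
  (RInt (fun s => fst (f s)) a b, RInt (fun s => snd (f s)) a b).

Lemma ex_RInt_fst (f : R -> C) (a b : R) : Ccont f -> ex_RInt (fun s => fst (f s)) a b.
Proof. intros H. apply (ex_RInt_continuous (V := R_CompleteNormedModule)). intros; apply H. Qed.

Lemma ex_RInt_snd (f : R -> C) (a b : R) : Ccont f -> ex_RInt (fun s => snd (f s)) a b.
Proof. intros H. apply (ex_RInt_continuous (V := R_CompleteNormedModule)). intros; apply H. Qed.

Lemma CInt_ext (f g : R -> C) (a b : R) : (forall t, f t = g t) -> CInt f a b = CInt g a b.
Proof. intros H. replace g with f; [easy|]. now apply functional_extensionality. Qed.

Lemma CInt_Chasles (f : R -> C) (a b c : R) : Ccont f ->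
  CInt f a c = (CInt f a b + CInt f b c)%C.
Proof.
intros H. unfold CInt, Cplus; simpl. f_equal; symmetry.
- apply (RInt_Chasles (V := R_CompleteNormedModule)); now apply ex_RInt_fst.
- apply (RInt_Chasles (V := R_CompleteNormedModule)); now apply ex_RInt_snd.
Qed.

Lemma CInt_plus (f g : R -> C) (a b : R) : Ccont f -> Ccont g ->
  CInt (fun t => f t + g t)%C a b = (CInt f a b + CInt g a b)%C.
Proof.
intros Hf Hg. unfold CInt, Cplus; simpl. f_equal.
- apply (RInt_plus (V := R_CompleteNormedModule)); now apply ex_RInt_fst.
- apply (RInt_plus (V := R_CompleteNormedModule)); now apply ex_RInt_snd.
Qed.

Lemma CInt_FTC (g f : R -> C) (a b : R) : Ccont f ->
  (forall t, is_derive (fun s => fst (g s)) t (fst (f t)) /\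
             is_derive (fun s => snd (g s)) t (snd (f t))) ->
  CInt f a b = (g b - g a)%C.
Proof.
intros Hf Hg. unfold CInt. apply injective_projections; simpl.
- apply is_RInt_unique, (is_RInt_derive (V := R_CompleteNormedModule) (fun s => fst (g s))).
  + intros; apply Hg.
  + intros; apply Hf.
- apply is_RInt_unique, (is_RInt_derive (V := R_CompleteNormedModule) (fun s => snd (g s))).
  + intros; apply Hg.
  + intros; apply Hf.
Qed.

(** The factor 2 comes from bounding real and imaginary parts separately; it only affects constants
    downstream. *)
Lemma CInt_bound (f : R -> C) (a b B : R) : Ccont f -> a <= b ->
  (forall t, a <= t <= b -> Cmod (f t) <= B) -> Cmod (CInt f a b) <= 2 * B * (b - a).
Proof.
intros Hf Hab HB.
eapply Rle_trans; [apply Cmod_pair_le|].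
assert (H1 : Rabs (RInt (fun s => fst (f s)) a b) <= (b - a) * B).
{ apply abs_RInt_le_const; [exact Hab|now apply ex_RInt_fst|].
  intros t Ht. eapply Rle_trans; [apply Rabs_fst_le|now apply HB]. }
assert (H2 : Rabs (RInt (fun s => snd (f s)) a b) <= (b - a) * B).
{ apply abs_RInt_le_const; [exact Hab|now apply ex_RInt_snd|].
  intros t Ht. eapply Rle_trans; [apply Rabs_snd_le|now apply HB]. }
lra.
Qed.

Lemma Ccont_line (f : C -> C) (z d : C) : entire f -> Ccont (fun t : R => f (z + t * d)%C).
Proof.
intros Hf t.
destruct (Cderiv_at_line f z d _ t (entire_Dop f (z + t * d)%C Hf)) as [H1 H2].
split; apply (ex_derive_continuous (V := R_NormedModule)); eexists; eassumption.
Qed.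

Lemma hline (y t : R) : (t, y) = ((0, y) + t * 1)%C.
Proof. unfold Cplus, Cmult, RtoC; simpl. f_equal; ring. Qed.

Lemma vline (x t : R) : (x, t) = ((x, 0%R) + t * Ci)%C.
Proof. unfold Cplus, Cmult, RtoC, Ci; simpl. f_equal; ring. Qed.

Lemma Ccont_h (f : C -> C) (y : R) : entire f -> Ccont (fun t => f (t, y)).
Proof.
intros Hf. replace (fun t => f (t, y)) with (fun t : R => f ((0%R, y) + t * 1)%C).
- now apply Ccont_line.
- apply functional_extensionality; intros t. now rewrite <- hline.
Qed.

Lemma Ccont_v (f : C -> C) (x : R) : entire f -> Ccont (fun t => f (x, t)).
Proof.
intros Hf. replace (fun t => f (x, t)) with (fun t : R => f ((x, 0%R) + t * Ci)%C).
- now apply Ccont_line.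
- apply functional_extensionality; intros t. now rewrite <- vline.
Qed.

Lemma CInt_h_primitive (Q f : C -> C) (y a b : R) :
  entire f -> (forall z, Cderiv_at Q z (f z)) ->
  CInt (fun t => f (t, y)) a b = (Q (b, y) - Q (a, y))%C.
Proof.
intros Hf HQ. apply (CInt_FTC (fun t => Q (t, y))); [now apply Ccont_h|]. intros t.
destruct (Cderiv_at_line Q (0, y) 1 (f (t, y)) t) as [H1 H2].
- rewrite <- hline. apply HQ.
- rewrite Cmult_1_r in H1, H2.
  split; [revert H1|revert H2]; apply is_derive_ext; intros s; now rewrite <- hline.
Qed.

Lemma CInt_v_primitive (Q f : C -> C) (x a b : R) :
  entire f -> (forall z, Cderiv_at Q z (f z)) ->
  (Ci * CInt (fun t => f (x, t)) a b)%C = (Q (x, b) - Q (x, a))%C.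
Proof.
intros Hf HQ.
replace (CInt (fun t => f (x, t)) a b) with (- Ci * Q (x, b) - (- Ci * Q (x, a)))%C.
{ assert (E : (Ci * Ci = -1)%C) by (unfold Ci, Cmult, RtoC; simpl; f_equal; ring).
  transitivity (- (Ci * Ci) * (Q (x, b) - Q (x, a)))%C; [ring|rewrite E; ring]. }
symmetry. apply (CInt_FTC (fun t => - Ci * Q (x, t))%C); [now apply Ccont_v|]. intros t.
destruct (Cderiv_at_line (fun z => - Ci * Q z)%C (x, 0) Ci (- Ci * f (x, t))%C t) as [H1 H2].
- apply Cderiv_at_scal. rewrite <- vline. apply HQ.
- replace (- Ci * f (x, t) * Ci)%C with (f (x, t)) in H1, H2.
  + split; [revert H1|revert H2]; apply is_derive_ext; intros s; now rewrite <- vline.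
  + apply injective_projections; simpl; ring.
Qed.

(** Counterclockwise boundary integral: [dz = dt] on horizontal sides, [dz = i dt] on vertical ones,
    with a minus sign on the top and left sides. *)
Definition rect_int (f : C -> C) (x y w h : R) : C :=
  (CInt (fun t => f (t, y)) x (x + w) - CInt (fun t => f (t, (y + h)%R)) x (x + w)
   + Ci * (CInt (fun t => f ((x + w)%R, t)) y (y + h) - CInt (fun t => f (x, t)) y (y + h)))%C.

Lemma rect_int_primitive (Q f : C -> C) (x y w h : R) :
  entire f -> (forall z, Cderiv_at Q z (f z)) -> rect_int f x y w h = 0.
Proof.
intros Hf HQ. unfold rect_int.
rewrite !(CInt_h_primitive Q) by assumption.
match goal with |- (_ + Ci * (?A - ?B))%C = _ =>
  replace (Ci * (A - B))%C with (Ci * A - Ci * B)%C by ring end.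
rewrite !(CInt_v_primitive Q) by assumption. ring.
Qed.

Lemma rect_int_plus (f g : C -> C) (x y w h : R) : entire f -> entire g ->
  rect_int (fun z => f z + g z)%C x y w h = (rect_int f x y w h + rect_int g x y w h)%C.
Proof.
intros Hf Hg. unfold rect_int.
rewrite (CInt_plus (fun t => f (t, y)) (fun t => g (t, y))) by now apply Ccont_h.
rewrite (CInt_plus (fun t => f (t, (y + h)%R)) (fun t => g (t, (y + h)%R))) by now apply Ccont_h.
rewrite (CInt_plus (fun t => f (x, t)) (fun t => g (x, t))) by now apply Ccont_v.
rewrite (CInt_plus (fun t => f ((x + w)%R, t)) (fun t => g ((x + w)%R, t))) by now apply Ccont_v.
ring.
Qed.

(** Perimeter [2 * (w + h)] times the factor 2 of [CInt_bound]. *)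
Lemma rect_int_bound (f : C -> C) (x y w h B : R) : entire f -> 0 <= w -> 0 <= h ->
  (forall z : C, x <= fst z <= x + w -> y <= snd z <= y + h -> Cmod (f z) <= B) ->
  Cmod (rect_int f x y w h) <= 4 * B * (w + h).
Proof.
intros Hf Hw Hh HB. unfold rect_int.
assert (H1 := CInt_bound (fun t => f (t, y)) x (x + w) B (Ccont_h f y Hf) ltac:(lra)
  ltac:(intros t Ht; apply HB; simpl; lra)).
assert (H2 := CInt_bound (fun t => f (t, (y + h)%R)) x (x + w) B (Ccont_h f _ Hf) ltac:(lra)
  ltac:(intros t Ht; apply HB; simpl; lra)).
assert (H3 := CInt_bound (fun t => f (x, t)) y (y + h) B (Ccont_v f x Hf) ltac:(lra)
  ltac:(intros t Ht; apply HB; simpl; lra)).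
assert (H4 := CInt_bound (fun t => f ((x + w)%R, t)) y (y + h) B (Ccont_v f _ Hf) ltac:(lra)
  ltac:(intros t Ht; apply HB; simpl; lra)).
eapply Rle_trans; [apply Cmod_triangle|].
rewrite Cmod_mult, Cmod_Ci.
unfold Cminus.
eapply Rle_trans; [apply Rplus_le_compat; [apply Cmod_triangle|]|].
{ apply Rmult_le_compat_l; [lra|apply Cmod_triangle]. }
rewrite !Cmod_opp. lra.
Qed.

Lemma rect_int_quarters (f : C -> C) (x y w h : R) : entire f ->
  rect_int f x y w h =
  (rect_int f x y (w / 2) (h / 2) + rect_int f (x + w / 2) y (w / 2) (h / 2)
   + (rect_int f x (y + h / 2) (w / 2) (h / 2)
      + rect_int f (x + w / 2) (y + h / 2) (w / 2) (h / 2)))%C.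
Proof.
intros Hf. unfold rect_int.
replace (x + w / 2 + w / 2) with (x + w) by field.
replace (y + h / 2 + h / 2) with (y + h) by field.
rewrite (CInt_Chasles (fun t => f (t, y)) x (x + w / 2) (x + w)) by now apply Ccont_h.
rewrite (CInt_Chasles (fun t => f (t, (y + h)%R)) x (x + w / 2) (x + w)) by now apply Ccont_h.
rewrite (CInt_Chasles (fun t => f (x, t)) y (y + h / 2) (y + h)) by now apply Ccont_v.
rewrite (CInt_Chasles (fun t => f ((x + w)%R, t)) y (y + h / 2) (y + h)) by now apply Ccont_v.
ring.
Qed.

Lemma Goursat (f : C -> C) (x y w h : R) : entire f -> 0 < w -> 0 < h ->
  rect_int f x y w h = 0.
Proof.
intros Hf Hw Hh.
(* The bound is exactly additive under quartering, each quarter contributing a fourth of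
   [(w + h) ^ 2], so a local estimate propagates to the whole rectangle. *)
assert (H : forall eps, 0 < eps -> Cmod (rect_int f x y w h) <= 4 * eps * (w + h) ^ 2).
{ intros eps He. revert x y w h Hw Hh.
  apply (rectangle_bisection (fun x y w h => Cmod (rect_int f x y w h) <= 4 * eps * (w + h) ^ 2)).
  - intros x y w h Hw Hh H1 H2 H3 H4. rewrite rect_int_quarters by assumption.
    eapply Rle_trans; [apply Cmod_triangle|].
    eapply Rle_trans; [apply Rplus_le_compat; apply Cmod_triangle|]. nra.
  - intros px py. set (p := (px, py) : C).
    pose proof (entire_Dop f p Hf) as D. rewrite Cderiv_at_eps in D.
    destruct (D eps He) as [del [Hdel Hd]].
    exists (del / 2). split; [lra|]. intros x y w h Hw Hh Hx Hy.
    (* The affine part has a quadratic primitive, so its boundary integral vanishes; what is left is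
       the first-order remainder, at most [eps * (w + h)] on the rectangle. *)
    pose (A := fun z : C => (f p + Dop f p * (z - p))%C).
    assert (HA : entire A).
    { apply entire_plus; [apply entire_const|]. apply entire_scal.
      apply entire_minus; [apply entire_id|apply entire_const]. }
    assert (Hr : entire (fun z => f z - A z)%C) by now apply entire_minus.
    replace (rect_int f x y w h) with
      (rect_int A x y w h + rect_int (fun z => f z - A z)%C x y w h)%C.
    2:{ rewrite <- rect_int_plus by assumption.
        f_equal. apply functional_extensionality; intros z. ring. }
    rewrite (rect_int_primitive (fun z => f p * z + Dop f p * ((z - p) * (z - p) * / 2))%C A); [|exact HA|].
    + rewrite Cplus_0_l.
      eapply Rle_trans; [apply (rect_int_bound _ _ _ _ _ (eps * (w + h)) Hr); [lra|lra|]|].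
      * intros z Hz1 Hz2.
        assert (Hzp : Cmod (z - p)%C <= w + h).
        { eapply Rle_trans; [apply (Cmod_pair_le (fst z - px) (snd z - py))|].
          apply Rplus_le_compat; apply Rabs_le; lra. }
        specialize (Hd (z - p)%C ltac:(lra)).
        replace (p + (z - p))%C with z in Hd by ring.
        replace (f z - A z)%C with (f z - f p - Dop f p * (z - p))%C by (unfold A; ring).
        eapply Rle_trans; [exact Hd|]. apply Rmult_le_compat_l; lra.
      * right; ring.
    + intros z.
      assert (Dm : Cderiv_at (fun w0 : C => w0 - p)%C z (1 - 0)%C)
        by (apply Cderiv_at_minus; [apply Cderiv_at_id|apply Cderiv_at_const]).
      refine (Cderiv_at_ext _ _ _ _ _ _ _
       (Cderiv_at_plus _ _ _ _ _ (Cderiv_at_scal (f p) _ _ _ (Cderiv_at_id z))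
         (Cderiv_at_scal (Dop f p) _ _ _ (Cderiv_at_mult _ _ _ _ _
            (Cderiv_at_mult _ _ _ _ _ Dm Dm) (Cderiv_at_const (/ 2) z))))).
      * intros; reflexivity.
      * unfold A. field. }
apply Cmod_eq_0. apply Rle_antisym; [|apply Cmod_ge_0].
apply le_epsilon. intros eps He.
assert (0 < 4 * (w + h) ^ 2) by nra.
specialize (H (eps / (4 * (w + h) ^ 2)) ltac:(now apply Rdiv_lt_0_compat)).
eapply Rle_trans; [exact H|]. right. field. nra.
Qed.

Lemma Cexp_add_2PI (x t : R) : Cexp (x, t + 2 * PI) = Cexp (x, t).
Proof.
unfold Cexp; simpl. rewrite cos_plus, sin_plus, cos_2PI, sin_2PI. f_equal; ring.
Qed.

Lemma entire_Cexp_opp : entire (fun w => Cexp (- w)).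
Proof.
apply (entire_comp Cexp (fun w => - w)%C); [apply entire_Cexp|].
replace Copp with (fun w => (-1) * w)%C.
- apply entire_scal, entire_id.
- apply functional_extensionality; intros w; ring.
Qed.

(* The circle integral of [f(w) / (w - z)^2] in logarithmic coordinates
   [w = z + exp u] : Goursat makes it independent of the radius, and its limit
   as the radius tends to 0 is [2 i pi f'(z)]. *)
Lemma circle_int_indep (f : C -> C) (z : C) (x x' : R) : entire f -> x < x' ->
  CInt (fun t => f (z + Cexp (x, t)) * Cexp (- (x, t)))%C 0 (2 * PI) =
  CInt (fun t => f (z + Cexp (x', t)) * Cexp (- (x', t)))%C 0 (2 * PI).
Proof.
intros Hf Hx. set (G := fun w : C => (f (z + Cexp w) * Cexp (- w))%C).
assert (HG : entire G).
{ apply entire_mult; [|apply entire_Cexp_opp].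
  apply (entire_comp f (fun w => z + Cexp w)%C); [exact Hf|].
  apply entire_plus; [apply entire_const|apply entire_Cexp]. }
pose proof PI_RGT_0 as Hpi.
pose proof (Goursat G x 0 (x' - x) (2 * PI) HG ltac:(lra) ltac:(lra)) as H.
unfold rect_int in H.
replace (CInt (fun t => G (t, (0 + 2 * PI)%R)) x (x + (x' - x)))
  with (CInt (fun t => G (t, 0)) x (x + (x' - x))) in H.
2:{ apply CInt_ext; intros t. unfold G. rewrite !Cexp_opp.
    now rewrite Cexp_add_2PI. }
replace (x + (x' - x)) with x' in H by ring. rewrite Rplus_0_l in H.
change (CInt (fun t => G (x, t)) 0 (2 * PI) = CInt (fun t => G (x', t)) 0 (2 * PI)).
set (A := CInt (fun t => G (x', t)) 0 (2 * PI)) in *.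
set (B := CInt (fun t => G (x, t)) 0 (2 * PI)) in *.
assert (E : (Ci * (A - B) = 0)%C) by (rewrite <- H; ring).
apply Ceq_minus.
destruct (Ceq_dec (B - A) 0) as [E0|E0]; [exact E0|exfalso].
apply (Cmult_neq_0 Ci (A - B)); [apply Ci_nz| |exact E].
intros E1. apply E0. replace (B - A)%C with (- (A - B))%C by ring. rewrite E1; ring.
Qed.

(** Comparing the circle of radius [r] with a tiny one turns a bound of [f] on the first into a
    bound of the derivative at the centre. The factor 2 is that of [CInt_bound]. *)
Lemma Cauchy_estimate (f : C -> C) (z : C) (r B : R) : entire f -> 0 < r ->
  (forall w, Cmod (w - z) <= r -> Cmod (f w) <= B) -> Cmod (Dop f z) <= 2 * B / r.
Proof.
intros Hf Hr HB. pose proof PI_RGT_0 as Hpi.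
set (X := ln r).
assert (HX : exp X = r) by now apply exp_ln.
apply le_epsilon. intros eps He.
pose proof (entire_Dop f z Hf) as D. rewrite Cderiv_at_eps in D.
destruct (D (eps / 2) ltac:(lra)) as [del [Hdel Hd]].
(* Strictly below both [ln r] and [ln del]: the small circle lies inside the large one and where the
   derivative estimate applies. *)
set (x := Rmin X (ln del) - 1).
assert (HxX : x < X) by (pose proof (Rmin_l X (ln del)); unfold x; lra).
assert (Hxd : exp x < del).
{ rewrite <- (exp_ln del Hdel). apply exp_increasing.
  pose proof (Rmin_r X (ln del)); unfold x; lra. }
pose proof (circle_int_indep f z x X Hf HxX) as E.
assert (HGe : forall y, Ccont (fun t => f (z + Cexp (y, t)) * Cexp (- (y, t)))%C).
{ intros y. apply (Ccont_v (fun w => f (z + Cexp w) * Cexp (- w))%C).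
  apply entire_mult; [|apply entire_Cexp_opp].
  apply (entire_comp f (fun w => z + Cexp w)%C); [exact Hf|].
  apply entire_plus; [apply entire_const|apply entire_Cexp]. }
assert (HV : Cmod (CInt (fun t => f (z + Cexp (X, t)) * Cexp (- (X, t)))%C 0 (2 * PI)) <= 2 * (B / r) * (2 * PI - 0)).
{ apply CInt_bound; [apply HGe|lra|]. intros t _.
  rewrite Cmod_mult, Cexp_opp, Cmod_inv by apply Cexp_neq_0.
  rewrite Cmod_Cexp; simpl fst. rewrite HX. unfold Rdiv.
  apply Rmult_le_compat_r; [left; now apply Rinv_0_lt_compat|]. apply HB.
  replace (z + Cexp (X, t) - z)%C with (Cexp (X, t)) by ring.
  rewrite Cmod_Cexp; simpl. lra. }
rewrite <- E in HV. clear E.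
set (d := Dop f z) in *.
(* On the small circle the integrand is [aff + rho]: the tangent part, integrated exactly, and a
   remainder of modulus at most [eps / 2]. *)
set (rho := fun w : C => ((f (z + Cexp w) - f z - d * Cexp w) * Cexp (- w))%C).
set (aff := fun w : C => (f z * Cexp (- w) + d)%C).
assert (Haff : entire aff).
{ apply entire_plus; [apply entire_scal, entire_Cexp_opp|apply entire_const]. }
assert (Hrho : entire rho).
{ apply entire_mult; [|apply entire_Cexp_opp].
  apply entire_minus; [apply entire_minus|].
  - apply (entire_comp f (fun w => z + Cexp w)%C); [exact Hf|].
    apply entire_plus; [apply entire_const|apply entire_Cexp].
  - apply entire_const.
  - apply entire_scal, entire_Cexp. }
replace (CInt (fun t => f (z + Cexp (x, t)) * Cexp (- (x, t)))%C 0 (2 * PI))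
 with (CInt (fun t => aff (x, t)) 0 (2 * PI) + CInt (fun t => rho (x, t)) 0 (2 * PI))%C in HV.
2:{ rewrite <- CInt_plus by now apply Ccont_v. apply CInt_ext. intros t.
    unfold aff, rho. rewrite Cexp_opp. field. apply Cexp_neq_0. }
(* The term [f z * Cexp (- w)] has a primitive of period [2 * PI] in the imaginary direction, so
   only the constant [d] contributes. *)
assert (HI : (CInt (fun t => aff (x, t)) 0 (2 * PI) = d * RtoC (2 * PI))%C).
{ pose proof (CInt_v_primitive (fun w => f z * ((-1) * Cexp (- w)) + d * w)%C aff x 0 (2 * PI) Haff) as P.
  set (I := CInt (fun t => aff (x, t)) 0 (2 * PI)) in *.
  assert (P' : (Ci * I)%C = (Ci * (d * RtoC (2 * PI)))%C).
  { rewrite P.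
    - rewrite !Cexp_opp. rewrite <- (Rplus_0_l (2 * PI)) at 1. rewrite Cexp_add_2PI.
      apply injective_projections; simpl; ring.
    - intros w. unfold aff.
      assert (Dn : Cderiv_at (fun w => - w)%C w (- (1))%C).
      { refine (Cderiv_at_ext _ _ _ _ _ _ _ (Cderiv_at_scal (-1) _ _ _ (Cderiv_at_id w))).
        intros; ring. ring. }
      refine (Cderiv_at_ext _ _ _ _ _ _ _ (Cderiv_at_plus _ _ _ _ _
        (Cderiv_at_scal (f z) _ _ _ (Cderiv_at_scal (-1) _ _ _
           (Cderiv_at_comp Cexp _ _ _ _ (Cderiv_at_Cexp (- w)) Dn)))
        (Cderiv_at_scal d _ _ _ (Cderiv_at_id w)))).
      intros; reflexivity. ring. }
  apply (f_equal (fun w => / Ci * w)%C) in P'.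
  rewrite 2!Cmult_assoc, Cinv_l, 2!Cmult_1_l in P' by apply Ci_nz. exact P'. }
rewrite HI in HV.
assert (HR : Cmod (CInt (fun t => rho (x, t)) 0 (2 * PI)) <= 2 * (eps / 2) * (2 * PI - 0)).
{ apply CInt_bound; [now apply Ccont_v|lra|]. intros t _. unfold rho.
  specialize (Hd (Cexp (x, t))). rewrite Cmod_Cexp in Hd. simpl fst in Hd.
  specialize (Hd Hxd).
  rewrite Cmod_mult, Cexp_opp, Cmod_inv by apply Cexp_neq_0.
  rewrite Cmod_Cexp; simpl fst. pose proof (exp_pos x).
  replace (eps / 2) with (eps / 2 * exp x * / exp x) by (field; lra).
  apply Rmult_le_compat_r; [left; now apply Rinv_0_lt_compat|]. exact Hd. }
set (J := CInt (fun t => rho (x, t)) 0 (2 * PI)) in *.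
assert (Hd2 : Cmod (d * RtoC (2 * PI))%C <= Cmod (d * RtoC (2 * PI) + J)%C + Cmod J).
{ replace (d * RtoC (2 * PI))%C with ((d * RtoC (2 * PI) + J) + - J)%C at 1 by ring.
  eapply Rle_trans; [apply Cmod_triangle|]. rewrite Cmod_opp; lra. }
rewrite Cmod_mult, Cmod_R, (Rabs_pos_eq (2 * PI)) in Hd2 by lra.
apply Rmult_le_reg_r with (2 * PI); [lra|].
replace ((2 * B / r + eps) * (2 * PI)) with (2 * (B / r) * (2 * PI - 0) + 2 * (eps / 2) * (2 * PI - 0)) by (field; lra).
lra.
Qed.

(** Differentiability bounds [f] near each point; bisection spreads the bound to a square containing
    the disc. *)
Lemma entire_bounded (f : C -> C) (r : R) : entire f ->
  exists B, 0 < B /\ forall z, Cmod z <= r -> Cmod (f z) <= B.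
Proof.
intros Hf. set (s := Rabs r + 1). pose proof (Rabs_pos r).
assert (H1 : exists B, forall z : C, - s <= fst z <= - s + 2 * s ->
  - s <= snd z <= - s + 2 * s -> Cmod (f z) <= B).
{ apply (rectangle_bisection (fun x y w h => exists B, forall z : C, x <= fst z <= x + w ->
    y <= snd z <= y + h -> Cmod (f z) <= B)); [| |unfold s; lra|unfold s; lra].
  - intros x y w h Hw Hh [B1 H1] [B2 H2] [B3 H3] [B4 H4].
    exists (Rmax (Rmax B1 B2) (Rmax B3 B4)). intros z Hx Hy.
    pose proof (Rmax_l (Rmax B1 B2) (Rmax B3 B4)). pose proof (Rmax_r (Rmax B1 B2) (Rmax B3 B4)).
    pose proof (Rmax_l B1 B2). pose proof (Rmax_r B1 B2).
    pose proof (Rmax_l B3 B4). pose proof (Rmax_r B3 B4).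
    destruct (Rle_lt_dec (fst z) (x + w / 2)); destruct (Rle_lt_dec (snd z) (y + h / 2)).
    + specialize (H1 z ltac:(lra) ltac:(lra)). lra.
    + specialize (H3 z ltac:(lra) ltac:(lra)). lra.
    + specialize (H2 z ltac:(lra) ltac:(lra)). lra.
    + specialize (H4 z ltac:(lra) ltac:(lra)). lra.
  - intros px py. set (p := (px, py) : C).
    pose proof (entire_Dop f p Hf) as D. rewrite Cderiv_at_eps in D.
    destruct (D 1 Rlt_0_1) as [del [Hdel Hd]].
    exists (del / 2). split; [lra|]. intros x y w h Hw Hh Hx Hy.
    exists (Cmod (f p) + (Cmod (Dop f p) + 1) * del). intros z Hzx Hzy.
    assert (Hzp : Cmod (z - p)%C < del).
    { eapply Rle_lt_trans; [apply (Cmod_pair_le (fst z - px) (snd z - py))|].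
      apply Rle_lt_trans with (w + h); [|lra].
      apply Rplus_le_compat; apply Rabs_le; lra. }
    specialize (Hd _ Hzp). replace (p + (z - p))%C with z in Hd by ring.
    replace (f z) with (f p + (Dop f p * (z - p) + (f z - f p - Dop f p * (z - p))))%C by ring.
    eapply Rle_trans; [apply Cmod_triangle|]. apply Rplus_le_compat_l.
    eapply Rle_trans; [apply Cmod_triangle|]. rewrite Cmod_mult.
    pose proof (Cmod_ge_0 (Dop f p)). nra. }
destruct H1 as [B HB]. exists (Rmax B 1). split.
{ eapply Rlt_le_trans; [apply Rlt_0_1|apply Rmax_r]. }
intros z Hz. eapply Rle_trans; [|apply Rmax_l].
pose proof (Rabs_fst_le z) as Hx. pose proof (Rabs_snd_le z) as Hy.
pose proof (Rle_abs r). apply Rabs_le_between in Hx. apply Rabs_le_between in Hy.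
apply HB; unfold s; lra.
Qed.

(** A factor [c] of modulus at most 1 turns the increment into its modulus; the real mean value
    theorem then applies to the real part of [c * g] minus [b]. *)
Lemma curve_increment_le (g g' : R -> C) (b b' : R -> R) :
  (forall t, 0 <= t <= 1 -> is_derive (fun s => fst (g s)) t (fst (g' t)) /\
                            is_derive (fun s => snd (g s)) t (snd (g' t))) ->
  (forall t, 0 <= t <= 1 -> is_derive b t (b' t)) ->
  (forall t, 0 <= t <= 1 -> Cmod (g' t) <= b' t) ->
  Cmod (g 1 - g 0)%C <= b 1 - b 0.
Proof.
intros Hg Hb Hle.
set (d := (g 1 - g 0)%C).
assert (Hc : exists c : C, Cmod c <= 1 /\ (c * d)%C = RtoC (Cmod d)).
{ destruct (Ceq_dec d 0) as [->|Hd].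
  - exists 0. rewrite Cmod_0. split; [lra|ring].
  - assert (Hm : Cmod d <> 0) by (intros E; apply Hd; now apply Cmod_eq_0).
    exists (Cconj d * RtoC (/ Cmod d))%C. split.
    + rewrite Cmod_mult, Cmod_conj, Cmod_R, Rabs_pos_eq.
      right; field; exact Hm. left; apply Rinv_0_lt_compat. pose proof (Cmod_ge_0 d); lra.
    + replace (Cconj d * RtoC (/ Cmod d) * d)%C with (d * Cconj d * RtoC (/ Cmod d))%C by ring.
      rewrite <- Cmod2_conj, <- RtoC_mult. f_equal. field; exact Hm. }
destruct Hc as [c [Hc1 Hc2]].
set (phi := fun t => fst c * fst (g t) - snd c * snd (g t) - b t).
set (phi' := fun t => fst c * fst (g' t) - snd c * snd (g' t) - b' t).
assert (Hphi : forall t, 0 <= t <= 1 -> is_derive phi t (phi' t)).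
{ intros t Ht. destruct (Hg t Ht) as [H1 H2]. specialize (Hb t Ht).
  unfold phi, phi'. apply (is_derive_minus (V := R_NormedModule)); [|exact Hb].
  apply (is_derive_minus (V := R_NormedModule)).
  - now apply is_derive_scal.
  - now apply is_derive_scal. }
destruct (MVT_gen phi 0 1 phi') as [xi [Hxi E]].
- rewrite Rmin_left, Rmax_right by lra. intros t Ht. apply Hphi; lra.
- rewrite Rmin_left, Rmax_right by lra. intros t Ht.
  apply continuity_pt_filterlim. apply (ex_derive_continuous (V := R_NormedModule)).
  exists (phi' t). now apply Hphi.
- rewrite Rmin_left, Rmax_right in Hxi by lra.
  assert (Hn : phi' xi <= 0).
  { unfold phi'. specialize (Hle xi Hxi).
    pose proof (Rabs_fst_le (c * g' xi)%C) as Q. rewrite Cmod_mult in Q.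
    simpl in Q. pose proof (Cmod_ge_0 (g' xi)).
    pose proof (Rle_abs (fst c * fst (g' xi) - snd c * snd (g' xi))). nra. }
  assert (E2 : phi 1 - phi 0 = Cmod d - (b 1 - b 0)).
  { apply (f_equal fst) in Hc2. simpl in Hc2. rewrite <- Hc2. unfold phi, d; simpl. ring. }
  lra.
Qed.

Lemma entire_increment_le (f : C -> C) (z h : C) (B : R) : entire f ->
  (forall t, 0 <= t <= 1 -> Cmod (Dop f (z + t * h)%C) <= B) ->
  Cmod (f (z + h) - f z)%C <= B * Cmod h.
Proof.
intros Hf HB.
pose proof (curve_increment_le (fun t => f (z + t * h)%C) (fun t => Dop f (z + t * h) * h)%C
  (fun t => B * Cmod h * t) (fun _ => B * Cmod h)) as P.
cbv beta in P. rewrite Cmult_1_l, Cmult_0_l, Cplus_0_r in P.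
replace (B * Cmod h * 1 - B * Cmod h * 0) with (B * Cmod h) in P by ring. apply P.
- intros t _. apply Cderiv_at_line. now apply entire_Dop.
- intros t _. auto_derive; [exact I|ring].
- intros t Ht. rewrite Cmod_mult. apply Rmult_le_compat_r; [apply Cmod_ge_0|now apply HB].
Qed.

(** With the Cauchy condition split as [e n + e m], letting [m] go to infinity leaves the explicit
    rate [e n]. *)
Lemma Ccauchy_limit (u : nat -> C) (e : nat -> R) : is_lim_seq e 0 ->
  (forall n m, Cmod (u n - u m)%C <= e n + e m) ->
  exists l, forall n, Cmod (u n - l)%C <= e n.
Proof.
intros He Hu.
assert (Hc : forall p : C -> R, (forall z w : C, Rabs (p z - p w) <= Cmod (z - w)%C) ->
  ex_finite_lim_seq (fun n => p (u n))).
{ intros p Hp. apply ex_lim_seq_cauchy_corr. intros eps.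
  apply is_lim_seq_spec in He. destruct (He (pos_div_2 eps)) as [N HN].
  exists N. intros n m Hn Hm. eapply Rle_lt_trans; [apply Hp|].
  eapply Rle_lt_trans; [apply Hu|].
  pose proof (HN n Hn) as A1. pose proof (HN m Hm) as A2. simpl in A1, A2.
  rewrite Rminus_0_r in A1, A2.
  pose proof (Rle_abs (e n)). pose proof (Rle_abs (e m)). lra. }
destruct (Hc fst) as [l1 H1].
{ intros z w. apply (Rabs_fst_le (z - w)%C). }
destruct (Hc snd) as [l2 H2].
{ intros z w. apply (Rabs_snd_le (z - w)%C). }
exists (l1, l2). intros n. apply le_epsilon. intros eps Heps.
apply is_lim_seq_spec in He. apply is_lim_seq_spec in H1. apply is_lim_seq_spec in H2.
assert (Heps3 : 0 < eps / 3) by lra.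
destruct (He (mkposreal _ Heps3)) as [N HN]. destruct (H1 (mkposreal _ Heps3)) as [N1 HN1].
destruct (H2 (mkposreal _ Heps3)) as [N2 HN2]. simpl in HN, HN1, HN2.
set (m := (N + N1 + N2)%nat).
specialize (HN m ltac:(unfold m; lia)). specialize (HN1 m ltac:(unfold m; lia)).
specialize (HN2 m ltac:(unfold m; lia)). rewrite Rminus_0_r in HN. pose proof (Rle_abs (e m)).
replace (u n - (l1, l2))%C with ((u n - u m) + (u m - (l1, l2)))%C by ring.
eapply Rle_trans; [apply Cmod_triangle|].
specialize (Hu n m).
pose proof (Cmod_pair_le (fst (u m) - l1) (snd (u m) - l2)).
change (u m - (l1, l2))%C with ((fst (u m) - l1, snd (u m) - l2) : C). lra.
Qed.

Lemma is_lim_seq_scal_inv_S (K : R) : is_lim_seq (fun n => K / INR (S n)) 0.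
Proof.
replace (Finite 0) with (Rbar_mult K 0) by (simpl; f_equal; ring).
apply is_lim_seq_scal_l.
apply (is_lim_seq_incr_1 (fun n => / INR n)).
replace (Finite 0) with (Rbar_inv p_infty) by reflexivity.
apply is_lim_seq_inv; [apply is_lim_seq_INR|easy].
Qed.

Lemma Rle_limit (a : R) (e : nat -> R) (b : R) : is_lim_seq e 0 ->
  (forall n, a <= b + e n) -> a <= b.
Proof.
intros He H. apply (is_lim_seq_le (fun _ => a) (fun n => b + e n) a b H).
- apply is_lim_seq_const.
- replace (Finite b) with (Rbar_plus b 0) by (simpl; f_equal; ring).
  apply is_lim_seq_plus'; [apply is_lim_seq_const|exact He].
Qed.

Lemma entire_translate (f : C -> C) (h : C) : entire f -> entire (fun z => f (z + h)%C).
Proof.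
intros Hf. apply (entire_comp f (fun z => z + h)%C); [exact Hf|].
apply entire_plus; [apply entire_id|apply entire_const].
Qed.

Lemma Dop_translate (f : C -> C) (h : C) : entire f ->
  Dop (fun z => f (z + h)%C) = (fun z => Dop f (z + h)%C).
Proof.
intros Hf. apply Dop_intro; intros z.
refine (Cderiv_at_ext _ _ _ _ _ _ _ (Cderiv_at_comp f _ z _ _ (entire_Dop f (z + h)%C Hf)
  (Cderiv_at_plus _ _ _ _ _ (Cderiv_at_id z) (Cderiv_at_const h z)))); [reflexivity|ring].
Qed.

Lemma Dop_increment (f : C -> C) (h : C) : entire f ->
  Dop (fun z => f (z + h) - f z)%C = (fun z => Dop f (z + h) - Dop f z)%C.
Proof.
intros Hf. rewrite (Dop_minus (fun z => f (z + h)%C) f (entire_translate f h Hf) Hf).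
now rewrite Dop_translate by exact Hf.
Qed.

Lemma Cmod_plus_le (z h : C) (a b : R) : Cmod z <= a -> Cmod h <= b -> Cmod (z + h)%C <= a + b.
Proof. intros. eapply Rle_trans; [apply Cmod_triangle|]. lra. Qed.

Lemma Cmod_scal_unit_le (t : R) (h : C) (b : R) : 0 <= t <= 1 -> Cmod h <= b -> Cmod (t * h)%C <= b.
Proof.
intros Ht Hh. rewrite Cmod_mult, Cmod_R, Rabs_pos_eq by lra. pose proof (Cmod_ge_0 h). nra.
Qed.

Lemma Cauchy_estimate_disc (f : C -> C) (rho s B : R) : entire f -> 0 < s ->
  (forall z, Cmod z <= rho + s -> Cmod (f z) <= B) ->
  forall z, Cmod z <= rho -> Cmod (Dop f z) <= 2 * B / s.
Proof.
intros Hf Hs HB z Hz. apply Cauchy_estimate; [exact Hf|exact Hs|].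
intros w Hw. apply HB. replace w with (z + (w - z))%C by ring. now apply Cmod_plus_le.
Qed.

(** Cauchy's estimate controls first derivatives only, so it is applied to increments. For
    [f (w + h) - f w] it makes [Dop f] Lipschitz on discs, hence the difference quotients of [f]
    converge uniformly to [Dop f]; for the difference of two such quotients it makes the quotients
    of [Dop f] a Cauchy family. *)
Lemma entire_Dop_entire (f : C -> C) : entire f -> entire (Dop f).
Proof.
intros Hf z. set (R0 := Cmod z).
(* The margin 5 leaves room for the unit discs consumed by the successive Cauchy estimates and
   translations. *)
destruct (entire_bounded f (R0 + 5) Hf) as [B [HB0 HB]].
assert (HD : forall w, Cmod w <= R0 + 4 -> Cmod (Dop f w) <= 2 * B).
{ intros w Hw. replace (2 * B) with (2 * B / 1) by field.
  apply (Cauchy_estimate_disc f (R0 + 4) 1 B Hf); [lra| |exact Hw].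
  intros; apply HB; lra. }
assert (Hlip : forall w h, Cmod w <= R0 + 2 -> Cmod h <= 1 ->
  Cmod (Dop f (w + h) - Dop f w)%C <= 4 * B * Cmod h).
{ intros w h Hw Hh.
  assert (He : entire (fun w => f (w + h) - f w)%C).
  { apply entire_minus; [now apply entire_translate|exact Hf]. }
  replace (Dop f (w + h) - Dop f w)%C with (Dop (fun w => f (w + h) - f w)%C w).
  2:{ now rewrite Dop_increment. }
  replace (4 * B * Cmod h) with (2 * (2 * B * Cmod h) / 1) by field.
  apply (Cauchy_estimate_disc _ (R0 + 2) 1 _ He); [lra| |exact Hw].
  intros v Hv. apply entire_increment_le; [exact Hf|]. intros t Ht. apply HD.
  pose proof (Cmod_plus_le v (t * h)%C _ _ Hv (Cmod_scal_unit_le t h 1 Ht Hh)). lra. }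
assert (Hq : forall w h, Cmod w <= R0 + 2 -> Cmod h <= 1 ->
  Cmod (f (w + h) - f w - Dop f w * h)%C <= 4 * B * Cmod h * Cmod h).
{ intros w h Hw Hh.
  pose proof (curve_increment_le (fun t => f (w + t * h) - f w - Dop f w * (t * h))%C
    (fun t => (Dop f (w + t * h) - Dop f w) * h)%C
    (fun t => 4 * B * Cmod h * Cmod h * t) (fun _ => 4 * B * Cmod h * Cmod h)) as P.
  cbv beta in P. rewrite Cmult_1_l, Cmult_0_l, Cplus_0_r in P.
  replace (f w - f w - Dop f w * 0)%C with (RtoC 0) in P by ring.
  replace (f (w + h) - f w - Dop f w * h - 0)%C with (f (w + h) - f w - Dop f w * h)%C in P by ring.
  replace (4 * B * Cmod h * Cmod h * 1 - 4 * B * Cmod h * Cmod h * 0) with (4 * B * Cmod h * Cmod h) in P by ring.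
  apply P.
  - intros t _.
    pose (k := fun v => (f v - f w - Dop f w * (v - w))%C).
    assert (Hk : Cderiv_at k (w + t * h)%C (Dop f (w + t * h) - 0 - Dop f w * (1 - 0))%C).
    { apply (Cderiv_at_minus (fun v => f v - f w)%C).
      - apply Cderiv_at_minus; [now apply entire_Dop|apply Cderiv_at_const].
      - apply Cderiv_at_scal. apply Cderiv_at_minus; [apply Cderiv_at_id|apply Cderiv_at_const]. }
    apply Cderiv_at_line in Hk.
    replace ((Dop f (w + t * h) - 0 - Dop f w * (1 - 0)) * h)%C with
      ((Dop f (w + t * h) - Dop f w) * h)%C in Hk by ring.
    destruct Hk as [K1 K2].
    split; [revert K1|revert K2]; apply is_derive_ext; intros s; unfold k; f_equal; ring.
  - intros t _. auto_derive; [exact I|ring].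
  - intros t Ht. rewrite Cmod_mult. apply Rmult_le_compat_r; [apply Cmod_ge_0|].
    eapply Rle_trans; [apply Hlip; [exact Hw|now apply Cmod_scal_unit_le]|].
    apply Rmult_le_compat_l; [lra|]. apply Cmod_scal_unit_le; [exact Ht|lra]. }
pose (q := fun h : C => ((Dop f (z + h) - Dop f z) / h)%C).
assert (Hqq : forall h k : C, h <> 0 -> k <> 0 -> Cmod h <= 1 -> Cmod k <= 1 ->
  Cmod (q h - q k)%C <= 8 * B * Cmod h + 8 * B * Cmod k).
{ intros h k Hh0 Hk0 Hh Hk.
  pose (F := fun v => (/ h * (f (v + h) - f v) - / k * (f (v + k) - f v))%C).
  assert (Hdiff : forall d, entire (fun v => f (v + d) - f v)%C).
  { intros d. apply entire_minus; [now apply entire_translate|exact Hf]. }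
  assert (HF : entire F) by (apply entire_minus; now apply entire_scal).
  replace (q h - q k)%C with (Dop F z).
  2:{ unfold F. rewrite (Dop_minus (fun v => / h * (f (v + h) - f v))%C (fun v => / k * (f (v + k) - f v))%C)
        by now apply entire_scal.
      rewrite (Dop_scal (/ h) (fun v => f (v + h) - f v)%C), (Dop_scal (/ k) (fun v => f (v + k) - f v)%C) by auto.
      rewrite 2!Dop_increment by exact Hf. unfold q. field. split; assumption. }
  replace (8 * B * Cmod h + 8 * B * Cmod k) with (2 * (4 * B * Cmod h + 4 * B * Cmod k) / 1) by field.
  apply (Cauchy_estimate_disc F R0 1 _ HF); [lra| |unfold R0; lra].
  intros w Hw.
  assert (Hone : forall d : C, d <> 0 -> Cmod d <= 1 ->
    Cmod (/ d * (f (w + d) - f w) - Dop f w)%C <= 4 * B * Cmod d).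
  { intros d Hd0 Hd. specialize (Hq w d ltac:(lra) Hd).
    replace (/ d * (f (w + d) - f w) - Dop f w)%C with (/ d * (f (w + d) - f w - Dop f w * d))%C
      by (field; exact Hd0).
    rewrite Cmod_mult, Cmod_inv by exact Hd0.
    apply Cmod_gt_0 in Hd0 as Hdp.
    apply Rmult_le_reg_l with (Cmod d); [exact Hdp|].
    rewrite <- Rmult_assoc, Rinv_r, Rmult_1_l by lra. lra. }
  unfold F. pose proof (Hone h Hh0 Hh). pose proof (Hone k Hk0 Hk).
  replace (/ h * (f (w + h) - f w) - / k * (f (w + k) - f w))%C with
   ((/ h * (f (w + h) - f w) - Dop f w) + - (/ k * (f (w + k) - f w) - Dop f w))%C by ring.
  eapply Rle_trans; [apply Cmod_triangle|]. rewrite Cmod_opp. lra. }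
assert (Hsn : forall n, 0 < / INR (S n) <= 1).
{ intros n. split; [apply Rinv_0_lt_compat, lt_0_INR; lia|].
  rewrite <- Rinv_1. apply Rinv_le_contravar; [lra|]. apply (le_INR 1); lia. }
assert (Hs0 : forall n, RtoC (/ INR (S n)) <> 0).
{ intros n E. apply RtoC_inj in E. specialize (Hsn n); lra. }
assert (Hs1 : forall n, Cmod (/ INR (S n))%R = / INR (S n)).
{ intros n. rewrite Cmod_R, Rabs_pos_eq; [easy|]. specialize (Hsn n); lra. }
(* The increments [1 / (n + 1)] produce the candidate [l]; an arbitrary [h] is then compared with
   them. *)
destruct (Ccauchy_limit (fun n => q (RtoC (/ INR (S n)))) (fun n => 8 * B / INR (S n))) as [l Hl].
{ apply is_lim_seq_scal_inv_S. }
{ intros n m. pose proof (Hqq _ _ (Hs0 n) (Hs0 m)) as P. rewrite !Hs1 in P.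
  unfold Rdiv. apply P; apply Hsn. }
exists l. apply Cderiv_at_eps. intros eps He.
exists (Rmin 1 (eps / (8 * B))). split.
{ apply Rmin_glb_lt; [lra|]. apply Rdiv_lt_0_compat; lra. }
intros h Hh.
assert (Hh1 : Cmod h <= 1) by (pose proof (Rmin_l 1 (eps / (8 * B))); lra).
assert (Hh2 : 8 * B * Cmod h <= eps).
{ pose proof (Rmin_r 1 (eps / (8 * B))).
  apply Rle_trans with (8 * B * (eps / (8 * B))); [apply Rmult_le_compat_l; lra|].
  right; field; lra. }
destruct (Ceq_dec h 0) as [->|Hh0].
{ replace (Dop f (z + 0) - Dop f z - l * 0)%C with (RtoC 0) by (rewrite Cplus_0_r; ring).
  rewrite Cmod_0. lra. }
replace (Dop f (z + h) - Dop f z - l * h)%C with ((q h - l) * h)%C by (unfold q; field; exact Hh0).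
rewrite Cmod_mult. apply Rmult_le_compat_r; [apply Cmod_ge_0|].
apply Rle_trans with (8 * B * Cmod h); [|exact Hh2].
apply (Rle_limit _ (fun n => (16 * B) / INR (S n))); [apply is_lim_seq_scal_inv_S|].
intros n. pose proof (Hqq _ _ Hh0 (Hs0 n) Hh1) as P. rewrite Hs1 in P.
specialize (P ltac:(apply Hsn)). specialize (Hl n).
replace (q h - l)%C with ((q h - q (RtoC (/ INR (S n)))) + (q (RtoC (/ INR (S n))) - l))%C by ring.
eapply Rle_trans; [apply Cmod_triangle|]. unfold Rdiv in *. lra.
Qed.

(** * Taylor expansions and limits of entire functions *)

Fixpoint psum (u : nat -> C) (n : nat) : C :=
  match n with O => 0 | S m => psum u m + u m end%C.

Lemma psum_ext (u v : nat -> C) (n : nat) : (forall k, (k < n)%nat -> u k = v k) -> psum u n = psum v n.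
Proof.
induction n as [|n IH]; intros H; [easy|]. simpl. rewrite IH, H; auto.
Qed.

Lemma psum_plus (u v : nat -> C) (n : nat) :
  psum (fun k => u k + v k)%C n = (psum u n + psum v n)%C.
Proof. induction n as [|n IH]; simpl; [ring|rewrite IH; ring]. Qed.

Lemma psum_scal (c : C) (u : nat -> C) (n : nat) :
  psum (fun k => c * u k)%C n = (c * psum u n)%C.
Proof. induction n as [|n IH]; simpl; [ring|rewrite IH; ring]. Qed.

Lemma psum_zero (u : nat -> C) (n : nat) : (forall k, (k < n)%nat -> u k = 0) -> psum u n = 0.
Proof. induction n as [|n IH]; intros H; [easy|]. simpl. rewrite IH, H; auto. ring. Qed.

Lemma psum_S_l (u : nat -> C) (n : nat) : psum u (S n) = (u O + psum (fun k => u (S k)) n)%C.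
Proof. induction n as [|n IH]; [simpl; ring|]. change (psum u (S (S n))) with (psum u (S n) + u (S n))%C.
rewrite IH. simpl. ring. Qed.

Lemma Cmod_psum_le (u : nat -> C) (B : R) (n : nat) :
  (forall k, (k < n)%nat -> Cmod (u k) <= B) -> Cmod (psum u n) <= INR n * B.
Proof.
induction n as [|n IH]; intros H.
- simpl. rewrite Cmod_0. lra.
- rewrite S_INR. simpl psum. eapply Rle_trans; [apply Cmod_triangle|].
  specialize (IH ltac:(auto)). specialize (H n ltac:(auto)). lra.
Qed.

Lemma entire_psum (u : nat -> C -> C) (n : nat) : (forall k, entire (u k)) ->
  entire (fun z => psum (fun k => u k z) n).
Proof.
intros H. induction n as [|n IH]; simpl; [apply entire_const|now apply entire_plus].
Qed.

Lemma entire_iter_Dop (n : nat) (f : C -> C) : entire f -> entire (Nat.iter n Dop f).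
Proof. intros Hf. induction n; simpl; [exact Hf|now apply entire_Dop_entire]. Qed.

Lemma iter_Dop_plus (n : nat) (f g : C -> C) : entire f -> entire g ->
  Nat.iter n Dop (fun z => f z + g z)%C = (fun z => Nat.iter n Dop f z + Nat.iter n Dop g z)%C.
Proof.
intros Hf Hg. induction n as [|n IH]; [easy|]. simpl. rewrite IH.
now apply Dop_plus; apply entire_iter_Dop.
Qed.

Lemma iter_Dop_scal (n : nat) (c : C) (f : C -> C) : entire f ->
  Nat.iter n Dop (fun z => c * f z)%C = (fun z => c * Nat.iter n Dop f z)%C.
Proof.
intros Hf. induction n as [|n IH]; [easy|]. simpl. rewrite IH.
now apply Dop_scal; apply entire_iter_Dop.
Qed.

Lemma pow_le_fact (x : R) (n : nat) : 0 <= x -> x ^ n / INR (fact n) <= exp x.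
Proof.
intros Hx. eapply Rle_trans; [|apply (exp_ge_taylor x n Hx)].
assert (Hpos : forall k, 0 <= x ^ k / INR (fact k)).
{ intros k. apply Rmult_le_pos; [now apply pow_le|].
  left. apply Rinv_0_lt_compat, INR_fact_lt_0. }
destruct n as [|n]; simpl; [lra|].
assert (0 <= sum_f_R0 (fun k => x ^ k / INR (fact k)) n).
{ apply cond_pos_sum. intros; apply Hpos. }
lra.
Qed.

(** The term of index [n] in the series of [exp (INR n)] is at most [exp 1 ^ n], and
    [exp 1 <= 3]. *)
Lemma pow_n_le_fact (n : nat) : INR n ^ n <= INR (fact n) * 3 ^ n.
Proof.
pose proof (INR_fact_lt_0 n) as Hf.
apply Rmult_le_reg_r with (/ INR (fact n)); [now apply Rinv_0_lt_compat|].
replace (INR (fact n) * 3 ^ n * / INR (fact n)) with (3 ^ n) by (field; lra).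
eapply Rle_trans; [apply (pow_le_fact (INR n) n (pos_INR n))|].
replace (exp (INR n)) with (exp 1 ^ n).
- apply pow_incr. split; [left; apply exp_pos|apply exp_le_3].
- induction n as [|n IH]; [simpl; now rewrite exp_0|].
  rewrite S_INR, exp_plus, <- IH by apply INR_fact_lt_0. simpl; ring.
Qed.

Lemma iter_Dop_bound_step (f : C -> C) (t B : R) (n : nat) (rho : R) : entire f -> 0 < t ->
  (forall z, Cmod z <= rho + INR n * t -> Cmod (f z) <= B) ->
  forall z, Cmod z <= rho -> Cmod (Nat.iter n Dop f z) <= (2 / t) ^ n * B.
Proof.
intros Hf Ht. revert rho. induction n as [|n IH]; intros rho HB z Hz.
- simpl. rewrite Rmult_1_l. apply HB. simpl. lra.
- simpl Nat.iter. replace ((2 / t) ^ S n * B) with (2 * ((2 / t) ^ n * B) / t) by (simpl; field; lra).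
  apply (Cauchy_estimate_disc _ rho t); [now apply entire_iter_Dop|exact Ht| |exact Hz].
  apply IH. intros w Hw. apply HB. rewrite S_INR. lra.
Qed.

(** The margin [s] is cut into [n] equal steps, one per derivative, each costing a factor
    [2 * n / s]; the resulting [n ^ n] is absorbed by [fact n * 3 ^ n], whence [6 / s]. *)
Lemma iter_Dop_bound (f : C -> C) (s B rho : R) (n : nat) : entire f -> 0 < s ->
  (forall z, Cmod z <= rho + s -> Cmod (f z) <= B) ->
  forall z, Cmod z <= rho -> Cmod (Nat.iter n Dop f z) <= INR (fact n) * (6 / s) ^ n * B.
Proof.
intros Hf Hs HB z Hz.
assert (HB0 : 0 <= B) by (eapply Rle_trans; [apply Cmod_ge_0|apply (HB z); lra]).
destruct n as [|n].
- simpl. rewrite 2!Rmult_1_l. apply HB. lra.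
- set (m := S n). assert (Hm : 0 < INR m) by (apply lt_0_INR; unfold m; lia).
  eapply Rle_trans; [apply (iter_Dop_bound_step f (s / INR m) B m rho Hf)|].
  + now apply Rdiv_lt_0_compat.
  + intros w Hw. apply HB. replace (INR m * (s / INR m)) with s in Hw by (field; lra). exact Hw.
  + exact Hz.
  + apply Rmult_le_compat_r; [exact HB0|].
    replace (2 / (s / INR m)) with (INR m * (2 / s)) by (field; lra).
    replace (6 / s) with (3 * (2 / s)) by (field; lra).
    rewrite 2!Rpow_mult_distr, <- Rmult_assoc.
    apply Rmult_le_compat_r; [|apply pow_n_le_fact].
    apply pow_le. left; apply Rdiv_lt_0_compat; lra.
Qed.

Definition tpoly (c : nat -> C) (n : nat) (v : C) : C :=
  psum (fun k => c k * v ^ k / INR (fact k))%C n.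

Lemma RtoC_fact_neq_0 (n : nat) : RtoC (INR (fact n)) <> 0.
Proof. apply RtoC_neq_0, INR_fact_neq_0. Qed.

Lemma Cderiv_at_tpoly (c : nat -> C) (n : nat) (v : C) :
  Cderiv_at (tpoly c (S n)) v (tpoly (fun k => c (S k)) n v).
Proof.
unfold tpoly. induction n as [|n IH].
- refine (Cderiv_at_ext _ _ _ _ _ _ _ (Cderiv_at_const (c O) v)); [|reflexivity].
  intros w; simpl. field.
- assert (HT : Cderiv_at (fun v => c (S n) / INR (fact (S n)) * v ^ S n)%C v
    (c (S n) / INR (fact (S n)) * (INR (S n) * v ^ n * 1))%C).
  { apply Cderiv_at_scal, (Cderiv_at_pow (fun v => v)), Cderiv_at_id. }
  refine (Cderiv_at_ext _ _ _ _ _ _ _ (Cderiv_at_plus _ _ _ _ _ IH HT)).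
  + intros w. change (psum (fun k => c k * w ^ k / INR (fact k))%C (S (S n))) with
     (psum (fun k => c k * w ^ k / INR (fact k))%C (S n) + c (S n) * w ^ S n / INR (fact (S n)))%C.
    f_equal. unfold Cdiv. ring.
  + match goal with |- _ = psum ?F (S n) => change (psum F (S n)) with (psum F n + F n)%C end.
    cbv beta. f_equal. rewrite fact_simpl, mult_INR, RtoC_mult.
    field. split; [apply RtoC_fact_neq_0|].
    now apply RtoC_neq_0, not_0_INR.
Qed.

Lemma is_derive_scal_pow (K : R) (n : nat) (t : R) :
  is_derive (fun s => K * s ^ S n) t (K * (INR (S n) * t ^ n)).
Proof.
apply is_derive_scal.
replace (INR (S n) * t ^ n) with (INR (S n) * 1 * t ^ pred (S n)) by (simpl pred; ring).
apply (is_derive_pow (fun s => s) (S n) t 1). apply (is_derive_id (K := R_AbsRing)).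
Qed.

(** Induction through the derivative of the remainder along the segment from [z] to [z + h]: the
    case [n] for [Dop f] bounds it by the derivative of a multiple of [t ^ S n], and the mean value
    inequality integrates this. *)
Lemma Taylor_remainder (n : nat) : forall (f : C -> C) (z h : C) (B : R), entire f ->
  (forall t, 0 <= t <= 1 -> Cmod (Nat.iter n Dop f (z + t * h)%C) <= B) ->
  Cmod (f (z + h) - tpoly (fun k => Nat.iter k Dop f z) n h)%C <= B * Cmod h ^ n / INR (fact n).
Proof.
induction n as [|n IH]; intros f z h B Hf HB.
- specialize (HB 1 ltac:(lra)). simpl in HB. rewrite Cmult_1_l in HB.
  unfold tpoly; simpl. replace (f (z + h) - 0)%C with (f (z + h)%C) by ring. lra.
- set (c := fun k => Nat.iter k Dop f z).
  set (m := Cmod h). pose proof (Cmod_ge_0 h) as Hm. fold m in Hm.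
  pose proof (INR_fact_lt_0 n) as Hfn. pose proof (INR_fact_lt_0 (S n)) as HfSn.
  assert (HSn : 0 < INR (S n)) by (apply lt_0_INR; lia).
  pose proof (curve_increment_le (fun t => f (z + t * h) - tpoly c (S n) (t * h))%C
   (fun t => (Dop f (z + t * h) - tpoly (fun k => c (S k)) n (t * h)) * h)%C
   (fun t => B * m ^ S n / INR (fact (S n)) * t ^ S n)
   (fun t => B * m ^ S n / INR (fact n) * t ^ n)) as P.
  cbv beta in P. rewrite Cmult_1_l, Cmult_0_l, Cplus_0_r in P.
  assert (E0 : (f z - tpoly c (S n) 0)%C = 0).
  { unfold tpoly. rewrite psum_S_l, psum_zero.
    - unfold c; simpl. field.
    - intros k _. simpl Cpow. unfold Cdiv. ring. }
  rewrite E0 in P.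
  replace (f (z + h) - tpoly c (S n) h - 0)%C with (f (z + h) - tpoly c (S n) h)%C in P by ring.
  rewrite pow1, pow_i, Rmult_0_r, Rminus_0_r, Rmult_1_r in P by lia.
  apply P.
  + intros t Ht.
    assert (Hk : Cderiv_at (fun v => f v - tpoly c (S n) (v - z))%C (z + t * h)%C
       (Dop f (z + t * h) - tpoly (fun k => c (S k)) n (z + t * h - z) * (1 - 0))%C).
    { apply Cderiv_at_minus; [now apply entire_Dop|].
      apply (Cderiv_at_comp (tpoly c (S n)) (fun v => v - z)%C); [apply Cderiv_at_tpoly|].
      apply Cderiv_at_minus; [apply Cderiv_at_id|apply Cderiv_at_const]. }
    apply Cderiv_at_line in Hk.
    replace (z + t * h - z)%C with (t * h)%C in Hk by ring.
    replace (1 - 0)%C with (RtoC 1) in Hk by ring. rewrite Cmult_1_r in Hk.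
    destruct Hk as [K1 K2].
    split; [revert K1|revert K2]; apply is_derive_ext; intros s; do 3 f_equal; ring.
  + intros t _.
    replace (B * m ^ S n / INR (fact n) * t ^ n)
      with (B * m ^ S n / INR (fact (S n)) * (INR (S n) * t ^ n)).
    * apply is_derive_scal_pow.
    * rewrite fact_simpl, mult_INR. field. split; lra.
  + intros t Ht. rewrite Cmod_mult. fold m.
    replace (B * m ^ S n / INR (fact n) * t ^ n) with (B * (t * m) ^ n / INR (fact n) * m)
      by (rewrite Rpow_mult_distr; simpl; field; lra).
    apply Rmult_le_compat_r; [exact Hm|].
    replace (tpoly (fun k => c (S k)) n (t * h)) with
      (tpoly (fun k => Nat.iter k Dop (Dop f) z) n (t * h)).
    2:{ unfold tpoly. apply psum_ext. intros k _. unfold c. now rewrite Nat.iter_succ_r. }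
    replace (t * m) with (Cmod (t * h)%C) by (rewrite Cmod_mult, Cmod_R, Rabs_pos_eq; [reflexivity|lra]).
    apply IH; [now apply entire_Dop_entire|].
    intros s Hs. rewrite <- Nat.iter_succ_r.
    replace (z + s * (t * h))%C with (z + (s * t)%R * h)%C by (rewrite RtoC_mult; ring).
    apply HB. nra.
Qed.

Lemma entire_Taylor (f : C -> C) (rho : R) : entire f ->
  exists K, 0 < K /\ forall n z, Cmod z <= rho ->
    Cmod (f z - tpoly (fun k => Nat.iter k Dop f 0) n z)%C <= K / 2 ^ n.
Proof.
intros Hf. set (r := Rabs rho + 1). pose proof (Rabs_pos rho) as Hr0. pose proof (Rle_abs rho) as Hr1.
(* With margin [12 * r] the bound on derivatives has ratio [6 / (12 * r)], and [Cmod z <= r] leaves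
   the rate [1 / 2]. *)
destruct (entire_bounded f (r + 12 * r) Hf) as [B [HB0 HB]].
exists B; split; [exact HB0|]. intros n z Hz.
assert (Hzr : Cmod z <= r) by (unfold r; lra).
assert (Hb : forall w, Cmod w <= r -> Cmod (Nat.iter n Dop f w) <= INR (fact n) * (6 / (12 * r)) ^ n * B).
{ apply iter_Dop_bound; [exact Hf|unfold r; lra|exact HB]. }
pose proof (Taylor_remainder n f 0 z (INR (fact n) * (6 / (12 * r)) ^ n * B) Hf) as P.
rewrite Cplus_0_l in P. eapply Rle_trans; [apply P|].
- intros t Ht. rewrite Cplus_0_l. apply Hb. now apply Cmod_scal_unit_le.
- pose proof (INR_fact_lt_0 n). pose proof (Cmod_ge_0 z).
  replace (INR (fact n) * (6 / (12 * r)) ^ n * B * Cmod z ^ n / INR (fact n))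
    with (B * (Cmod z / (2 * r)) ^ n).
  2:{ replace (Cmod z / (2 * r)) with (6 / (12 * r) * Cmod z) by (unfold r; field; lra).
      rewrite Rpow_mult_distr. field; lra. }
  unfold Rdiv. apply Rmult_le_compat_l; [lra|]. rewrite <- pow_inv.
  apply pow_incr. split.
  + apply Rmult_le_pos; [lra|]. left; apply Rinv_0_lt_compat; unfold r; lra.
  + apply Rmult_le_reg_r with (2 * r); [unfold r; lra|]. rewrite Rmult_assoc, Rinv_l by (unfold r; lra).
    lra.
Qed.

Lemma Cmod_minus_sym (z w : C) : Cmod (z - w)%C = Cmod (w - z)%C.
Proof. rewrite <- Cmod_opp. f_equal; ring. Qed.

Lemma Cmod_minus_triangle (x y z : C) : Cmod (x - z)%C <= Cmod (x - y)%C + Cmod (y - z)%C.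
Proof. replace (x - z)%C with ((x - y) + (y - z))%C by ring. apply Cmod_triangle. Qed.

Lemma is_lim_seq_scal_0 (k : R) (e : nat -> R) : is_lim_seq e 0 -> is_lim_seq (fun n => k * e n) 0.
Proof.
intros He. replace (Finite 0) with (Rbar_mult k 0) by (simpl; f_equal; ring).
now apply is_lim_seq_scal_l.
Qed.

Lemma is_lim_seq_div_pow2 (K : R) : is_lim_seq (fun n => K / 2 ^ n) 0.
Proof.
apply is_lim_seq_ext with (fun n => K * (/ 2) ^ n).
{ intros n. now rewrite pow_inv. }
apply is_lim_seq_scal_0. apply is_lim_seq_geom. rewrite Rabs_pos_eq; lra.
Qed.

(** Weierstrass' theorem: Cauchy's estimate makes the derivatives at [z] converge and bounds the
    second derivatives uniformly, so the quadratic Taylor estimate survives the limit. *)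
Lemma entire_limit (u : nat -> C -> C) (f : C -> C) : (forall n, entire (u n)) ->
  (forall rho, exists e, is_lim_seq e 0 /\
     forall n z, Cmod z <= rho -> Cmod (u n z - f z)%C <= e n) ->
  entire f.
Proof.
intros Hu Hlim z. set (rho := Cmod z + 1).
destruct (Hlim (rho + 1)) as [e [He HeB]].
assert (Huu : forall n m w, Cmod w <= rho + 1 -> Cmod (u n w - u m w)%C <= e n + e m).
{ intros n m w Hw. eapply Rle_trans; [apply (Cmod_minus_triangle _ (f w))|].
  rewrite (Cmod_minus_sym (f w)). now apply Rplus_le_compat; apply HeB. }
assert (HD : forall n m, Cmod (Dop (u n) z - Dop (u m) z)%C <= 2 * e n + 2 * e m).
{ intros n m. pose proof (Dop_minus _ _ (Hu n) (Hu m)) as E.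
  apply (f_equal (fun g => g z)) in E. rewrite <- E.
  replace (2 * e n + 2 * e m) with (2 * (e n + e m) / 1) by field.
  apply (Cauchy_estimate_disc _ rho 1); [now apply entire_minus|lra|now apply Huu|].
  unfold rho; lra. }
destruct (Ccauchy_limit _ _ (is_lim_seq_scal_0 2 e He) HD) as [l Hl].
assert (He1 : exists N, forall n, (N <= n)%nat -> e n <= 1).
{ apply is_lim_seq_spec in He. destruct (He (mkposreal 1 Rlt_0_1)) as [N HN].
  exists N. intros n Hn. specialize (HN n Hn). simpl in HN. rewrite Rminus_0_r in HN.
  pose proof (Rle_abs (e n)). lra. }
destruct He1 as [N HN].
destruct (entire_bounded (u N) (rho + 1) (Hu N)) as [B [HB0 HB]].
assert (HnB : forall n w, (N <= n)%nat -> Cmod w <= rho + 1 -> Cmod (u n w) <= B + 2).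
{ intros n w Hn Hw. replace (u n w) with (u N w + (u n w - u N w))%C by ring.
  eapply Rle_trans; [apply Cmod_triangle|]. specialize (HB w Hw). specialize (Huu n N w Hw).
  pose proof (HN n Hn). pose proof (HN N (le_n N)). lra. }
set (K := INR (fact 2) * (6 / 1) ^ 2 * (B + 2)).
assert (HK : forall n h, (N <= n)%nat -> Cmod h <= 1 ->
  Cmod (u n (z + h) - u n z - Dop (u n) z * h)%C <= K * Cmod h ^ 2).
{ intros n h Hn Hh.
  assert (HB2 : forall w, Cmod w <= rho -> Cmod (Nat.iter 2 Dop (u n) w) <= K).
  { apply (iter_Dop_bound (u n) 1 (B + 2) rho 2 (Hu n)); [lra|].
    intros w Hw. now apply HnB. }
  pose proof (Taylor_remainder 2 (u n) z h K (Hu n)) as P.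
  replace (u n (z + h) - u n z - Dop (u n) z * h)%C with
    (u n (z + h) - tpoly (fun k => Nat.iter k Dop (u n) z) 2 h)%C.
  2:{ unfold tpoly; simpl. field. }
  eapply Rle_trans; [apply P|].
  - intros t Ht. apply HB2. apply Cmod_plus_le; [lra|]. now apply Cmod_scal_unit_le.
  - assert (0 <= K) by (unfold K; simpl; lra).
    pose proof (pow2_ge_0 (Cmod h)). change (INR (fact 2)) with 2. nra. }
exists l. apply Cderiv_at_eps. intros eps Heps.
assert (HK0 : 0 < K) by (unfold K; simpl; lra).
exists (Rmin 1 (eps / K)). split.
{ apply Rmin_glb_lt; [lra|now apply Rdiv_lt_0_compat]. }
intros h Hh.
assert (Hh1 : Cmod h <= 1) by (pose proof (Rmin_l 1 (eps / K)); lra).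
pose proof (Cmod_ge_0 h) as Hh0.
apply Rle_trans with (K * Cmod h ^ 2).
- apply (Rle_limit _ (fun n => 4 * e (n + N)%nat)).
  { apply is_lim_seq_scal_0. now apply (is_lim_seq_incr_n e N 0). }
  intros n. set (m := (n + N)%nat).
  specialize (HK m h ltac:(unfold m; lia) Hh1). specialize (Hl m).
  assert (A1 := HeB m (z + h)%C ltac:(apply Rle_trans with (Cmod z + 1); [now apply Cmod_plus_le; [lra|]|unfold rho; lra])).
  assert (A2 := HeB m z ltac:(unfold rho; lra)).
  replace (f (z + h) - f z - l * h)%C with
   ((u m (z + h) - u m z - Dop (u m) z * h) + (- (u m (z + h) - f (z + h)) + ((u m z - f z) + (Dop (u m) z - l) * h)))%C
   by ring.
  eapply Rle_trans; [apply Cmod_triangle|]. apply Rplus_le_compat; [exact HK|].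
  eapply Rle_trans; [apply Cmod_triangle|]. rewrite Cmod_opp.
  eapply Rle_trans; [apply Rplus_le_compat_l, Cmod_triangle|]. rewrite Cmod_mult.
  pose proof (Cmod_ge_0 (Dop (u m) z - l)%C). nra.
- pose proof (Rmin_r 1 (eps / K)) as Hr.
  assert (K * Cmod h <= eps).
  { apply Rle_trans with (K * (eps / K)); [apply Rmult_le_compat_l; lra|right; field; lra]. }
  simpl. nra.
Qed.

(** * Geometrically dominated series and the operator [Phi(D)] *)

Lemma psum_sum_n (u : nat -> C) (p : C -> R) (n : nat) :
  (forall z w, p (z + w)%C = p z + p w) -> p 0 = 0 ->
  p (psum u (S n)) = sum_n (fun k => p (u k)) n.
Proof.
intros Hp H0. induction n as [|n IH].
- rewrite sum_O. simpl. now rewrite Hp, H0, Rplus_0_l.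
- rewrite sum_Sn. change (psum u (S (S n))) with (psum u (S n) + u (S n))%C.
  rewrite Hp, IH. reflexivity.
Qed.

(** The link between the componentwise definition by [Series] and modulus estimates on partial sums;
    the algebraic rules for [Csum] are derived through it. *)
Lemma Csum_unique (u : nat -> C) (l : C) (e : nat -> R) : is_lim_seq e 0 ->
  (forall n, Cmod (psum u n - l)%C <= e n) -> Csum u = l.
Proof.
intros He H.
assert (Hs : forall p : C -> R, (forall z w, p (z + w)%C = p z + p w) -> p 0 = 0 ->
  (forall z, Rabs (p z) <= Cmod z) -> Series (fun n => p (u n)) = p l).
{ intros p Hp H0 Hle. apply is_series_unique.
  change (is_lim_seq (sum_n (fun n => p (u n))) (p l)).
  apply is_lim_seq_ext with (fun n => p (psum u (S n))).
  { intros n. now apply psum_sum_n. }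
  apply (is_lim_seq_incr_1 (fun n => p (psum u n))).
  apply is_lim_seq_spec. intros eps. apply is_lim_seq_spec in He.
  destruct (He eps) as [N HN]. exists N. intros n Hn.
  specialize (HN n Hn). rewrite Rminus_0_r in HN. pose proof (Rle_abs (e n)).
  replace (p (psum u n) - p l) with (p (psum u n - l)%C).
  - specialize (Hle (psum u n - l)%C). specialize (H n). lra.
  - assert (p (psum u n) = p (psum u n - l)%C + p l) by (rewrite <- Hp; f_equal; ring). lra. }
unfold Csum. rewrite (Hs fst), (Hs snd); [now destruct l|..]; try reflexivity.
apply Rabs_snd_le. apply Rabs_fst_le.
Qed.

Lemma psum_tail_le (u : nat -> C) (K : R) (n m : nat) :
  (forall k, Cmod (u k) <= K / 2 ^ k) -> Cmod (psum u (n + m) - psum u n)%C <= 2 * K / 2 ^ n - 2 * K / 2 ^ (n + m).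
Proof.
intros Hu. induction m as [|m IH].
- rewrite Nat.add_0_r. rewrite Cmod_minus_self. lra.
- rewrite Nat.add_succ_r. simpl psum.
  replace (psum u (n + m) + u (n + m)%nat - psum u n)%C with ((psum u (n + m) - psum u n) + u (n + m)%nat)%C by ring.
  eapply Rle_trans; [apply Cmod_triangle|]. specialize (Hu (n + m)%nat).
  replace (2 * K / 2 ^ S (n + m)) with (K / 2 ^ (n + m)) by (simpl; field; apply pow_nonzero; lra).
  replace (2 * K / 2 ^ (n + m)) with (K / 2 ^ (n + m) + K / 2 ^ (n + m)) in IH by (field; apply pow_nonzero; lra).
  lra.
Qed.

(** Domination by [K / 2 ^ k] is the common criterion for the series of [Phi_eval] and of [PhiD];
    the constant can be taken uniform on a disc, which gives locally uniform convergence. *)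
Lemma Csum_tail (u : nat -> C) (K : R) : (forall k, Cmod (u k) <= K / 2 ^ k) ->
  forall n, Cmod (psum u n - Csum u)%C <= 2 * K / 2 ^ n.
Proof.
intros Hu.
assert (HK : 0 <= K).
{ specialize (Hu O). simpl in Hu. rewrite Rdiv_1_r in Hu. pose proof (Cmod_ge_0 (u O)). lra. }
assert (Hp : forall n, 0 <= 2 * K / 2 ^ n).
{ intros n. apply Rmult_le_pos; [lra|]. left; apply Rinv_0_lt_compat, pow_lt; lra. }
assert (Hc : forall n m, Cmod (psum u n - psum u m)%C <= 2 * K / 2 ^ n + 2 * K / 2 ^ m).
{ intros n m. destruct (Nat.le_ge_cases n m) as [L|L].
  - rewrite Cmod_minus_sym. replace m with (n + (m - n))%nat at 1 by lia.
    eapply Rle_trans; [now apply psum_tail_le|].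
    pose proof (Hp m). pose proof (Hp (n + (m - n))%nat). lra.
  - replace n with (m + (n - m))%nat at 1 by lia.
    eapply Rle_trans; [now apply psum_tail_le|].
    pose proof (Hp n). pose proof (Hp (m + (n - m))%nat). lra. }
destruct (Ccauchy_limit _ _ (is_lim_seq_div_pow2 (2 * K)) Hc) as [l Hl].
rewrite (Csum_unique u l _ (is_lim_seq_div_pow2 (2 * K)) Hl). exact Hl.
Qed.

Lemma Csum_bound (u : nat -> C) (K : R) : (forall k, Cmod (u k) <= K / 2 ^ k) -> Cmod (Csum u) <= 2 * K.
Proof.
intros Hu. pose proof (Csum_tail u K Hu O) as H. simpl in H.
rewrite Cmod_minus_sym in H. replace (Csum u - 0)%C with (Csum u) in H by ring. lra.
Qed.

Lemma Csum_plus (u v : nat -> C) (K L : R) :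
  (forall k, Cmod (u k) <= K / 2 ^ k) -> (forall k, Cmod (v k) <= L / 2 ^ k) ->
  Csum (fun k => u k + v k)%C = (Csum u + Csum v)%C.
Proof.
intros Hu Hv. apply (Csum_unique _ _ _ (is_lim_seq_div_pow2 (2 * K + 2 * L))). intros n.
rewrite psum_plus.
replace (psum u n + psum v n - (Csum u + Csum v))%C with ((psum u n - Csum u) + (psum v n - Csum v))%C by ring.
eapply Rle_trans; [apply Cmod_triangle|].
pose proof (Csum_tail u K Hu n). pose proof (Csum_tail v L Hv n). unfold Rdiv in *. lra.
Qed.

Lemma Csum_scal (c : C) (u : nat -> C) (K : R) : (forall k, Cmod (u k) <= K / 2 ^ k) ->
  Csum (fun k => c * u k)%C = (c * Csum u)%C.
Proof.
intros Hu. apply (Csum_unique _ _ _ (is_lim_seq_scal_0 (Cmod c) _ (is_lim_seq_div_pow2 (2 * K)))). intros n.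
rewrite psum_scal.
replace (c * psum u n - c * Csum u)%C with (c * (psum u n - Csum u))%C by ring.
rewrite Cmod_mult. apply Rmult_le_compat_l; [apply Cmod_ge_0|now apply Csum_tail].
Qed.

Lemma entire_Csum (u : nat -> C -> C) : (forall n, entire (u n)) ->
  (forall rho, exists K, forall n z, Cmod z <= rho -> Cmod (u n z) <= K / 2 ^ n) ->
  entire (fun z => Csum (fun n => u n z)).
Proof.
intros Hu HK. apply (entire_limit (fun n z => psum (fun k => u k z) n)).
- intros n. now apply entire_psum.
- intros rho. destruct (HK rho) as [K Hle]. exists (fun n => 2 * K / 2 ^ n).
  split; [apply is_lim_seq_div_pow2|]. intros n z Hz. apply Csum_tail. intros k. now apply Hle.
Qed.

Lemma Phi_eval_term_bound (a : nat -> C) (rho : R) : exp_type a ->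
  exists K, forall n z, Cmod z <= rho -> Cmod (a n * z ^ n)%C <= K / 2 ^ n.
Proof.
intros [M [R0 [HM [HR Ha]]]]. set (r := Rabs rho). pose proof (Rabs_pos rho) as Hr.
exists (M * exp (2 * R0 * r)). intros n z Hz.
assert (Hzr : Cmod z <= r) by (pose proof (Rle_abs rho); unfold r; lra).
pose proof (INR_fact_lt_0 n) as Hf. pose proof (pow_lt 2 n ltac:(lra)) as H2.
rewrite Cmod_mult, Cmod_pow.
apply Rle_trans with (M * R0 ^ n / INR (fact n) * r ^ n).
- apply Rmult_le_compat; [apply Cmod_ge_0|apply pow_le, Cmod_ge_0|apply Ha|].
  apply pow_incr. split; [apply Cmod_ge_0|exact Hzr].
- assert (HR2 : 0 <= 2 * R0 * r) by (apply Rmult_le_pos; [lra|exact Hr]).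
  pose proof (pow_le_fact (2 * R0 * r) n HR2) as P.
  replace (M * R0 ^ n / INR (fact n) * r ^ n) with (M * ((2 * R0 * r) ^ n / INR (fact n)) / 2 ^ n).
  + apply Rmult_le_compat_r; [left; now apply Rinv_0_lt_compat|]. apply Rmult_le_compat_l; lra.
  + rewrite 2!Rpow_mult_distr. field. lra.
Qed.

Lemma entire_Phi_eval (a : nat -> C) : exp_type a -> entire (Phi_eval a).
Proof.
intros Ha. apply (entire_Csum (fun n z => a n * z ^ n)%C).
- intros n. apply entire_scal, entire_Cpow, entire_id.
- intros rho. now apply Phi_eval_term_bound.
Qed.

(** The margin [12 * R0] bounds the derivatives by [B * fact n / (2 * R0) ^ n], which cancels
    [R0 ^ n / fact n] and leaves [1 / 2 ^ n]. *)
Lemma PhiD_term_bound (a : nat -> C) (M R0 : R) (f : C -> C) (rho B : R) : 0 < M -> 0 < R0 ->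
  (forall n, Cmod (a n) <= M * R0 ^ n / INR (fact n)) -> entire f ->
  (forall z, Cmod z <= rho + 12 * R0 -> Cmod (f z) <= B) ->
  forall n z, Cmod z <= rho -> Cmod (a n * Nat.iter n Dop f z)%C <= (M * B) / 2 ^ n.
Proof.
intros HM HR Ha Hf HB n z Hz.
pose proof (INR_fact_lt_0 n) as Hfn. pose proof (pow_lt 2 n ltac:(lra)) as H2.
pose proof (pow_lt R0 n HR) as HRn.
pose proof (iter_Dop_bound f (12 * R0) B rho n Hf ltac:(lra) HB z Hz) as P.
rewrite Cmod_mult.
apply Rle_trans with (M * R0 ^ n / INR (fact n) * (INR (fact n) * (6 / (12 * R0)) ^ n * B)).
- apply Rmult_le_compat; [apply Cmod_ge_0|apply Cmod_ge_0|apply Ha|exact P].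
- right. replace (6 / (12 * R0)) with (/ 2 * / R0) by (field; lra).
  rewrite Rpow_mult_distr, 2!pow_inv. field. repeat split; lra.
Qed.

(** Continuity of [PhiD a] in quantitative form: the factor [K] and the loss of radius [s] depend on
    neither [f] nor [rho], so they compose under iteration. *)
Lemma PhiD_bound (a : nat -> C) : exp_type a -> exists K s, 0 < K /\ 0 < s /\
  forall f rho B, entire f -> (forall z, Cmod z <= rho + s -> Cmod (f z) <= B) ->
  forall z, Cmod z <= rho -> Cmod (PhiD a f z) <= K * B.
Proof.
intros [M [R0 [HM [HR Ha]]]]. exists (2 * M), (12 * R0).
split; [lra|split; [lra|]]. intros f rho B Hf HB z Hz.
rewrite Rmult_assoc. apply Csum_bound. intros k.
now apply (PhiD_term_bound a M R0 f rho B).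
Qed.

Lemma PhiD_terms_geometric (a : nat -> C) (f : C -> C) (rho : R) : exp_type a -> entire f ->
  exists K, forall n z, Cmod z <= rho -> Cmod (a n * Nat.iter n Dop f z)%C <= K / 2 ^ n.
Proof.
intros [M [R0 [HM [HR Ha]]]] Hf.
destruct (entire_bounded f (rho + 12 * R0) Hf) as [B [_ HB]].
exists (M * B). now apply (PhiD_term_bound a M R0 f rho B).
Qed.

Lemma entire_PhiD (a : nat -> C) (f : C -> C) : exp_type a -> entire f -> entire (PhiD a f).
Proof.
intros Ha Hf. apply (entire_Csum (fun n z => a n * Nat.iter n Dop f z)%C).
- intros n. now apply entire_scal, entire_iter_Dop.
- intros rho. now apply PhiD_terms_geometric.
Qed.

Lemma PhiD_plus (a : nat -> C) (f g : C -> C) : exp_type a -> entire f -> entire g ->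
  PhiD a (fun z => f z + g z)%C = (fun z => PhiD a f z + PhiD a g z)%C.
Proof.
intros Ha Hf Hg. apply functional_extensionality; intros z. unfold PhiD.
destruct (PhiD_terms_geometric a f (Cmod z) Ha Hf) as [K HK].
destruct (PhiD_terms_geometric a g (Cmod z) Ha Hg) as [L HL].
rewrite <- (Csum_plus _ _ K L).
- f_equal. apply functional_extensionality; intros n. rewrite iter_Dop_plus by assumption. ring.
- intros k. apply HK; lra.
- intros k. apply HL; lra.
Qed.

Lemma PhiD_scal (a : nat -> C) (c : C) (f : C -> C) : exp_type a -> entire f ->
  PhiD a (fun z => c * f z)%C = (fun z => c * PhiD a f z)%C.
Proof.
intros Ha Hf. apply functional_extensionality; intros z. unfold PhiD.
destruct (PhiD_terms_geometric a f (Cmod z) Ha Hf) as [K HK].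
rewrite <- (Csum_scal _ _ K).
- f_equal. apply functional_extensionality; intros n. rewrite iter_Dop_scal by assumption. ring.
- intros k. apply HK; lra.
Qed.

(** * Exponentials as eigenvectors of [Phi(D)] *)

Definition cexpo (l z : C) : C := Cexp (l * z).

Lemma Cderiv_at_cexpo (l z : C) : Cderiv_at (cexpo l) z (l * cexpo l z)%C.
Proof.
refine (Cderiv_at_ext _ _ _ _ _ _ _ (Cderiv_at_comp Cexp (fun z => l * z)%C z _ _
  (Cderiv_at_Cexp (l * z)%C) (Cderiv_at_scal l _ _ _ (Cderiv_at_id z)))); [reflexivity|].
unfold cexpo; ring.
Qed.

Lemma entire_cexpo (l : C) : entire (cexpo l).
Proof. exact (entire_intro _ _ (Cderiv_at_cexpo l)). Qed.

Lemma iter_Dop_cexpo (l : C) (n : nat) : Nat.iter n Dop (cexpo l) = (fun z => l ^ n * cexpo l z)%C.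
Proof.
induction n as [|n IH].
- simpl. apply functional_extensionality; intros z; ring.
- simpl Nat.iter. rewrite IH. apply Dop_intro; intros z.
  refine (Cderiv_at_ext _ _ _ _ _ _ _ (Cderiv_at_scal (l ^ n) _ _ _ (Cderiv_at_cexpo l z)));
  [reflexivity|simpl; ring].
Qed.

Lemma PhiD_cexpo (a : nat -> C) (l : C) : exp_type a ->
  PhiD a (cexpo l) = (fun z => Phi_eval a l * cexpo l z)%C.
Proof.
intros Ha. apply functional_extensionality; intros z. unfold PhiD, Phi_eval.
destruct (Phi_eval_term_bound a (Cmod l) Ha) as [K HK].
rewrite (Cmult_comm _ (cexpo l z)), <- (Csum_scal _ _ K).
- f_equal. apply functional_extensionality; intros n. rewrite iter_Dop_cexpo. ring.
- intros k. apply HK; lra.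
Qed.

Lemma cexpo_plus (l m z : C) : cexpo (l + m) z = (cexpo l z * cexpo m z)%C.
Proof. unfold cexpo. rewrite <- Cexp_plus. f_equal; ring. Qed.

(** * Density of exponentials *)

Lemma psum_extend (u : nat -> C) (N M : nat) : (N <= M)%nat ->
  psum (fun k => if (k <? N)%nat then u k else 0) M = psum u N.
Proof.
intros H. induction M as [|M IH].
- now replace N with O by lia.
- destruct (Nat.eq_dec N (S M)) as [->|E].
  + apply psum_ext. intros k Hk. apply Nat.ltb_lt in Hk. now rewrite Hk.
  + simpl. rewrite IH by lia. replace (M <? N)%nat with false; [ring|].
    symmetry. apply Nat.ltb_ge. lia.
Qed.

Definition cspan (s : nat -> C) (N : nat) (c : nat -> C) (z : C) : C :=
  psum (fun k => c k * cexpo (s k) z)%C N.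

Lemma entire_cspan (s : nat -> C) (N : nat) (c : nat -> C) : entire (cspan s N c).
Proof.
apply (entire_psum (fun k z => c k * cexpo (s k) z)%C). intros k. apply entire_scal, entire_cexpo.
Qed.

Definition approximable (s : nat -> C) (g : C -> C) : Prop :=
  forall rho eps, 0 < eps -> exists N c, forall z, Cmod z <= rho ->
    Cmod (g z - cspan s N c z)%C <= eps.

Lemma cspan_extend (s : nat -> C) (N M : nat) (c : nat -> C) (z : C) : (N <= M)%nat ->
  cspan s M (fun k => if (k <? N)%nat then c k else 0) z = cspan s N c z.
Proof.
intros H. unfold cspan. rewrite <- (psum_extend _ N M H). apply psum_ext.
intros k _. destruct (k <? N)%nat; ring.
Qed.

Lemma cspan_plus (s : nat -> C) (N : nat) (c d : nat -> C) (z : C) :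
  cspan s N (fun k => c k + d k)%C z = (cspan s N c z + cspan s N d z)%C.
Proof. unfold cspan. rewrite <- psum_plus. apply psum_ext. intros; ring. Qed.

Lemma approximable_plus (s : nat -> C) (f g : C -> C) :
  approximable s f -> approximable s g -> approximable s (fun z => f z + g z)%C.
Proof.
intros Hf Hg rho eps He.
destruct (Hf rho (eps / 2) ltac:(lra)) as [N [c Hc]].
destruct (Hg rho (eps / 2) ltac:(lra)) as [M [d Hd]].
exists (Nat.max N M), (fun k => (if (k <? N)%nat then c k else 0) + (if (k <? M)%nat then d k else 0))%C.
intros z Hz. rewrite cspan_plus, 2!cspan_extend by lia.
specialize (Hc z Hz). specialize (Hd z Hz).
replace (f z + g z - (cspan s N c z + cspan s M d z))%C with
 ((f z - cspan s N c z) + (g z - cspan s M d z))%C by ring.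
eapply Rle_trans; [apply Cmod_triangle|]. lra.
Qed.

Lemma approximable_scal (s : nat -> C) (b : C) (f : C -> C) :
  approximable s f -> approximable s (fun z => b * f z)%C.
Proof.
intros Hf rho eps He. pose proof (Cmod_ge_0 b) as Hb.
destruct (Hf rho (eps / (Cmod b + 1))) as [N [c Hc]]; [apply Rdiv_lt_0_compat; lra|].
exists N, (fun k => b * c k)%C. intros z Hz.
replace (cspan s N (fun k => b * c k)%C z) with (b * cspan s N c z)%C.
2:{ unfold cspan. rewrite <- psum_scal. apply psum_ext; intros; ring. }
replace (b * f z - b * cspan s N c z)%C with (b * (f z - cspan s N c z))%C by ring.
rewrite Cmod_mult. specialize (Hc z Hz).
apply Rle_trans with ((Cmod b + 1) * (eps / (Cmod b + 1))).
- apply Rmult_le_compat; [exact Hb|apply Cmod_ge_0|lra|exact Hc].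
- right; field; lra.
Qed.

Lemma approximable_psum (s : nat -> C) (u : nat -> C -> C) (n : nat) :
  (forall k, (k < n)%nat -> approximable s (u k)) -> approximable s (fun z => psum (fun k => u k z) n).
Proof.
induction n as [|n IH]; intros H.
- intros rho eps He. exists O, (fun _ => RtoC 0). intros z _. unfold cspan; simpl.
  rewrite Cmod_minus_self; lra.
- simpl. apply approximable_plus; [apply IH; auto|apply H; auto].
Qed.

Lemma approximable_limit (s : nat -> C) (f : C -> C) :
  (forall rho eps, 0 < eps -> exists g, approximable s g /\
     forall z, Cmod z <= rho -> Cmod (f z - g z)%C <= eps) -> approximable s f.
Proof.
intros H rho eps He. destruct (H rho (eps / 2) ltac:(lra)) as [g [Hg Hfg]].
destruct (Hg rho (eps / 2) ltac:(lra)) as [N [c Hc]].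
exists N, c. intros z Hz. eapply Rle_trans; [apply (Cmod_minus_triangle _ (g z))|].
specialize (Hfg z Hz). specialize (Hc z Hz). lra.
Qed.

Lemma approximable_cexpo (s : nat -> C) (n : nat) : approximable s (cexpo (s n)).
Proof.
intros rho eps He. exists (S n), (fun k => if (k =? n)%nat then 1 else 0). intros z _.
unfold cspan; simpl. rewrite Nat.eqb_refl, psum_zero.
- replace (cexpo (s n) z - (0 + 1 * cexpo (s n) z))%C with (RtoC 0) by ring. rewrite Cmod_0; lra.
- intros k Hk. replace (k =? n)%nat with false; [ring|]. symmetry; apply Nat.eqb_neq; lia.
Qed.

Lemma Cmod_cexpo_le (l z : C) : Cmod (cexpo l z) <= exp (Cmod l * Cmod z).
Proof.
unfold cexpo. rewrite Cmod_Cexp, <- Cmod_mult.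
pose proof (Rabs_fst_le (l * z)%C). pose proof (Rle_abs (fst (l * z)%C)).
destruct (Rle_lt_or_eq_dec (fst (l * z)%C) (Cmod (l * z)%C) ltac:(lra)) as [H1|H1].
- left. now apply exp_increasing.
- rewrite H1; lra.
Qed.

Lemma exp_le (x y : R) : x <= y -> exp x <= exp y.
Proof. intros [H|H]; [left; now apply exp_increasing|right; now rewrite H]. Qed.

(** The error carries the full factor [Cmod d ^ n]; with [n = k + 1] it survives division by [d ^ k]
    and still tends to 0 with [d]. *)
Lemma cexpo_Taylor (d z : C) (n : nat) (rho : R) : Cmod d <= 1 -> Cmod z <= rho ->
  Cmod (cexpo d z - tpoly (fun j => d ^ j)%C n z)%C <= Cmod d ^ n * (exp rho * rho ^ n).
Proof.
intros Hd Hz. pose proof (Cmod_ge_0 d) as Hd0. pose proof (Cmod_ge_0 z) as Hz0.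
pose proof (Taylor_remainder n (cexpo d) 0 z (Cmod d ^ n * exp rho) (entire_cexpo d)) as P.
rewrite Cplus_0_l in P.
replace (tpoly (fun j => d ^ j)%C n z) with (tpoly (fun k => Nat.iter k Dop (cexpo d) 0) n z).
2:{ unfold tpoly. apply psum_ext. intros k _. rewrite iter_Dop_cexpo.
    unfold cexpo. rewrite Cmult_0_r, Cexp_0. now rewrite Cmult_1_r. }
pose proof (exp_pos rho) as Hexp. pose proof (pow_le _ n Hd0) as Hdn.
eapply Rle_trans; [apply P|].
- intros t Ht. rewrite Cplus_0_l, iter_Dop_cexpo, Cmod_mult, Cmod_pow.
  apply Rmult_le_compat_l; [exact Hdn|].
  eapply Rle_trans; [apply Cmod_cexpo_le|]. apply exp_le.
  pose proof (Cmod_scal_unit_le t z rho Ht Hz). pose proof (Cmod_ge_0 (t * z)%C). nra.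
- rewrite <- Rmult_assoc. unfold Rdiv. rewrite Rmult_assoc.
  apply Rmult_le_compat_l; [apply Rmult_le_pos; lra|].
  apply Rle_trans with (Cmod z ^ n * 1).
  + apply Rmult_le_compat_l; [now apply pow_le|].
    rewrite <- Rinv_1. apply Rinv_le_contravar; [lra|]. apply (le_INR 1). apply lt_O_fact.
  + rewrite Rmult_1_r. now apply pow_incr.
Qed.

(* Differencing in the exponent: [z^k/k! e^(l z)] is the limit of
   [d^-k (e^((l+d) z) - sum_(j<k) d^j z^j/j! e^(l z))] as [d -> 0]. *)
Lemma approximable_monomial_cexpo (s : nat -> C) (l : C) :
  (forall k, s k <> l) ->
  (forall eps, 0 < eps -> exists k, Cmod (s k - l)%C < eps) ->
  forall k, approximable s (fun z => z ^ k / INR (fact k) * cexpo l z)%C.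
Proof.
intros Hne Hlim k. induction k as [k IH] using (well_founded_induction Wf_nat.lt_wf).
apply approximable_limit. intros rho0 eps He.
set (rho := Rabs rho0). pose proof (Rabs_pos rho0) as Hrho. fold rho in Hrho.
set (E := exp (Cmod l * rho)). assert (HE : 0 < E) by apply exp_pos.
(* The final error will be at most [Cmod d * (K - 1)]; the added 1 keeps [K] positive. *)
set (K := E * (exp rho * rho ^ S k) + 1).
assert (HK : 0 < K).
{ unfold K. assert (0 <= E * (exp rho * rho ^ S k)); [|lra].
  apply Rmult_le_pos; [lra|]. apply Rmult_le_pos; [left; apply exp_pos|now apply pow_le]. }
destruct (Hlim (Rmin 1 (eps / K))) as [n Hn].
{ apply Rmin_glb_lt; [lra|now apply Rdiv_lt_0_compat]. }
set (d := (s n - l)%C) in *.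
assert (Hd0 : d <> 0).
{ intros E0. apply (Hne n). now apply Ceq_minus. }
assert (Hd1 : Cmod d <= 1) by (pose proof (Rmin_l 1 (eps / K)); lra).
assert (HdK : Cmod d * K <= eps).
{ pose proof (Rmin_r 1 (eps / K)).
  apply Rle_trans with (eps / K * K); [apply Rmult_le_compat_r; lra|right; field; lra]. }
pose proof (Cpow_nz d k Hd0) as Hdk.
exists (fun z => / d ^ k * (cexpo (s n) z + (-1) * psum (fun j => d ^ j * (z ^ j / INR (fact j) * cexpo l z)) k))%C.
split.
- apply approximable_scal, approximable_plus; [apply approximable_cexpo|].
  apply approximable_scal.
  apply (approximable_psum s (fun j z => d ^ j * (z ^ j / INR (fact j) * cexpo l z))%C).
  intros j Hj. apply approximable_scal. now apply IH.
- intros z Hz0.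
  assert (Hz : Cmod z <= rho) by (pose proof (Rle_abs rho0); unfold rho; lra).
  replace (s n) with (d + l)%C by (unfold d; ring). rewrite cexpo_plus.
  replace (z ^ k / INR (fact k) * cexpo l z -
    / d ^ k * (cexpo d z * cexpo l z + -1 * psum (fun j => d ^ j * (z ^ j / INR (fact j) * cexpo l z)) k))%C
  with (- (/ d ^ k * cexpo l z * (cexpo d z - tpoly (fun j => d ^ j) (S k) z)))%C.
  2:{ unfold tpoly. simpl psum.
      replace (psum (fun j => d ^ j * (z ^ j / INR (fact j) * cexpo l z)) k)%C with
        (cexpo l z * psum (fun j => d ^ j * z ^ j / INR (fact j)) k)%C.
      - field. split; [exact Hdk|apply RtoC_fact_neq_0].
      - rewrite <- psum_scal. apply psum_ext. intros j _. field. apply RtoC_fact_neq_0. }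
  rewrite Cmod_opp, 2!Cmod_mult, Cmod_inv, Cmod_pow by exact Hdk.
  pose proof (cexpo_Taylor d z (S k) rho Hd1 Hz) as T.
  assert (Hdp : 0 < Cmod d) by now apply Cmod_gt_0.
  pose proof (pow_lt _ k Hdp) as Hdkp.
  assert (Hel : Cmod (cexpo l z) <= E).
  { eapply Rle_trans; [apply Cmod_cexpo_le|]. apply exp_le.
    apply Rmult_le_compat_l; [apply Cmod_ge_0|exact Hz]. }
  apply Rle_trans with (/ Cmod d ^ k * E * (Cmod d ^ S k * (exp rho * rho ^ S k))).
  + apply Rmult_le_compat; [|apply Cmod_ge_0| |exact T].
    * apply Rmult_le_pos; [left; now apply Rinv_0_lt_compat|apply Cmod_ge_0].
    * apply Rmult_le_compat_l; [left; now apply Rinv_0_lt_compat|exact Hel].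
  + replace (/ Cmod d ^ k * E * (Cmod d ^ S k * (exp rho * rho ^ S k))) with (Cmod d * (K - 1)).
    * pose proof (Cmod_ge_0 d). lra.
    * unfold K. simpl. field. lra.
Qed.

(** Factoring out [e^(l z)] leaves an entire function [v], whose Taylor polynomials reduce the claim
    to the products [z^k/k! e^(l z)]. *)
Lemma cexpo_span_dense (s : nat -> C) (l : C) (u : C -> C) :
  (forall k, s k <> l) ->
  (forall eps, 0 < eps -> exists k, Cmod (s k - l)%C < eps) ->
  entire u -> approximable s u.
Proof.
intros Hne Hlim Hu. apply approximable_limit. intros rho0 eps He.
set (rho := Rabs rho0). pose proof (Rabs_pos rho0) as Hrho. fold rho in Hrho.
set (E := exp (Cmod l * rho)). assert (HE : 0 < E) by apply exp_pos.
set (v := fun z => (u z * cexpo (- l) z)%C).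
assert (Hv : entire v) by (apply entire_mult; [exact Hu|apply entire_cexpo]).
destruct (entire_Taylor v rho Hv) as [K [HK HT]].
pose proof (is_lim_seq_div_pow2 (E * K)) as L. apply is_lim_seq_spec in L.
destruct (L (mkposreal eps He)) as [n Hn]. specialize (Hn n (le_n n)). simpl in Hn.
rewrite Rminus_0_r in Hn. pose proof (Rle_abs (E * K / 2 ^ n)) as Ha.
set (c := fun k => Nat.iter k Dop v 0) in HT.
exists (fun z => psum (fun k => c k * (z ^ k / INR (fact k) * cexpo l z))%C n). split.
- apply (approximable_psum s (fun k z => c k * (z ^ k / INR (fact k) * cexpo l z))%C).
  intros k _. apply approximable_scal. now apply approximable_monomial_cexpo.
- intros z Hz0.
  assert (Hz : Cmod z <= rho) by (pose proof (Rle_abs rho0); unfold rho; lra).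
  specialize (HT n z Hz).
  replace (u z - psum (fun k => c k * (z ^ k / INR (fact k) * cexpo l z)) n)%C with
    (cexpo l z * (v z - tpoly c n z))%C.
  + rewrite Cmod_mult.
    assert (Hel : Cmod (cexpo l z) <= E).
    { eapply Rle_trans; [apply Cmod_cexpo_le|]. apply exp_le.
      apply Rmult_le_compat_l; [apply Cmod_ge_0|exact Hz]. }
    apply Rle_trans with (E * (K / 2 ^ n)).
    * apply Rmult_le_compat; auto using Cmod_ge_0.
    * unfold Rdiv in *. lra.
  + unfold tpoly, Cminus. rewrite Cmult_plus_distr_l. f_equal.
    * unfold v. replace (cexpo l z * (u z * cexpo (- l) z))%C with (u z * (cexpo l z * cexpo (- l) z))%C by ring.
      rewrite <- cexpo_plus. replace (l + - l)%C with (RtoC 0) by ring.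
      unfold cexpo. rewrite Cmult_0_l, Cexp_0. ring.
    * 
      replace (cexpo l z * - psum (fun k => c k * z ^ k / INR (fact k)) n)%C with
        (- (cexpo l z * psum (fun k => c k * z ^ k / INR (fact k)) n))%C by ring.
      f_equal. rewrite <- psum_scal. apply psum_ext. intros k _. field. apply RtoC_fact_neq_0.
Qed.

(** * Local behaviour of the modulus *)

Lemma Cexp_surj (w : C) : w <> 0 -> exists z, Cexp z = w.
Proof.
intros Hw. apply Cmod_gt_0 in Hw as Hm. set (m := Cmod w) in *.
set (x := fst w / m). set (y := snd w / m).
assert (Hxy : x ^ 2 + y ^ 2 = 1).
{ assert (E : m ^ 2 = fst w ^ 2 + snd w ^ 2) by apply Cmod2_alt.
  unfold x, y. replace ((fst w / m) ^ 2 + (snd w / m) ^ 2) with ((fst w ^ 2 + snd w ^ 2) / m ^ 2) by (field; lra).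
  rewrite <- E. field; lra. }
assert (Hx : -1 <= x <= 1) by nra.
assert (Hth : exists th, cos th = x /\ sin th = y).
{ pose proof (sin2_cos2 (acos x)) as S2. rewrite cos_acos in S2 by exact Hx.
  unfold Rsqr in S2. assert (Hs : 0 <= sin (acos x)).
  { destruct (acos_bound x). now apply sin_ge_0. }
  destruct (Rle_lt_dec 0 y) as [Hy|Hy].
  - exists (acos x). split; [now apply cos_acos|]. nra.
  - exists (- acos x). rewrite cos_neg, sin_neg. split; [now apply cos_acos|]. nra. }
destruct Hth as [th [Hc Hs]].
exists (ln m, th). unfold Cexp; simpl. rewrite exp_ln, Hc, Hs by exact Hm.
unfold x, y. destruct w as [w1 w2]; simpl. f_equal; field; lra.
Qed.

Lemma Cexp_pow (z : C) (n : nat) : (Cexp z ^ n)%C = Cexp (INR n * z).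
Proof.
induction n as [|n IH].
- simpl. now rewrite Cmult_0_l, Cexp_0.
- rewrite S_INR, RtoC_plus. simpl Cpow. rewrite IH, <- Cexp_plus. f_equal; ring.
Qed.

Lemma Croot (w : C) (n : nat) : (0 < n)%nat -> exists z, (z ^ n)%C = w.
Proof.
intros Hn. destruct (Ceq_dec w 0) as [->|Hw].
- exists 0. destruct n; [lia|]. simpl. ring.
- destruct (Cexp_surj w Hw) as [z <-]. exists (Cexp (/ INR n * z)).
  rewrite Cexp_pow. f_equal. field.
  apply RtoC_neq_0, not_0_INR. lia.
Qed.

Lemma least_nat (P : nat -> Prop) : (exists n, P n) ->
  exists n, P n /\ forall k, (k < n)%nat -> ~ P k.
Proof.
intros [n Hn]. revert Hn. induction n as [n IH] using (well_founded_induction Wf_nat.lt_wf).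
intros Hn. destruct (classic (exists k, (k < n)%nat /\ P k)) as [[k [Hk HP]]|H].
- now apply (IH k).
- exists n. split; [exact Hn|]. intros k Hk HP. apply H. now exists k.
Qed.

(** With [b * h ^ n] the first nonconstant Taylor term at [z0], the direction of [h] can be chosen
    so that this term points along [F z0] and increases the modulus. *)
Lemma entire_open_modulus (F : C -> C) (z0 : C) (eps : R) : entire F ->
  (exists w, F w <> F z0) -> Cmod (F z0) = 1 -> 0 < eps ->
  exists z, Cmod (z - z0)%C < eps /\ 1 < Cmod (F z).
Proof.
intros HF [w Hw] H1 He.
set (G := fun h => F (h + z0)%C).
assert (HG : entire G) by now apply entire_translate.
set (c := fun k => Nat.iter k Dop G 0).
assert (HG0 : G 0 = F z0) by (unfold G; now rewrite Cplus_0_l).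
assert (Hex : exists k, c (S k) <> 0).
{ apply NNPP; intros Hno. apply Hw.
  destruct (entire_Taylor G (Cmod (w - z0)%C) HG) as [K [HK HT]].
  assert (E : (F w - F z0)%C = 0); [|now apply Ceq_minus].
  apply Cmod_eq_0. apply Rle_antisym; [|apply Cmod_ge_0].
  apply (Rle_limit _ (fun n => K / 2 ^ S n)).
  { apply (is_lim_seq_incr_1 (fun n => K / 2 ^ n)). apply is_lim_seq_div_pow2. }
  intros n. rewrite Rplus_0_l. specialize (HT (S n) (w - z0)%C ltac:(lra)).
  replace (G (w - z0)%C) with (F w) in HT by (unfold G; f_equal; ring).
  replace (tpoly (fun k => Nat.iter k Dop G 0) (S n) (w - z0)) with (F z0) in HT; [exact HT|].
  unfold tpoly. rewrite psum_S_l, psum_zero.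
  - simpl. rewrite HG0. field.
  - intros k _. replace (Nat.iter (S k) Dop G 0) with (RtoC 0).
    + unfold Cdiv. ring.
    + symmetry. apply NNPP; intros Hk. apply Hno. now exists k. }
destruct (least_nat _ Hex) as [k [Hk Hmin]].
set (n := S k) in *.
destruct (entire_bounded (Nat.iter (S n) Dop G) 1 (entire_iter_Dop (S n) G HG)) as [B [HB0 HB]].
set (b := (c n / INR (fact n))%C).
assert (Hb : b <> 0).
{ intros E. apply Hk. replace (c n) with (b * INR (fact n))%C; [rewrite E; ring|].
  unfold b. field. apply RtoC_fact_neq_0. }
apply Cmod_gt_0 in Hb as Hbp.
(* [b * om ^ n = Cmod b * F z0], so that [h = r * om] adds a positive multiple of [F z0]. *)
destruct (Croot (RtoC (Cmod b) / b * F z0)%C n ltac:(unfold n; lia)) as [om Hom].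
set (W := Cmod om + 1). pose proof (Cmod_ge_0 om) as Hom0.
assert (HW : 0 < W) by (unfold W; lra).
assert (HWn : 0 < W ^ S n) by now apply pow_lt.
(* The three constraints keep [h] in the unit disc where [B] is valid, keep it within [eps / 2], and
   make the remainder at most half of the gain [Cmod b * r ^ n]. *)
set (r := Rmin (/ W) (Rmin (eps / (2 * W)) (Cmod b / (2 * B * W ^ S n)))).
assert (Hr : 0 < r).
{ repeat apply Rmin_glb_lt.
  - now apply Rinv_0_lt_compat.
  - apply Rdiv_lt_0_compat; lra.
  - apply Rdiv_lt_0_compat; [exact Hbp|]. apply Rmult_lt_0_compat; lra. }
assert (Hr1 : r * W <= 1).
{ apply Rle_trans with (/ W * W); [apply Rmult_le_compat_r; [lra|apply Rmin_l]|right; field; lra]. }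
assert (Hr2 : r * W <= eps / 2).
{ apply Rle_trans with (eps / (2 * W) * W).
  - apply Rmult_le_compat_r; [lra|]. eapply Rle_trans; [apply Rmin_r|apply Rmin_l].
  - right; field; lra. }
assert (Hr3 : r * (B * W ^ S n) <= Cmod b / 2).
{ apply Rle_trans with (Cmod b / (2 * B * W ^ S n) * (B * W ^ S n)).
  - apply Rmult_le_compat_r; [apply Rmult_le_pos; lra|].
    eapply Rle_trans; [apply Rmin_r|apply Rmin_r].
  - right; field; split; lra. }
set (h := (r * om)%C).
assert (HhW : Cmod h <= r * W).
{ unfold h. rewrite Cmod_mult, Cmod_R, Rabs_pos_eq by lra. apply Rmult_le_compat_l; unfold W; lra. }
exists (h + z0)%C. split.
{ replace (h + z0 - z0)%C with h by ring. lra. }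
change (1 < Cmod (G h)).
pose proof (Taylor_remainder (S n) G 0 h B HG) as T. rewrite Cplus_0_l in T.
assert (T' : Cmod (G h - tpoly c (S n) h)%C <= B * Cmod h ^ S n / INR (fact (S n))).
{ apply T. intros t Ht. rewrite Cplus_0_l. apply HB. apply Cmod_scal_unit_le; [exact Ht|lra]. }
assert (Etp : tpoly c (S n) h = (F z0 * RtoC (1 + Cmod b * r ^ n))%C).
{ unfold tpoly. change (psum ?u (S n)) with (psum u n + u n)%C. cbv beta.
  replace (psum (fun j => c j * h ^ j / INR (fact j))%C n) with (F z0).
  - replace (c n * h ^ n / INR (fact n))%C with (b * h ^ n)%C
      by (unfold b; field; apply RtoC_fact_neq_0).
    unfold h. rewrite Cpow_mult_l, Hom, RtoC_plus, RtoC_mult, RtoC_pow. field. exact Hb.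
  - unfold n. rewrite psum_S_l, psum_zero.
    + unfold c. simpl. rewrite HG0. field.
    + intros j Hj. replace (c (S j)) with (RtoC 0); [unfold Cdiv; ring|].
      symmetry. apply NNPP. apply Hmin. lia. }
rewrite Etp in T'.
assert (Hrn : 0 < r ^ n) by now apply pow_lt.
assert (HR : B * Cmod h ^ S n / INR (fact (S n)) <= Cmod b / 2 * r ^ n).
{ apply Rle_trans with (B * (r * W) ^ S n * 1).
  - unfold Rdiv. apply Rmult_le_compat.
    + apply Rmult_le_pos; [lra|apply pow_le, Cmod_ge_0].
    + left; apply Rinv_0_lt_compat, INR_fact_lt_0.
    + apply Rmult_le_compat_l; [lra|]. apply pow_incr. split; [apply Cmod_ge_0|exact HhW].
    + rewrite <- Rinv_1. apply Rinv_le_contravar; [lra|]. apply (le_INR 1). apply lt_O_fact.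
  - rewrite Rpow_mult_distr, <- (tech_pow_Rmult r n).
    apply Rle_trans with (r * (B * W ^ S n) * r ^ n); [right; ring|].
    apply Rmult_le_compat_r; lra. }
assert (Hmain : Cmod (F z0 * RtoC (1 + Cmod b * r ^ n))%C = 1 + Cmod b * r ^ n).
{ rewrite Cmod_mult, H1, Cmod_R, Rabs_pos_eq; [ring|]. assert (0 < Cmod b * r ^ n) by now apply Rmult_lt_0_compat. lra. }
assert (Htri : Cmod (F z0 * RtoC (1 + Cmod b * r ^ n))%C <=
   Cmod (G h) + Cmod (G h - F z0 * RtoC (1 + Cmod b * r ^ n))%C).
{ replace (F z0 * RtoC (1 + Cmod b * r ^ n))%C with
   (G h + - (G h - F z0 * RtoC (1 + Cmod b * r ^ n)))%C at 1 by ring.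
  eapply Rle_trans; [apply Cmod_triangle|]. rewrite Cmod_opp. lra. }
assert (0 < Cmod b * r ^ n) by now apply Rmult_lt_0_compat. lra.
Qed.

(** * Convex hulls and strictly convex arcs *)

Lemma sum_n_concat {V : AbelianMonoid} (u : nat -> V) (n m : nat) :
  sum_n u (n + S m) = plus (sum_n u n) (sum_n (fun i => u (S n + i)%nat) m).
Proof.
induction m as [|m IH].
- rewrite Nat.add_1_r, sum_Sn, sum_O. now rewrite Nat.add_0_r.
- rewrite Nat.add_succ_r, sum_Sn, IH, sum_Sn, plus_assoc.
  reflexivity.
Qed.

Lemma conv_convex (A : C -> Prop) (z w : C) (t : R) : conv A z -> conv A w -> 0 <= t <= 1 ->
  conv A (RtoC (1 - t) * z + RtoC t * w)%C.
Proof.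
(* The two combinations are concatenated; the sums include index [n], so the second one starts at
   [S n]. *)
intros [n [p [x [Hp [Hx Hz]]]]] [m [q [y [Hq [Hy Hw]]]]] Ht.
set (pp := fun i => if (i <=? n)%nat then p i else q (i - S n)%nat).
set (ww := fun i => if (i <=? n)%nat then (1 - t) * x i else t * y (i - S n)%nat).
exists (n + S m)%nat, pp, ww. split; [|split].
- intros i Hi. unfold pp, ww. destruct (Nat.leb_spec i n) as [L|L].
  + destruct (Hp i L). split; [easy|]. apply Rmult_le_pos; lra.
  + destruct (Hq (i - S n)%nat ltac:(lia)). split; [easy|]. apply Rmult_le_pos; lra.
- rewrite sum_n_concat.
  rewrite (sum_n_ext_loc ww (fun i => mult (K := R_Ring) (1 - t) (x i)) n).
  2:{ intros i Hi. unfold ww. apply Nat.leb_le in Hi. now rewrite Hi. }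
  rewrite (sum_n_ext_loc (fun i => ww (S n + i)%nat) (fun i => mult (K := R_Ring) t (y i)) m).
  2:{ intros i Hi. unfold ww. replace (S n + i <=? n)%nat with false.
      replace (S n + i - S n)%nat with i by lia. reflexivity.
      symmetry; apply Nat.leb_gt; lia. }
  rewrite 2!(sum_n_mult_l (K := R_Ring)).
  transitivity ((1 - t) * sum_n x n + t * sum_n y m); [reflexivity|]. rewrite Hx, Hy.
  change ((1 - t) * 1 + t * 1 = 1). ring.
- rewrite (sum_n_concat (V := C_AbelianMonoid)).
  rewrite (sum_n_ext_loc (fun i => ww i * pp i)%C (fun i => mult (K := C_Ring) (RtoC (1 - t)) (x i * p i)%C) n).
  2:{ intros i Hi. unfold ww, pp. apply Nat.leb_le in Hi. rewrite Hi.
      rewrite RtoC_mult. unfold mult; simpl. ring. }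
  rewrite (sum_n_ext_loc (fun i => ww (S n + i)%nat * pp (S n + i)%nat)%C (fun i => mult (K := C_Ring) (RtoC t) (y i * q i)%C) m).
  2:{ intros i Hi. unfold ww, pp. replace (S n + i <=? n)%nat with false.
      replace (S n + i - S n)%nat with i by lia. rewrite RtoC_mult. unfold mult; simpl. ring.
      symmetry; apply Nat.leb_gt; lia. }
  rewrite 2!(sum_n_mult_l (K := C_Ring)). rewrite Hz, Hw. reflexivity.
Qed.

Lemma conv_subset (A : C -> Prop) (z : C) : A z -> conv A z.
Proof.
intros Hz. exists O, (fun _ => z), (fun _ => 1). split; [|split].
- intros; split; [exact Hz|lra].
- now rewrite sum_O.
- rewrite sum_O. now rewrite Cmult_1_l.
Qed.

Definition convex (K : C -> Prop) : Prop := forall z w t, K z -> K w -> 0 <= t <= 1 ->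
  K (RtoC (1 - t) * z + RtoC t * w)%C.

Definition inter (K : C -> Prop) (z : C) : Prop :=
  exists del, 0 < del /\ forall w, Cmod (w - z)%C < del -> K w.

Lemma convex_comb3 (K : C -> Prop) (a b c : C) (x y z : R) : convex K -> K a -> K b -> K c ->
  0 < x -> 0 < y -> 0 < z -> x + y + z = 1 -> K (x * a + y * b + z * c)%C.
Proof.
intros HK Ha Hb Hc Hx Hy Hz Hs.
assert (E : (x * a + y * b + z * c)%C =
  (RtoC (1 - (y + z)) * a + RtoC (y + z) * (RtoC (1 - z / (y + z)) * b + RtoC (z / (y + z)) * c))%C).
{ replace (1 - (y + z)) with x by lra. replace (1 - z / (y + z)) with (y / (y + z)) by (field; lra).
  rewrite 2!RtoC_div by lra. field. apply RtoC_neq_0; lra. }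
rewrite E. apply HK; [exact Ha| |lra]. apply HK; [exact Hb|exact Hc|].
split; [left; apply Rdiv_lt_0_compat; lra|].
apply Rmult_le_reg_r with (y + z); [lra|]. unfold Rdiv. rewrite Rmult_assoc, Rinv_l; lra.
Qed.

(** Determinant of [z] and [w] as plane vectors: its sign tells on which side of the line through 0
    and [z] the point [w] lies. *)
Definition cr (z w : C) : R := fst z * snd w - snd z * fst w.

Lemma Rabs_cr_le (z w : C) : Rabs (cr z w) <= Cmod z * Cmod w.
Proof.
replace (cr z w) with (snd (Cconj z * w)%C) by (unfold cr; simpl; ring).
rewrite <- (Cmod_conj z), <- Cmod_mult. apply Rabs_snd_le.
Qed.

(** Cramer's rule writes a displacement [d] in the basis [b - a], [c - a] with coefficients at most
    [L * Cmod d], too small to spoil the positivity of the barycentric coordinates. *)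
Lemma inter_triangle (K : C -> Prop) (a b c : C) (x y z : R) : convex K -> K a -> K b -> K c ->
  cr (b - a) (c - a) <> 0 -> 0 < x -> 0 < y -> 0 < z -> x + y + z = 1 ->
  inter K (x * a + y * b + z * c)%C.
Proof.
intros HK Ha Hb Hc HD Hx Hy Hz Hs.
set (D := cr (b - a) (c - a)) in *.
set (L := (Cmod (b - a)%C + Cmod (c - a)%C) / Rabs D).
pose proof (Cmod_ge_0 (b - a)%C) as H1. pose proof (Cmod_ge_0 (c - a)%C) as H2.
pose proof (Rabs_pos_lt D HD) as HDp.
assert (HL : 0 <= L).
{ apply Rmult_le_pos; [lra|]. left; now apply Rinv_0_lt_compat. }
set (m := Rmin x (Rmin y z)).
assert (Hm : 0 < m) by (repeat apply Rmin_glb_lt; lra).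
assert (Hmx : m <= x) by apply Rmin_l.
assert (Hmy : m <= y) by (eapply Rle_trans; [apply Rmin_r|apply Rmin_l]).
assert (Hmz : m <= z) by (eapply Rle_trans; [apply Rmin_r|apply Rmin_r]).
exists (m / (2 * L + 1)). split; [apply Rdiv_lt_0_compat; lra|].
intros v Hv. set (d := (v - (x * a + y * b + z * c))%C) in *.
pose proof (Cmod_ge_0 d) as Hd0.
assert (HdL : Cmod d * (2 * L + 1) < m).
{ replace m with (m / (2 * L + 1) * (2 * L + 1)) by (field; lra).
  apply Rmult_lt_compat_r; lra. }
set (p := cr d (c - a) / D). set (q := cr (b - a) d / D).
assert (HX : forall X Y, Rabs X <= Y * Cmod d -> Y <= Cmod (b - a)%C + Cmod (c - a)%C ->
  Rabs (X / D) <= L * Cmod d).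
{ intros X Y HXY HY. unfold L, Rdiv. rewrite Rabs_mult, Rabs_inv.
  apply Rinv_0_lt_compat in HDp. rewrite Rmult_assoc, (Rmult_comm (/ Rabs D)), <- Rmult_assoc.
  apply Rmult_le_compat_r; [lra|]. nra. }
assert (Hp : Rabs p <= L * Cmod d).
{ apply (HX _ (Cmod (c - a)%C)); [rewrite Rmult_comm; apply Rabs_cr_le|lra]. }
assert (Hq : Rabs q <= L * Cmod d).
{ apply (HX _ (Cmod (b - a)%C)); [apply Rabs_cr_le|lra]. }
apply Rabs_le_between in Hp. apply Rabs_le_between in Hq.
assert (E : v = (RtoC (x - p - q) * a + RtoC (y + p) * b + RtoC (z + q) * c)%C).
{ assert (Ed : d = (p * (b - a) + q * (c - a))%C).
  { destruct a as [a1 a2], b as [b1 b2], c as [c1 c2], d as [d1 d2].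
    unfold p, q, D, cr in *. simpl in *. unfold Cplus, Cmult, Cminus, Copp, RtoC; simpl.
    f_equal; field; exact HD. }
  replace v with (x * a + y * b + z * c + d)%C by (unfold d; ring).
  rewrite Ed, !RtoC_minus, !RtoC_plus. ring. }
rewrite E. apply convex_comb3; try assumption; lra || nra.
Qed.

Lemma inter_comb (K : C -> Prop) (z w : C) (t : R) : convex K -> inter K z -> K w -> 0 <= t < 1 ->
  inter K (RtoC (1 - t) * z + RtoC t * w)%C.
Proof.
intros HK [del [Hdel Hz]] Hw Ht. exists ((1 - t) * del). split; [apply Rmult_lt_0_compat; lra|].
intros v Hv. set (d := (v - (RtoC (1 - t) * z + RtoC t * w))%C) in *.
assert (Hn : RtoC (1 - t) <> 0) by (apply RtoC_neq_0; lra).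
replace v with (RtoC (1 - t) * (z + d / RtoC (1 - t)) + RtoC t * w)%C.
2:{ unfold d. field. exact Hn. }
apply HK; [|exact Hw|lra]. apply Hz.
replace (z + d / RtoC (1 - t) - z)%C with (d / RtoC (1 - t))%C by (field; exact Hn).
rewrite Cmod_div, Cmod_R, Rabs_pos_eq by (try exact Hn; lra).
apply Rmult_lt_reg_r with (1 - t); [lra|]. unfold Rdiv. rewrite Rmult_assoc, Rinv_l; lra.
Qed.

(** For [0 < cr A B] this is the open sector swept counterclockwise from [A] to [B]. It is stable
    under positive combinations and excludes 0, where the modulus is not controlled. *)
Definition cone (A B z : C) : Prop := 0 < cr A z /\ 0 < cr z B.

Lemma cone_neq_0 (A B z : C) : cone A B z -> z <> 0.
Proof. intros [H _] ->. unfold cr in H; simpl in H. lra. Qed.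

Lemma cr_comb_r (A z w : C) (x y : R) : cr A (x * z + y * w)%C = x * cr A z + y * cr A w.
Proof. unfold cr; simpl. ring. Qed.

Lemma cr_comb_l (A z w : C) (x y : R) : cr (x * z + y * w)%C A = x * cr z A + y * cr w A.
Proof. unfold cr; simpl. ring. Qed.

Lemma cone_comb (A B z w : C) (x y : R) : cone A B z -> cone A B w -> 0 < x -> 0 <= y ->
  cone A B (x * z + y * w)%C.
Proof.
intros [H1 H2] [H3 H4] Hx Hy. split; [rewrite cr_comb_r|rewrite cr_comb_l]; nra.
Qed.

Lemma cone_scal (A B z : C) (x : R) : cone A B z -> 0 < x -> cone A B (x * z)%C.
Proof.
intros H Hx. replace (x * z)%C with (x * z + 0 * z)%C by ring. now apply cone_comb; [| |lra|lra].
Qed.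

(** Both coordinates of [k] in the basis [A], [B] are positive, so a small multiple [mu * k] is
    inside the triangle 0, [A], [B]; then [t * k] lies strictly between this interior point and
    [k]. *)
Lemma inter_scal (K : C -> Prop) (A B k : C) (t : R) : convex K -> K 0 -> K A -> K B -> K k ->
  0 < cr A B -> cone A B k -> 0 < t < 1 -> inter K (t * k)%C.
Proof.
intros HK H0 HA HB Hk HAB [C1 C2] Ht.
set (a := cr k B / cr A B). set (b := cr A k / cr A B).
assert (Ha : 0 < a) by now apply Rdiv_lt_0_compat.
assert (Hb : 0 < b) by now apply Rdiv_lt_0_compat.
assert (Ek : k = (a * A + b * B)%C).
{ destruct A as [a1 a2], B as [b1 b2], k as [k1 k2].
  unfold a, b, cr in *. simpl in *. unfold Cplus, Cmult, Cminus, Copp, RtoC; simpl.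
  f_equal; field; lra. }
(* [mu <= t / 2] places [mu * k] before [t * k]; [mu * (a + b) <= / 2] leaves a positive weight for
   the vertex 0. *)
set (mu := Rmin (t / 2) (/ (2 * (a + b)))).
assert (Hmu : 0 < mu).
{ apply Rmin_glb_lt; [lra|]. apply Rinv_0_lt_compat; lra. }
assert (Hmu1 : mu <= t / 2) by apply Rmin_l.
assert (Hmu2 : mu * (a + b) <= / 2).
{ apply Rle_trans with (/ (2 * (a + b)) * (a + b)).
  - apply Rmult_le_compat_r; [lra|apply Rmin_r].
  - right; field; lra. }
assert (Hi : inter K (mu * k)%C).
{ replace (mu * k)%C with (RtoC (1 - mu * a - mu * b) * 0 + RtoC (mu * a) * A + RtoC (mu * b) * B)%C.
  - apply inter_triangle; try assumption; try nra.
    replace (A - 0)%C with A by ring. replace (B - 0)%C with B by ring. lra.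
  - rewrite Ek at 1. rewrite !RtoC_mult. ring. }
set (s := (t - mu) / (1 - mu)).
replace (t * k)%C with (RtoC (1 - s) * (mu * k) + RtoC s * k)%C.
- apply inter_comb; try assumption. unfold s. split.
  + apply Rmult_le_pos; [lra|left; apply Rinv_0_lt_compat; lra].
  + apply Rmult_lt_reg_r with (1 - mu); [lra|]. unfold Rdiv. rewrite Rmult_assoc, Rinv_l; lra.
- rewrite Cmult_assoc, <- RtoC_mult, <- Cmult_plus_distr_r, <- RtoC_plus.
  do 2 f_equal. unfold s. field. lra.
Qed.

Lemma cr_0_collinear (z w : C) : z <> 0 -> cr z w = 0 -> exists s : R, w = (s * z)%C.
Proof.
intros Hz Hc. exists ((fst z * fst w + snd z * snd w) / (fst z ^ 2 + snd z ^ 2)).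
assert (Hp : fst z ^ 2 + snd z ^ 2 <> 0).
{ intros E. apply Hz. destruct z as [x y]; simpl in *. unfold RtoC. f_equal; nra. }
destruct z as [x y], w as [u v]. unfold cr in Hc; simpl fst in *; simpl snd in *.
apply injective_projections; simpl fst; simpl snd; apply Rminus_diag_uniq.
- transitivity (- y * (x * v - y * u) / (x ^ 2 + y ^ 2)); [field; exact Hp|rewrite Hc; field; exact Hp].
- transitivity (x * (x * v - y * u) / (x ^ 2 + y ^ 2)); [field; exact Hp|rewrite Hc; field; exact Hp].
Qed.

(** Three collinear points lie on the segment between the outer two, which would meet [G] three
    times; the position [s] of [c] relative to [a] and [b] decides which point is in the middle. *)
Lemma strictly_convex_triangle (G : C -> Prop) (a b c : C) : strictly_convex G -> G a -> G b -> G c ->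
  a <> b -> a <> c -> b <> c -> cr (b - a) (c - a) <> 0.
Proof.
intros HG Ha Hb Hc Hab Hac Hbc E.
assert (Hba : (b - a)%C <> 0) by (apply Cminus_eq_contra; congruence).
destruct (cr_0_collinear _ _ Hba E) as [s Hs].
assert (Hc' : c = (a + s * (b - a))%C) by (rewrite <- Hs; ring).
assert (L : forall z w : C, segment z w z).
{ intros z w. exists 0. split; [lra|]. rewrite Rminus_0_r. ring. }
assert (Rr : forall z w : C, segment z w w).
{ intros z w. exists 1. split; [lra|]. replace (1 - 1) with 0 by ring. ring. }
destruct (Rlt_le_dec s 0) as [H1|H1]; [|destruct (Rle_lt_dec s 1) as [H2|H2]].
- destruct (HG c b Hc Hb c a b Hc Ha Hb (L _ _)) as [X|[X|X]]; try congruence.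
  + exists (- s / (1 - s)). split.
    * split; [apply Rmult_le_pos; [lra|left; apply Rinv_0_lt_compat; lra]|].
      apply Rmult_le_reg_r with (1 - s); [lra|]. unfold Rdiv. rewrite Rmult_assoc, Rinv_l; lra.
    * rewrite Hc'. replace (1 - - s / (1 - s)) with (/ (1 - s)) by (field; lra).
      unfold Rdiv. rewrite RtoC_mult, RtoC_inv, RtoC_opp, RtoC_minus by lra. field.
      intros X. rewrite <- RtoC_minus in X. apply RtoC_inj in X. lra.
  + apply Rr.
- destruct (HG a b Ha Hb a c b Ha Hc Hb (L _ _)) as [X|[X|X]]; try congruence.
  + exists s. split; [lra|]. rewrite Hc', RtoC_minus. ring.
  + apply Rr.
- destruct (HG a c Ha Hc a b c Ha Hb Hc (L _ _)) as [X|[X|X]]; try congruence.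
  + exists (/ s). split.
    * split; [left; apply Rinv_0_lt_compat; lra|]. rewrite <- Rinv_1. apply Rinv_le_contravar; lra.
    * rewrite Hc', RtoC_minus, RtoC_inv by lra. field. apply RtoC_neq_0; lra.
  + apply Rr.
Qed.

Lemma arc_functional_continuity (gam : R -> C) (al be : R) (t : R) :
  (forall t, 0 <= t <= 1 -> forall eps, 0 < eps -> exists del, 0 < del /\
     forall s, 0 <= s <= 1 -> Rabs (s - t) < del -> Cmod (gam s - gam t)%C < eps) ->
  0 < t < 1 -> continuity_pt (fun s => al * fst (gam s) + be * snd (gam s)) t.
Proof.
intros Hc Ht eps Heps.
set (L := Rabs al + Rabs be + 1). pose proof (Rabs_pos al). pose proof (Rabs_pos be).
destruct (Hc t ltac:(lra) (eps / L)) as [del [Hdel Hd]]; [apply Rdiv_lt_0_compat; unfold L; lra|].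
exists (Rmin del (Rmin t (1 - t))). split.
{ repeat apply Rmin_glb_lt; lra. }
intros s [_ Hs]. simpl in Hs |- *. unfold Rdist in *.
pose proof (Rmin_l del (Rmin t (1 - t))). pose proof (Rmin_r del (Rmin t (1 - t))).
pose proof (Rmin_l t (1 - t)). pose proof (Rmin_r t (1 - t)).
assert (Hst : Rabs (s - t) < Rmin t (1 - t)) by lra.
apply Rabs_lt_between in Hst.
specialize (Hd s ltac:(lra) ltac:(lra)). set (d := (gam s - gam t)%C) in *.
replace (al * fst (gam s) + be * snd (gam s) - (al * fst (gam t) + be * snd (gam t)))
  with (al * fst d + be * snd d) by (unfold d; simpl; ring).
eapply Rle_lt_trans; [apply Rabs_triang|]. rewrite 2!Rabs_mult.
pose proof (Rabs_fst_le d). pose proof (Rabs_snd_le d). pose proof (Cmod_ge_0 d).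
apply Rle_lt_trans with (L * Cmod d).
- unfold L. pose proof (Rabs_pos (fst d)). pose proof (Rabs_pos (snd d)). nra.
- apply Rmult_lt_reg_r with (/ L); [apply Rinv_0_lt_compat; unfold L; lra|].
  rewrite Rmult_comm, <- Rmult_assoc, Rinv_l, Rmult_1_l by (unfold L; lra). exact Hd.
Qed.

Lemma continuity_pt_pos (f : R -> R) (t : R) : continuity_pt f t -> 0 < f t ->
  exists del, 0 < del /\ forall s, Rabs (s - t) < del -> 0 < f s.
Proof.
intros Hf Ht. destruct (Hf (f t) Ht) as [del [Hdel Hd]]. exists del. split; [exact Hdel|].
intros s Hs. destruct (Req_dec t s) as [<-|Hn]; [exact Ht|].
assert (H := Hd s ltac:(split; [split; [exact I|exact Hn]|exact Hs])).
simpl in H. unfold Rdist in H. apply Rabs_lt_between in H. lra.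
Qed.

(** Two nearby arc points give directions forming an acute angle and not parallel; by the
    intermediate value theorem the arc passes through a direction strictly between them. *)
Lemma arc_cone_point (G : C -> Prop) (gam : R -> C) : strictly_convex G ->
  (forall t, 0 <= t <= 1 -> forall eps, 0 < eps -> exists del, 0 < del /\
     forall s, 0 <= s <= 1 -> Rabs (s - t) < del -> Cmod (gam s - gam t)%C < eps) ->
  (forall s t, 0 <= s <= 1 -> 0 <= t <= 1 -> gam s = gam t -> s = t) ->
  (forall t, 0 <= t <= 1 -> G (gam t)) ->
  exists A B t, 0 < t < 1 /\ G A /\ G B /\ 0 < cr A B /\ cone A B (gam t).
Proof.
intros HG Hcont Hinj HGg.
assert (H0 : exists t0, 0 < t0 < 1 /\ gam t0 <> 0).
{ destruct (Ceq_dec (gam (1 / 3)) 0) as [E|E]; [|exists (1 / 3); split; [lra|exact E]].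
  exists (2 / 3). split; [lra|]. intros E'. rewrite <- E in E'.
  apply Hinj in E'; lra. }
destruct H0 as [t0 [Ht0 Hn0]]. set (A := gam t0) in *.
assert (HAA : 0 < fst A * fst A + snd A * snd A).
{ destruct (Rle_lt_dec (fst A * fst A + snd A * snd A) 0) as [L|L]; [|exact L].
  exfalso. apply Hn0. destruct A as [x y]; simpl in *. unfold RtoC. f_equal; nra. }
destruct (continuity_pt_pos (fun s => fst A * fst (gam s) + snd A * snd (gam s)) t0)
  as [del [Hdel Hd]].
{ now apply arc_functional_continuity. }
{ exact HAA. }
set (r := Rmin (del / 2) ((1 - t0) / 2)).
assert (Hr : 0 < r) by (apply Rmin_glb_lt; lra).
assert (Hr1 : r <= del / 2) by apply Rmin_l.
assert (Hr2 : r <= (1 - t0) / 2) by apply Rmin_r.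
(* The line through 0 and [A] carries at most one other arc point, so one of two nearby parameters
   leaves it. *)
assert (Hp : exists p, t0 < p < 1 /\ p - t0 < del /\ cr A (gam p) <> 0).
{ assert (Hz : forall w, cr A w = 0 -> exists k : R, w = (k * A)%C) by (intros w; now apply cr_0_collinear).
  destruct (Req_dec (cr A (gam (t0 + r))) 0) as [E1|E1]; [|exists (t0 + r); repeat split; try lra; exact E1].
  destruct (Req_dec (cr A (gam (t0 + r / 2))) 0) as [E2|E2]; [|exists (t0 + r / 2); repeat split; try lra; exact E2].
  exfalso.
  apply (strictly_convex_triangle G A (gam (t0 + r)) (gam (t0 + r / 2)) HG).
  - apply HGg; lra.
  - apply HGg; lra.
  - apply HGg; lra.
  - intros E. apply Hinj in E; lra.
  - intros E. apply Hinj in E; lra.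
  - intros E. apply Hinj in E; lra.
  - destruct (Hz _ E1) as [k1 ->]. destruct (Hz _ E2) as [k2 ->]. unfold cr; simpl. ring. }
destruct Hp as [p [Hp [Hpd Hcr]]]. set (B := gam p) in *.
set (dot := fun z : C => fst A * fst z + snd A * snd z).
assert (HdB : 0 < dot B).
{ apply Hd. rewrite Rabs_pos_eq; lra. }
set (c := cr A B) in *.
(* At a zero of [psi] the angle from [A] has half the tangent of the angle from [A] to [B]. The
   outer factor [c] makes [psi] negative at [t0] and positive at [p] for either orientation. *)
set (psi := fun t => c * (cr A (gam t) * dot B - c * dot (gam t) / 2)).
assert (Hc2 : 0 < c * c) by nra.
assert (Hpsi : exists t, t0 <= t <= p /\ psi t = 0).
{ destruct (Ranalysis5.IVT_interv psi t0 p) as [t [Ht E]].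
  - intros x Hx.
    assert (Hcx : continuity_pt (fun s => (- c * dot B * snd A - c * c * fst A / 2) * fst (gam s)
        + (c * dot B * fst A - c * c * snd A / 2) * snd (gam s)) x).
    { apply arc_functional_continuity; [exact Hcont|lra]. }
    revert Hcx. apply continuity_pt_ext. intros s. unfold psi, cr, dot. field.
  - lra.
  - unfold psi. fold A. replace (cr A A) with 0 by (unfold cr; ring).
    change (dot A) with (fst A * fst A + snd A * snd A). nra.
  - unfold psi. fold B. fold c. nra.
  - exists t. now split. }
destruct Hpsi as [t [Ht Hpt]].
assert (E : cr A (gam t) * dot B = c * dot (gam t) / 2).
{ unfold psi in Hpt. apply Rmult_integral in Hpt. destruct Hpt as [Hpt|Hpt]; lra. }
assert (Hdt : 0 < dot (gam t)).
{ apply Hd. rewrite Rabs_pos_eq; lra. }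
(* The identity [cr z B * dot A = dot z * cr A B - cr A z * dot B] transfers the sign of [c] to the
   second determinant. *)
assert (E2 : cr (gam t) B * (fst A * fst A + snd A * snd A) = c * dot (gam t) / 2).
{ transitivity (dot (gam t) * c - cr A (gam t) * dot B); [|lra].
  unfold c, dot, cr. ring. }
assert (Hs : forall x y, 0 < y -> x * y = c * dot (gam t) / 2 -> 0 < c * x).
{ intros x y Hy Ex. apply Rmult_lt_reg_r with y; [exact Hy|]. rewrite Rmult_assoc, Ex, Rmult_0_l.
  assert (0 < c * c * dot (gam t)) by now apply Rmult_lt_0_compat. lra. }
pose proof (Hs _ _ HdB E) as S1. pose proof (Hs _ _ HAA E2) as S2.
destruct (Rlt_le_dec 0 c) as [Hc|Hc].
- exists A, B, t. split; [lra|]. split; [apply HGg; lra|]. split; [apply HGg; lra|].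
  split; [exact Hc|]. split; nra.
- exists B, A, t. split; [lra|]. split; [apply HGg; lra|]. split; [apply HGg; lra|].
  split; [|split].
  + replace (cr B A) with (- c) by (unfold c, cr; ring). lra.
  + replace (cr B (gam t)) with (- cr (gam t) B) by (unfold cr; ring). nra.
  + replace (cr (gam t) A) with (- cr A (gam t)) by (unfold cr; ring). nra.
Qed.

(** The sector is open, so the parameters [t + eta / (k + 1)] stay in it for [eta] small;
    injectivity makes the points distinct and different from their limit, as the density of
    exponentials requires. *)
Lemma arc_cone_sequence (G : C -> Prop) : compact_arc G -> strictly_convex G ->
  exists A B (s : nat -> C) (l : C), G A /\ G B /\ 0 < cr A B /\
    (forall k, G (s k) /\ cone A B (s k)) /\ G l /\ cone A B l /\
    (forall i j, s i = s j -> i = j) /\ (forall k, s k <> l) /\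
    (forall eps, 0 < eps -> exists k, Cmod (s k - l)%C < eps).
Proof.
intros [gam [Hcont [Hinj Himg]]] HG.
assert (HGg : forall t, 0 <= t <= 1 -> G (gam t)) by (intros t Ht; apply Himg; now exists t).
destruct (arc_cone_point G gam HG Hcont Hinj HGg) as [A [B [t [Ht [HA [HB [HAB [C1 C2]]]]]]]].
destruct (continuity_pt_pos (fun s => - snd A * fst (gam s) + fst A * snd (gam s)) t) as [d1 [Hd1 H1]].
{ now apply arc_functional_continuity. }
{ unfold cr in C1. lra. }
destruct (continuity_pt_pos (fun s => snd B * fst (gam s) + - fst B * snd (gam s)) t) as [d2 [Hd2 H2]].
{ now apply arc_functional_continuity. }
{ unfold cr in C2. lra. }
set (eta := Rmin (Rmin d1 d2) (1 - t) / 2).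
assert (Heta : 0 < eta).
{ unfold eta. assert (0 < Rmin (Rmin d1 d2) (1 - t)) by (repeat apply Rmin_glb_lt; lra). lra. }
assert (He : eta < d1 /\ eta < d2 /\ eta < 1 - t).
{ unfold eta in *. pose proof (Rmin_l (Rmin d1 d2) (1 - t)). pose proof (Rmin_r (Rmin d1 d2) (1 - t)).
  pose proof (Rmin_l d1 d2). pose proof (Rmin_r d1 d2). repeat split; lra. }
set (q := fun k => eta / INR (S k)).
assert (HS : forall k, 1 <= INR (S k)) by (intros k; apply (le_INR 1); lia).
assert (Hq : forall k, 0 < q k <= eta).
{ intros k. specialize (HS k). split; [apply Rdiv_lt_0_compat; lra|].
  apply Rmult_le_reg_r with (INR (S k)); [lra|]. unfold q, Rdiv.
  rewrite Rmult_assoc, Rinv_l by lra. nra. }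
exists A, B, (fun k => gam (t + q k)), (gam t).
split; [exact HA|]. split; [exact HB|]. split; [exact HAB|].
split; [|split; [apply HGg; lra|split; [now split|split; [|split]]]].
- intros k. specialize (Hq k). split; [apply HGg; lra|].
  specialize (H1 (t + q k)). specialize (H2 (t + q k)).
  replace (t + q k - t) with (q k) in * by ring. rewrite Rabs_pos_eq in * by lra.
  specialize (H1 ltac:(lra)). specialize (H2 ltac:(lra)). unfold cone, cr. split; lra.
- intros i j E. apply Hinj in E; [|pose proof (Hq i); lra|pose proof (Hq j); lra].
  assert (E' : q i = q j) by lra. unfold q in E'.
  apply (f_equal (fun x => eta / x)) in E'.
  replace (eta / (eta / INR (S i))) with (INR (S i)) in E' by (field; specialize (HS i); split; lra).
  replace (eta / (eta / INR (S j))) with (INR (S j)) in E' by (field; specialize (HS j); split; lra).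
  apply INR_eq in E'. lia.
- intros k E. pose proof (Hq k). apply Hinj in E; lra.
- intros eps Heps. destruct (Hcont t ltac:(lra) eps Heps) as [del [Hdel Hd]].
  pose proof (is_lim_seq_scal_inv_S eta) as L. apply is_lim_seq_spec in L.
  destruct (L (mkposreal del Hdel)) as [k Hk]. specialize (Hk k (le_n k)). simpl pos in Hk.
  rewrite Rminus_0_r in Hk. fold (q k) in Hk. exists k. pose proof (Hq k).
  apply Hd; [lra|]. now replace (t + q k - t) with (q k) by ring.
Qed.

(** * Averages of words of exponents *)

Definition open_chord (S : C -> Prop) (z : C) : Prop :=
  exists g h t, S g /\ S h /\ g <> h /\ 0 < t < 1 /\ z = (RtoC (1 - t) * g + RtoC t * h)%C.

Fixpoint wsum (mu : nat -> C) (w : list nat) : C :=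
  match w with nil => 0 | i :: w' => mu i + wsum mu w' end%C.

Lemma wsum_cons_avg (mu : nat -> C) (i : nat) (w : list nat) : w <> nil ->
  exists t, 0 < t < 1 /\ (wsum mu (i :: w) / INR (length (i :: w)))%C =
    (RtoC (1 - t) * mu i + RtoC t * (wsum mu w / INR (length w)))%C.
Proof.
intros Hw. assert (Hl : 0 < INR (length w)).
{ apply lt_0_INR. destruct w; [easy|simpl; lia]. }
change (length (i :: w)) with (S (length w)). simpl wsum. rewrite S_INR.
set (l := INR (length w)) in *. exists (l / (l + 1)). split.
- split; [apply Rdiv_lt_0_compat; lra|].
  apply Rmult_lt_reg_r with (l + 1); [lra|]. unfold Rdiv. rewrite Rmult_assoc, Rinv_l; lra.
- replace (1 - l / (l + 1)) with (/ (l + 1)) by (field; lra).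
  rewrite RtoC_div, RtoC_inv, RtoC_plus by lra. field.
  split; try rewrite <- RtoC_plus; apply RtoC_neq_0; lra.
Qed.

Lemma wsum_single_avg (mu : nat -> C) (i : nat) : (wsum mu (i :: nil) / INR (length (i :: nil)))%C = mu i.
Proof. simpl. field. Qed.

Section Words.

Variables (F : C -> C) (G : C -> Prop) (A B : C).
Let K := conv (fun w => G w \/ w = RtoC 0).
Let arc_pt z := G z /\ cone A B z.
Let hull_pt z := inter K z /\ cone A B z.

Hypothesis F_entire : entire F.
Hypothesis G_sc : strictly_convex G.
Hypothesis F_arc : forall z, G z -> Cmod (F z) = 1.
Hypothesis F_hull : forall z, K z -> ~ G z -> z <> 0 -> Cmod (F z) < 1.
Hypothesis GA : G A.
Hypothesis GB : G B.
Hypothesis crAB : 0 < cr A B.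

Let K_convex : convex K.
Proof. intros z w t Hz Hw Ht. now apply conv_convex. Qed.

Let G_K z : G z -> K z.
Proof. intros H. apply conv_subset. now left. Qed.

Let K_0 : K 0.
Proof. apply conv_subset. now right. Qed.

Let inter_K z : inter K z -> K z.
Proof.
intros [d [Hd H]]. apply H. replace (z - z)%C with (RtoC 0) by ring. now rewrite Cmod_0.
Qed.

(** A point strictly inside the chord is not on the arc, since the chord would then meet the arc
    three times, and it is not 0 because it stays in the sector; so the hull hypothesis applies. *)
Lemma open_chord_lt (z : C) : open_chord arc_pt z -> Cmod (F z) < 1.
Proof.
intros [g [h [t [[Hg Cg] [[Hh Ch] [Hgh [Ht ->]]]]]]].
apply F_hull.
- apply K_convex; [now apply G_K|now apply G_K|lra].
- intros Hz. assert (Hgh' : (g - h)%C <> 0) by now apply Cminus_eq_contra.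
  destruct (G_sc g h Hg Hh g (RtoC (1 - t) * g + RtoC t * h)%C h Hg Hz Hh) as [E|[E|E]].
  + exists 0. split; [lra|]. rewrite Rminus_0_r. ring.
  + exists t. split; [lra|easy].
  + exists 1. split; [lra|]. replace (1 - 1) with 0 by ring. ring.
  + apply (Cmult_neq_0 t (g - h)); [apply RtoC_neq_0; lra|exact Hgh'|].
    rewrite RtoC_minus in E. transitivity (g - ((1 - t) * g + t * h))%C; [ring|]. rewrite <- E. ring.
  + easy.
  + apply (Cmult_neq_0 (1 - t)%R (g - h)); [apply RtoC_neq_0; lra|exact Hgh'|].
    rewrite RtoC_minus in *. transitivity ((1 - t) * g + t * h - h)%C; [ring|]. rewrite E. ring.
- apply (cone_neq_0 A B). apply cone_comb; try assumption; lra.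
Qed.

(* If the modulus were 1 at an interior point, the open mapping property would
   produce points of the hull where it exceeds 1. *)
Lemma inter_hull_lt (z : C) : (exists w, Cmod (F w) < 1) -> hull_pt z -> Cmod (F z) < 1.
Proof.
intros [w0 Hw0] [[d [Hd Hi]] Hc].
assert (Hle : forall w, K w -> w <> 0 -> Cmod (F w) <= 1).
{ intros w Hw Hw1. destruct (classic (G w)) as [HG|HG].
  - right. now apply F_arc.
  - left. now apply F_hull. }
assert (Hz0 : z <> 0) by now apply (cone_neq_0 A B).
apply Cmod_gt_0 in Hz0 as Hzp.
assert (Hz : K z).
{ apply inter_K. now exists d. }
destruct (Hle z Hz Hz0) as [H|H]; [exact H|exfalso].
destruct (entire_open_modulus F z (Rmin d (Cmod z)) F_entire) as [w [Hw1 Hw2]].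
- exists w0. intros E. rewrite E in Hw0. lra.
- exact H.
- now apply Rmin_glb_lt.
- pose proof (Rmin_l d (Cmod z)). pose proof (Rmin_r d (Cmod z)).
  assert (Hw0' : w <> 0).
  { intros ->. rewrite Cmod_minus_sym in Hw1. replace (z - 0)%C with z in Hw1 by ring. lra. }
  specialize (Hle w (Hi w ltac:(lra)) Hw0'). lra.
Qed.

Lemma hull_pt_comb (z w : C) (t : R) : hull_pt z -> K w -> cone A B w -> 0 < t < 1 ->
  hull_pt (RtoC (1 - t) * z + RtoC t * w)%C.
Proof.
intros [Hi Hc] Hk Hw Ht. split.
- apply inter_comb; try assumption; lra.
- apply cone_comb; try assumption; lra.
Qed.

(** If [y] is an end of the chord, the combination stays on that chord; otherwise [y], [g], [h] are
    three noncollinear arc points and it lies inside their triangle. *)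
Lemma open_chord_comb (y z : C) (t : R) : arc_pt y -> open_chord arc_pt z -> 0 < t < 1 ->
  hull_pt (RtoC (1 - t) * y + RtoC t * z)%C \/ open_chord arc_pt (RtoC (1 - t) * y + RtoC t * z)%C.
Proof.
intros Hy [g [h [s [Hg [Hh [Hgh [Hs ->]]]]]]] Ht.
destruct (Ceq_dec y g) as [->|Hyg]; [|destruct (Ceq_dec y h) as [->|Hyh]].
- right. exists g, h, (t * s). repeat (split; [assumption|]). split; [nra|].
  rewrite !RtoC_minus, RtoC_mult. ring.
- right. exists g, h, (1 - t * (1 - s)). repeat (split; [assumption|]). split; [nra|].
  rewrite !RtoC_minus, RtoC_mult, !RtoC_minus. ring.
- left. destruct Hy as [Hy Cy], Hg as [Hg Cg], Hh as [Hh Ch]. split.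
  + replace (RtoC (1 - t) * y + RtoC t * (RtoC (1 - s) * g + RtoC s * h))%C with
      (RtoC (1 - t) * y + RtoC (t * (1 - s)) * g + RtoC (t * s) * h)%C
      by (rewrite !RtoC_mult; ring).
    apply inter_triangle; auto; try nra.
    now apply (strictly_convex_triangle G).
  + apply cone_comb; try assumption; [apply cone_comb; try assumption|..]; lra.
Qed.

Variables (mu : nat -> C) (N : nat).
Hypothesis mu_letter : forall i, (i < N)%nat -> hull_pt (mu i) \/ arc_pt (mu i).
Hypothesis mu_inj : forall i j, (i < N)%nat -> (j < N)%nat -> i <> j ->
  arc_pt (mu i) -> arc_pt (mu j) -> mu i <> mu j.

Let mu_Kcone i : (i < N)%nat -> K (mu i) /\ cone A B (mu i).
Proof.
intros Hi. destruct (mu_letter i Hi) as [[H1 H2]|[H1 H2]]; split; auto.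
Qed.

Lemma word_avg_hull (w : list nat) : w <> nil -> (forall i, In i w -> (i < N)%nat) ->
  K (wsum mu w / INR (length w))%C /\ cone A B (wsum mu w / INR (length w))%C.
Proof.
induction w as [|i w IH]; intros Hw HN; [easy|].
destruct w as [|j w].
- rewrite wsum_single_avg. apply mu_Kcone, HN. now left.
- destruct (wsum_cons_avg mu i (j :: w)) as [t [Ht ->]]; [easy|].
  destruct IH as [I1 I2]; [easy|intros k Hk; apply HN; now right|].
  destruct (mu_Kcone i) as [J1 J2]; [apply HN; now left|].
  split; [apply K_convex; auto; lra|apply cone_comb; auto; lra].
Qed.

(** Letters are added one at a time: an interior letter or average absorbs the rest, two distinct
    arc letters open a chord, and a chord persists or gives way to an interior point. *)
Lemma word_avg_cases (w : list nat) : w <> nil -> (forall i, In i w -> (i < N)%nat) ->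
  (exists i, (i < N)%nat /\ (forall j, In j w -> j = i) /\ (wsum mu w / INR (length w))%C = mu i) \/
  hull_pt (wsum mu w / INR (length w))%C \/ open_chord arc_pt (wsum mu w / INR (length w))%C.
Proof.
induction w as [|i w IH]; intros Hw HN; [easy|].
assert (Hi : (i < N)%nat) by (apply HN; now left).
destruct w as [|j0 w0].
- left. exists i. rewrite wsum_single_avg. split; [exact Hi|]. split; [|easy].
  intros j [->|[]]; easy.
- set (w := j0 :: w0) in *. assert (Hw' : w <> nil) by easy.
  assert (HN' : forall k, In k w -> (k < N)%nat) by (intros k Hk; apply HN; now right).
  destruct (word_avg_hull w Hw' HN') as [Kw Cw].
  destruct (wsum_cons_avg mu i w Hw') as [t [Ht ->]].
  destruct (mu_letter i Hi) as [Oi|Si]; [right; left; now apply hull_pt_comb|].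
  destruct (IH Hw' HN') as [[j [Hj [Hall E]]]|[H|H]].
  + destruct (Nat.eq_dec j i) as [->|Hji].
    * left. exists i. split; [exact Hi|]. split.
      -- intros k [->|Hk]; [easy|now apply Hall].
      -- rewrite E, RtoC_minus. ring.
    * right. rewrite E. destruct (mu_letter j Hj) as [Oj|Sj].
      -- left. replace (RtoC (1 - t) * mu i + RtoC t * mu j)%C with
           (RtoC (1 - (1 - t)) * mu j + RtoC (1 - t) * mu i)%C
           by (replace (1 - (1 - t)) with t by ring; ring).
         destruct (mu_Kcone i Hi). apply hull_pt_comb; auto. lra.
      -- right. exists (mu i), (mu j), t. repeat (split; [assumption|]).
         split; [apply mu_inj; auto|]. now split.
  + right; left.
    replace (RtoC (1 - t) * mu i + RtoC t * (wsum mu w / INR (length w)))%C with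
      (RtoC (1 - (1 - t)) * (wsum mu w / INR (length w)) + RtoC (1 - t) * mu i)%C
      by (replace (1 - (1 - t)) with t by ring; ring).
    destruct (mu_Kcone i Hi). apply hull_pt_comb; auto. lra.
  + right. now apply open_chord_comb.
Qed.

(** For a shorter word the exponent is the average times [length w / m < 1], which [inter_scal]
    places in the interior; a word of length [m] with two different letters escapes the constant
    case of [word_avg_cases]. *)
Lemma word_lt (w : list nat) (m : nat) : (exists z, open_chord arc_pt z) ->
  w <> nil -> (forall i, In i w -> (i < N)%nat) ->
  (length w < m)%nat \/ (length w = m /\ exists i j, In i w /\ In j w /\ i <> j) ->
  Cmod (F (wsum mu w / INR m)%C) < 1.
Proof.
intros [z0 Hz0] Hw HN Hm.
assert (Hex : exists z, Cmod (F z) < 1) by (exists z0; now apply open_chord_lt).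
destruct Hm as [Hm|[<- [i [j [Hi [Hj Hij]]]]]].
- assert (Hl : (0 < length w)%nat) by (destruct w; [easy|simpl; lia]).
  apply lt_INR in Hm. apply lt_INR in Hl. simpl in Hl.
  destruct (word_avg_hull w Hw HN) as [Kw Cw].
  set (t := INR (length w) / INR m).
  assert (Ht : 0 < t < 1).
  { split; [apply Rdiv_lt_0_compat; lra|]. apply Rmult_lt_reg_r with (INR m); [lra|].
    unfold t, Rdiv. rewrite Rmult_assoc, Rinv_l; lra. }
  replace (wsum mu w / INR m)%C with (t * (wsum mu w / INR (length w)))%C.
  + apply inter_hull_lt; [exact Hex|]. split; [|apply cone_scal; [exact Cw|lra]].
    apply (inter_scal K A B); auto.
  + unfold t. rewrite RtoC_div by lra. field.
    split; apply RtoC_neq_0; lra.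
- destruct (word_avg_cases w Hw HN) as [[k [_ [Hk _]]]|[H|H]].
  + exfalso. apply Hij. rewrite (Hk i Hi), (Hk j Hj). easy.
  + now apply inter_hull_lt.
  + now apply open_chord_lt.
Qed.

End Words.

(** * Iterates and residuality *)

Section Iterates.

Variable a : nat -> C.
Hypothesis a_exp : exp_type a.
Let T := PhiD a.

Lemma entire_iter_PhiD (q : nat) (f : C -> C) : entire f -> entire (Nat.iter q T f).
Proof. intros Hf. induction q; simpl; [exact Hf|now apply entire_PhiD]. Qed.

Lemma iter_PhiD_plus (q : nat) (f g : C -> C) : entire f -> entire g ->
  Nat.iter q T (fun z => f z + g z)%C = (fun z => Nat.iter q T f z + Nat.iter q T g z)%C.
Proof.
intros Hf Hg. induction q as [|q IH]; [easy|]. simpl. rewrite IH.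
now apply PhiD_plus; try apply entire_iter_PhiD.
Qed.

Lemma iter_PhiD_scal (q : nat) (c : C) (f : C -> C) : entire f ->
  Nat.iter q T (fun z => c * f z)%C = (fun z => c * Nat.iter q T f z)%C.
Proof.
intros Hf. induction q as [|q IH]; [easy|]. simpl. rewrite IH.
now apply PhiD_scal; try apply entire_iter_PhiD.
Qed.

Lemma iter_PhiD_zero (q : nat) : Nat.iter q T (fun _ => RtoC 0) = (fun _ => RtoC 0).
Proof.
transitivity (Nat.iter q T (fun z => 0 * (fun _ => RtoC 0) z)%C).
- f_equal. apply functional_extensionality; intros; ring.
- rewrite iter_PhiD_scal by apply entire_const. apply functional_extensionality; intros; ring.
Qed.

Lemma iter_PhiD_psum (q : nat) (u : nat -> C -> C) (n : nat) : (forall k, entire (u k)) ->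
  Nat.iter q T (fun z => psum (fun k => u k z) n) = (fun z => psum (fun k => Nat.iter q T (u k) z) n).
Proof.
intros Hu. induction n as [|n IH]; [apply iter_PhiD_zero|].
simpl. rewrite (iter_PhiD_plus q (fun z => psum (fun k => u k z) n) (u n)).
- now rewrite IH.
- now apply entire_psum.
- apply Hu.
Qed.

Lemma iter_PhiD_cexpo (q : nat) (l : C) :
  Nat.iter q T (cexpo l) = (fun z => Phi_eval a l ^ q * cexpo l z)%C.
Proof.
induction q as [|q IH].
- apply functional_extensionality; intros z. simpl. ring.
- simpl Nat.iter. rewrite IH. unfold T.
  rewrite (PhiD_scal a (Phi_eval a l ^ q) (cexpo l)), PhiD_cexpo by (assumption || apply entire_cexpo).
  apply functional_extensionality; intros z. simpl. ring.
Qed.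

Lemma iter_PhiD_bound (q : nat) : exists K s, 0 < K /\ 0 < s /\
  forall f rho B, entire f -> (forall z, Cmod z <= rho + s -> Cmod (f z) <= B) ->
  forall z, Cmod z <= rho -> Cmod (Nat.iter q T f z) <= K * B.
Proof.
induction q as [|q [K [s [HK [Hs IH]]]]].
- exists 1, 1. split; [lra|split; [lra|]]. intros f rho B _ HB z Hz. rewrite Rmult_1_l.
  apply HB. lra.
- destruct (PhiD_bound a a_exp) as [L [r [HL [Hr HT]]]].
  exists (L * K), (s + r). split; [now apply Rmult_lt_0_compat|split; [lra|]].
  intros f rho B Hf HB z Hz. simpl. rewrite Rmult_assoc.
  apply (HT _ rho); [now apply entire_iter_PhiD| |exact Hz].
  apply IH; [exact Hf|]. intros w Hw. apply HB. lra.
Qed.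

Lemma iter_PhiD_minus_bound (q : nat) : exists K s, 0 < K /\ 0 < s /\
  forall f g rho B, entire f -> entire g ->
  (forall z, Cmod z <= rho + s -> Cmod (f z - g z)%C <= B) ->
  forall z, Cmod z <= rho -> Cmod (Nat.iter q T f z - Nat.iter q T g z)%C <= K * B.
Proof.
destruct (iter_PhiD_bound q) as [K [s [HK [Hs H]]]]. exists K, s.
split; [exact HK|split; [exact Hs|]]. intros f g rho B Hf Hg HB z Hz.
specialize (H (fun w => f w + (-1) * g w)%C rho B).
rewrite (iter_PhiD_plus q f (fun w => (-1) * g w)%C Hf (entire_scal (-1) g Hg)) in H.
rewrite (iter_PhiD_scal q (-1) g Hg) in H.
replace (Nat.iter q T f z - Nat.iter q T g z)%C with (Nat.iter q T f z + (-1) * Nat.iter q T g z)%C by ring.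
apply H; [apply entire_plus; [exact Hf|now apply entire_scal]| |exact Hz].
intros w Hw. replace (f w + -1 * g w)%C with (f w - g w)%C by ring. now apply HB.
Qed.

Lemma pow_close (f : C -> C) (r eps : R) (m : nat) : entire f -> 0 < eps ->
  exists del, 0 < del /\ forall g, (forall z, Cmod z <= r -> Cmod (g z - f z)%C <= del) ->
    forall k z, (k <= m)%nat -> Cmod z <= r -> Cmod (g z ^ k - f z ^ k)%C <= eps.
Proof.
intros Hf. revert eps. induction m as [|m IH]; intros eps He.
- exists 1. split; [lra|]. intros g _ k z Hk _. replace k with O by lia. simpl.
  rewrite Cmod_minus_self; lra.
- destruct (entire_bounded f r Hf) as [B [HB0 HB]].
  assert (HBm : 0 < B ^ m) by now apply pow_lt.
  destruct (IH (Rmin eps (eps / (2 * (B + 1))))) as [d [Hd H]].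
  { apply Rmin_glb_lt; [exact He|apply Rdiv_lt_0_compat; lra]. }
  exists (Rmin (Rmin d 1) (eps / (2 * B ^ m))). split.
  { repeat apply Rmin_glb_lt; try lra. apply Rdiv_lt_0_compat; lra. }
  intros g Hg k z Hk Hz.
  pose proof (Rmin_l (Rmin d 1) (eps / (2 * B ^ m))). pose proof (Rmin_r (Rmin d 1) (eps / (2 * B ^ m))).
  pose proof (Rmin_l d 1). pose proof (Rmin_r d 1).
  assert (Hgd : forall w, Cmod w <= r -> Cmod (g w - f w)%C <= d).
  { intros w Hw. specialize (Hg w Hw). lra. }
  pose proof (Rmin_l eps (eps / (2 * (B + 1)))). pose proof (Rmin_r eps (eps / (2 * (B + 1)))).
  destruct (Nat.eq_dec k (S m)) as [->|Hn].
  + specialize (H g Hgd m z (le_n m) Hz). specialize (Hg z Hz). specialize (HB z Hz).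
    simpl. replace (g z * g z ^ m - f z * f z ^ m)%C with
      ((f z + (g z - f z)) * (g z ^ m - f z ^ m) + (g z - f z) * f z ^ m)%C by ring.
    eapply Rle_trans; [apply Cmod_triangle|]. rewrite 2!Cmod_mult, Cmod_pow.
    replace eps with ((B + 1) * (eps / (2 * (B + 1))) + eps / (2 * B ^ m) * B ^ m) by (field; lra).
    apply Rplus_le_compat.
    * apply Rmult_le_compat; try apply Cmod_ge_0; [|lra].
      eapply Rle_trans; [apply Cmod_triangle|]. lra.
    * apply Rmult_le_compat; [apply Cmod_ge_0|apply pow_le, Cmod_ge_0|lra|].
      apply pow_incr. split; [apply Cmod_ge_0|exact HB].
  + specialize (H g Hgd k z ltac:(lia) Hz). lra.
Qed.

(** The bound [eta] strictly below [1 / (n + 1)] makes the inequalities uniformly strict on the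
    disc, hence open; [n] serves both as radius and as accuracy. *)
Definition near_orbit (m : nat) (v : C -> C) (n : nat) (f : C -> C) : Prop :=
  exists q eta, eta < / INR (S n) /\
    (forall k z, (1 <= k < m)%nat -> Cmod z <= INR n ->
       Cmod (Nat.iter q T (fun w => f w ^ k)%C z) <= eta) /\
    (forall z, Cmod z <= INR n -> Cmod (Nat.iter q T (fun w => f w ^ m)%C z - v z)%C <= eta).

Lemma near_orbit_open (m : nat) (v : C -> C) (n : nat) : H_open (near_orbit m v n).
Proof.
intros f Hf [q [eta [He [H1 H2]]]].
destruct (iter_PhiD_minus_bound q) as [K [s [HK [Hs HT]]]].
set (gap := (/ INR (S n) - eta) / 2).
assert (Hgap : 0 < gap) by (unfold gap; lra).
destruct (pow_close f (INR n + s) (gap / K) m Hf) as [d [Hd Hp]]; [now apply Rdiv_lt_0_compat|].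
exists (INR n + s), d. pose proof (pos_INR n).
split; [lra|split; [exact Hd|]]. intros g [Hg Hgf].
assert (Hk : forall k z, (k <= m)%nat -> Cmod z <= INR n ->
  Cmod (Nat.iter q T (fun w => g w ^ k)%C z - Nat.iter q T (fun w => f w ^ k)%C z)%C <= gap).
{ intros k z Hkm Hz. replace gap with (K * (gap / K)) by (field; lra).
  apply (HT _ _ (INR n)); [now apply entire_Cpow|now apply entire_Cpow| |exact Hz].
  intros w Hw. apply Hp; [|exact Hkm|exact Hw]. intros y Hy. left. now apply Hgf. }
exists q, (eta + gap). split; [unfold gap; lra|]. split.
- intros k z Hkm Hz. specialize (H1 k z Hkm Hz). specialize (Hk k z ltac:(lia) Hz).
  eapply Rle_trans; [|apply Rplus_le_compat; [exact H1|exact Hk]].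
  eapply Rle_trans; [|apply Cmod_triangle]. right. f_equal. ring.
- intros z Hz. specialize (H2 z Hz). specialize (Hk m z ltac:(lia) Hz).
  eapply Rle_trans; [|apply Rplus_le_compat; [exact H2|exact Hk]].
  eapply Rle_trans; [|apply Cmod_triangle]. right. f_equal. ring.
Qed.

(** Extracts the true degree: a nonzero element of the algebra is only known to take a nonzero
    value, while the argument divides by the top coefficient. Index [k] stands for the power
    [k + 1]. *)
Lemma psum_trim (d : nat -> C) (N : nat) :
  (forall w, psum (fun k => d k * w ^ S k)%C N = 0) \/
  exists M, d M <> 0 /\ forall w, psum (fun k => d k * w ^ S k)%C N = psum (fun k => d k * w ^ S k)%C (S M).
Proof.
induction N as [|N IH]; [now left|].
destruct (Ceq_dec (d N) 0) as [E|E].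
- assert (H : forall w, psum (fun k => d k * w ^ S k)%C (S N) = psum (fun k => d k * w ^ S k)%C N).
  { intros w. change (psum ?u (S N)) with (psum u N + u N)%C. cbv beta. rewrite E. ring. }
  destruct IH as [IH|[M [HM IH]]].
  + left. intros w. now rewrite H.
  + right. exists M. split; [exact HM|]. intros w. now rewrite H.
- right. now exists N.
Qed.

Lemma poly0_eval_psum (N : nat) (c : nat -> C) (w : C) :
  poly0_eval N c w = psum (fun k => c (S k) * w ^ S k)%C N.
Proof.
unfold poly0_eval. induction N as [|N IH].
- rewrite sum_n_m_zero by lia. reflexivity.
- rewrite sum_n_Sm by lia. rewrite IH. reflexivity.
Qed.

(* The top-degree term is steered towards [g / d_M] while all lower powers are
   sent to 0. *)
Lemma near_orbit_algebra (v : nat -> C -> C) (f : C -> C) : entire f ->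
  (forall g rho eps, entire g -> 0 < eps -> exists i, forall z, Cmod z <= rho ->
     Cmod (g z - v i z)%C <= eps) ->
  (forall m i n, near_orbit (S m) (v i) n f) -> generates_hc_algebra T f.
Proof.
intros Hf Hv HU N c [z0 Hz0].
destruct (psum_trim (fun k => c (S k)) N) as [H0|[M [HM H]]].
{ exfalso. apply Hz0. now rewrite poly0_eval_psum, H0. }
set (d := fun k => c (S k)) in *. change (d M <> RtoC 0) in HM.
assert (EP : (fun z => poly0_eval N c (f z)) = (fun z => psum (fun k => d k * f z ^ S k)%C (S M))).
{ apply functional_extensionality; intros z. now rewrite poly0_eval_psum, H. }
rewrite EP.
assert (Hterm : forall k, entire (fun z => d k * f z ^ S k)%C).
{ intros k. now apply entire_scal, entire_Cpow. }
assert (HP : entire (fun z => psum (fun k => d k * f z ^ S k)%C (S M))).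
{ now apply (entire_psum (fun k z => d k * f z ^ S k)%C). }
split; [exact HP|].
intros g Hg r eps Hr He.
apply Cmod_gt_0 in HM as HMp.
assert (HD : exists D, 0 < D /\ forall k, (k <= M)%nat -> Cmod (d k) <= D).
{ clear. induction M as [|M [D [HD IH]]].
  - pose proof (Cmod_ge_0 (d O)). exists (Cmod (d O) + 1). split; [lra|]. intros k Hk.
    replace k with O by lia. lra.
  - exists (D + Cmod (d (S M))). pose proof (Cmod_ge_0 (d (S M))). split; [lra|]. intros k Hk.
    destruct (Nat.eq_dec k (S M)) as [->|E]; [lra|]. specialize (IH k ltac:(lia)). lra. }
destruct HD as [D [HD HDk]].
destruct (Hv (fun z => / d M * g z)%C r (eps / (4 * Cmod (d M)))) as [i Hi].
{ now apply entire_scal. }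
{ apply Rdiv_lt_0_compat; lra. }
(* The [M + 1] terms together cost at most [(M + 1) * D / (n + 1)]; another [eps / 4] comes from
   replacing [g / d_M] by [v i]. *)
assert (Hn : exists n, r <= INR n /\ INR (S M) * D * / INR (S n) <= eps / 4).
{ assert (HMD : 0 < INR (S M) * D) by (apply Rmult_lt_0_compat; [apply lt_0_INR; lia|exact HD]).
  destruct (INR_unbounded (Rmax r (4 * (INR (S M) * D) / eps))) as [n Hn].
  pose proof (Rmax_l r (4 * (INR (S M) * D) / eps)). pose proof (Rmax_r r (4 * (INR (S M) * D) / eps)).
  exists n. split; [lra|]. assert (HSn : 0 < INR (S n)) by (apply lt_0_INR; lia).
  apply Rmult_le_reg_r with (INR (S n)); [exact HSn|]. rewrite Rmult_assoc, Rinv_l by lra.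
  assert (4 * (INR (S M) * D) / eps < INR (S n)) by (rewrite (S_INR n); lra).
  apply Rle_trans with (eps / 4 * (4 * (INR (S M) * D) / eps)).
  - right; field; lra.
  - apply Rmult_le_compat_l; lra. }
destruct Hn as [n [Hn1 Hn2]].
destruct (HU M i n) as [q [eta [Heta [H1 H2]]]].
exists (Nat.iter q T (fun z => psum (fun k => d k * f z ^ S k)%C (S M))).
split; [|now exists q].
split; [now apply entire_iter_PhiD|].
intros z Hz. assert (Hzn : Cmod z <= INR n) by lra.
rewrite (iter_PhiD_psum q (fun k z => d k * f z ^ S k)%C) by exact Hterm.
assert (Ek : forall k, Nat.iter q T (fun z => d k * f z ^ S k)%C z = (d k * Nat.iter q T (fun z => f z ^ S k)%C z)%C).
{ intros k. rewrite (iter_PhiD_scal q (d k) (fun z => f z ^ S k)%C); [easy|now apply entire_Cpow]. }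
rewrite (psum_ext _ (fun k => d k * Nat.iter q T (fun z => f z ^ S k)%C z)%C) by (intros; apply Ek).
change (psum ?u (S M)) with (psum u M + u M)%C. cbv beta.
assert (B1 : Cmod (psum (fun k => d k * Nat.iter q T (fun z => f z ^ S k)%C z)%C M) <= INR M * (D * / INR (S n))).
{ apply Cmod_psum_le. intros k Hk. rewrite Cmod_mult.
  specialize (H1 (S k) z ltac:(lia) Hzn). specialize (HDk k ltac:(lia)).
  apply Rmult_le_compat; try apply Cmod_ge_0; lra. }
specialize (H2 z Hzn). specialize (Hi z Hz).
set (t := Nat.iter q T (fun z => f z ^ S M)%C z) in *.
set (s := psum (fun k => d k * Nat.iter q T (fun z => f z ^ S k)%C z)%C M) in *.
replace (s + d M * t - g z)%C with (s + (d M * (t - v i z) + - (d M * (/ d M * g z - v i z))))%C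
  by (field; exact HM).
eapply Rle_lt_trans; [apply Cmod_triangle|].
eapply Rle_lt_trans; [apply Rplus_le_compat_l, Cmod_triangle|].
rewrite Cmod_opp, 2!Cmod_mult.
assert (B2 : Cmod (d M) * Cmod (t - v i z)%C <= D * / INR (S n)).
{ specialize (HDk M (le_n M)). apply Rmult_le_compat; try apply Cmod_ge_0; lra. }
assert (B3 : Cmod (d M) * Cmod (/ d M * g z - v i z)%C <= eps / 4).
{ replace (eps / 4) with (Cmod (d M) * (eps / (4 * Cmod (d M)))) by (field; lra).
  apply Rmult_le_compat_l; lra. }
rewrite (S_INR M) in Hn2. lra.
Qed.

End Iterates.

(** * A countable dense family of polynomials *)

Definition rat_of_nat (n : nat) : R :=
  let (p, r) := Cantor.of_nat n in let (s, t) := Cantor.of_nat r in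
  (INR p - INR s) / INR (S t).

(** The denominator is some [t + 1] with [t > / eps]; the signed numerator is split into its
    positive and negative parts, both natural numbers. *)
Lemma rat_of_nat_dense (x eps : R) : 0 < eps -> exists n, Rabs (x - rat_of_nat n) <= eps.
Proof.
intros He. destruct (INR_unbounded (/ eps)) as [t Ht].
assert (HSt : 0 < INR (S t)) by (apply lt_0_INR; lia).
destruct (archimed (x * INR (S t))) as [A1 A2]. set (k := up (x * INR (S t))) in *.
exists (Cantor.to_nat (Z.to_nat k, Cantor.to_nat (Z.to_nat (- k), t))).
unfold rat_of_nat. rewrite 2!Cantor.cancel_of_to.
replace (INR (Z.to_nat k) - INR (Z.to_nat (- k))) with (IZR k).
2:{ rewrite 2!INR_IZR_INZ, <- minus_IZR. f_equal. lia. }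
replace (x - IZR k / INR (S t)) with (- (IZR k - x * INR (S t)) / INR (S t)) by (field; lra).
unfold Rdiv. rewrite Rabs_mult, Rabs_Ropp, Rabs_inv, (Rabs_pos_eq (INR (S t))) by lra.
apply Rmult_le_reg_r with (INR (S t)); [exact HSt|]. rewrite Rmult_assoc, Rinv_l, Rmult_1_r by lra.
rewrite Rabs_pos_eq by lra. apply Rle_trans with 1; [lra|].
rewrite S_INR. apply Rle_trans with (eps * / eps); [right; field; lra|].
apply Rmult_le_compat_l; lra.
Qed.

Definition crat_of_nat (n : nat) : C :=
  let (p, r) := Cantor.of_nat n in (rat_of_nat p, rat_of_nat r).

Lemma crat_of_nat_dense (x : C) (eps : R) : 0 < eps -> exists n, Cmod (x - crat_of_nat n)%C <= eps.
Proof.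
intros He. destruct (rat_of_nat_dense (fst x) (eps / 2)) as [p Hp]; [lra|].
destruct (rat_of_nat_dense (snd x) (eps / 2)) as [r Hr]; [lra|].
exists (Cantor.to_nat (p, r)). unfold crat_of_nat. rewrite Cantor.cancel_of_to.
eapply Rle_trans; [apply (Cmod_pair_le (fst x - rat_of_nat p) (snd x - rat_of_nat r))|]. lra.
Qed.

(* Horner form: one code per coefficient, paired with the code of the rest. *)
Fixpoint poly_of_nat (k n : nat) (z : C) : C :=
  match k with
  | O => 0
  | S k' => let (p, r) := Cantor.of_nat n in crat_of_nat p + z * poly_of_nat k' r z
  end%C.

Lemma entire_poly_of_nat (k n : nat) : entire (poly_of_nat k n).
Proof.
revert n; induction k as [|k IH]; intros n; simpl; [apply entire_const|].
destruct (Cantor.of_nat n) as [p r].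
apply entire_plus; [apply entire_const|]. apply entire_mult; [apply entire_id|apply IH].
Qed.

Lemma poly_of_nat_dense (N : nat) (rho : R) : forall (c : nat -> C) (eps : R), 0 < eps ->
  exists n, forall z, Cmod z <= rho ->
    Cmod (psum (fun k => c k * z ^ k)%C N - poly_of_nat N n z)%C <= eps.
Proof.
induction N as [|N IH]; intros c eps He.
- exists O. intros z _. simpl. rewrite Cmod_minus_self; lra.
- set (r := Rabs rho + 1). pose proof (Rabs_pos rho). pose proof (Rle_abs rho).
  destruct (crat_of_nat_dense (c O) (eps / 2)) as [p Hp]; [lra|].
  destruct (IH (fun k => c (S k)) (eps / (2 * r))) as [n Hn].
  { apply Rdiv_lt_0_compat; unfold r; lra. }
  exists (Cantor.to_nat (p, n)). intros z Hz.
  rewrite psum_S_l.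
  change (poly_of_nat (S N) (Cantor.to_nat (p, n)) z) with
    (let (p, r) := Cantor.of_nat (Cantor.to_nat (p, n)) in crat_of_nat p + z * poly_of_nat N r z)%C.
  rewrite Cantor.cancel_of_to. specialize (Hn z Hz).
  replace (psum (fun k => c (S k) * z ^ S k)%C N) with (z * psum (fun k => c (S k) * z ^ k)%C N)%C.
  2:{ rewrite <- psum_scal. apply psum_ext. intros k _. simpl. ring. }
  set (A := psum (fun k => c (S k) * z ^ k)%C N) in *.
  replace (c O * z ^ 0 + z * A - (crat_of_nat p + z * poly_of_nat N n z))%C with
    ((c O - crat_of_nat p) + z * (A - poly_of_nat N n z))%C by (simpl; ring).
  eapply Rle_trans; [apply Cmod_triangle|]. rewrite Cmod_mult.
  replace eps with (eps / 2 + r * (eps / (2 * r))) by (field; unfold r; lra).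
  apply Rplus_le_compat; [exact Hp|]. apply Rmult_le_compat; try apply Cmod_ge_0; unfold r in *; lra.
Qed.

Lemma countable_dense_polynomials : exists v : nat -> C -> C, (forall i, entire (v i)) /\
  forall g rho eps, entire g -> 0 < eps -> exists i, forall z, Cmod z <= rho ->
    Cmod (g z - v i z)%C <= eps.
Proof.
exists (fun i => let (k, n) := Cantor.of_nat i in poly_of_nat k n). split.
- intros i. destruct (Cantor.of_nat i). apply entire_poly_of_nat.
- intros g rho eps Hg He.
  destruct (entire_Taylor g rho Hg) as [K [HK HT]].
  pose proof (is_lim_seq_div_pow2 K) as L. apply is_lim_seq_spec in L.
  assert (He2 : 0 < eps / 2) by lra.
  destruct (L (mkposreal _ He2)) as [N HN]. specialize (HN N (le_n N)). simpl in HN.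
  rewrite Rminus_0_r in HN. pose proof (Rle_abs (K / 2 ^ N)).
  destruct (poly_of_nat_dense N rho (fun k => Nat.iter k Dop g 0 / INR (fact k))%C (eps / 2) He2) as [n Hn].
  exists (Cantor.to_nat (N, n)). rewrite Cantor.cancel_of_to. intros z Hz.
  specialize (HT N z Hz). specialize (Hn z Hz).
  eapply Rle_trans; [apply (Cmod_minus_triangle _ (tpoly (fun k => Nat.iter k Dop g 0) N z))|].
  replace (psum (fun k => Nat.iter k Dop g 0 / INR (fact k) * z ^ k)%C N) with
    (tpoly (fun k => Nat.iter k Dop g 0) N z) in Hn.
  + lra.
  + unfold tpoly. apply psum_ext. intros k _. field. apply RtoC_fact_neq_0.
Qed.

Lemma residual_of_near_orbit_dense (a : nat -> C) : exp_type a ->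
  (forall m v n, entire v -> H_dense (near_orbit a (S m) v n)) ->
  H_residual (generates_hc_algebra (PhiD a)).
Proof.
intros Ha HD. destruct countable_dense_polynomials as [v [Hv Hvd]].
exists (fun j => let (m, r) := Cantor.of_nat j in let (i, n) := Cantor.of_nat r in
  near_orbit a (S m) (v i) n).
split.
- intros j. destruct (Cantor.of_nat j) as [m r]. destruct (Cantor.of_nat r) as [i n].
  split; [now apply near_orbit_open|now apply HD].
- intros f Hf HU. apply (near_orbit_algebra a Ha v); [exact Hf|exact Hvd|].
  intros m i n. specialize (HU (Cantor.to_nat (m, Cantor.to_nat (i, n)))).
  now rewrite 2!Cantor.cancel_of_to in HU.
Qed.

(** * Powers of exponential sums *)

Lemma funext2 (f g : nat -> C -> C) : (forall q z, f q z = g q z) -> f = g.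
Proof.
intros H. apply functional_extensionality; intros q.
apply functional_extensionality; intros z. apply H.
Qed.

Definition Cbounded (c : nat -> C) : Prop := exists K, forall q, Cmod (c q) <= K.

Lemma Cbounded_mult (c d : nat -> C) : Cbounded c -> Cbounded d -> Cbounded (fun q => c q * d q)%C.
Proof.
intros [K HK] [L HL]. exists (K * L). intros q. rewrite Cmod_mult.
apply Rmult_le_compat; auto using Cmod_ge_0.
Qed.

Lemma Cbounded_pow (c : nat -> C) (k : nat) : Cbounded c -> Cbounded (fun q => c q ^ k)%C.
Proof.
intros Hc. induction k as [|k IH]; simpl.
- exists (Cmod 1). intros; lra.
- now apply Cbounded_mult.
Qed.

(** Coefficients may depend on the number [q] of iterations to be applied, as the [y_j] do, but
    exponents may not; boundedness in [q] is what the decay of [Phi(l)^q] can absorb. *)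
Inductive expsum (P : C -> Prop) : (nat -> C -> C) -> Prop :=
| expsum_zero : expsum P (fun _ _ => RtoC 0)
| expsum_cons c l H : Cbounded c -> P l -> expsum P H ->
    expsum P (fun q z => c q * cexpo l z + H q z)%C.

Lemma expsum_ext (P : C -> Prop) (H H' : nat -> C -> C) :
  (forall q z, H q z = H' q z) -> expsum P H -> expsum P H'.
Proof. intros E. now rewrite (funext2 _ _ E). Qed.

Lemma expsum_plus (P : C -> Prop) (H H' : nat -> C -> C) : expsum P H -> expsum P H' ->
  expsum P (fun q z => H q z + H' q z)%C.
Proof.
intros HH HH'. induction HH as [|c l H Hc Hl HH IH].
- revert HH'. apply expsum_ext. intros; ring.
- apply (expsum_ext P (fun q z => c q * cexpo l z + (H q z + H' q z))%C); [intros; ring|].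
  now apply expsum_cons.
Qed.

Lemma expsum_psum (P : C -> Prop) (H : nat -> nat -> C -> C) (n : nat) :
  (forall i, (i < n)%nat -> expsum P (H i)) -> expsum P (fun q z => psum (fun i => H i q z) n).
Proof.
induction n as [|n IH]; intros HH; simpl; [apply expsum_zero|].
apply expsum_plus; [apply IH; auto|apply HH; auto].
Qed.

Lemma expsum_weaken (P Q : C -> Prop) (H : nat -> C -> C) : (forall l, P l -> Q l) ->
  expsum P H -> expsum Q H.
Proof.
intros HPQ HH. induction HH; [apply expsum_zero|]. apply expsum_cons; auto.
Qed.

Lemma expsum_mult_term (P Q : C -> Prop) (c : nat -> C) (l : C) (H : nat -> C -> C) : Cbounded c ->
  (forall l', P l' -> Q (l + l')%C) -> expsum P H -> expsum Q (fun q z => c q * cexpo l z * H q z)%C.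
Proof.
intros Hc HPQ HH. induction HH as [|d l' H Hd Hl HH IH].
- apply (expsum_ext Q (fun _ _ => RtoC 0)); [intros; ring|apply expsum_zero].
- apply (expsum_ext Q (fun q z => (c q * d q) * cexpo (l + l') z + c q * cexpo l z * H q z)%C).
  + intros q z. rewrite cexpo_plus. ring.
  + apply expsum_cons; [now apply Cbounded_mult|auto|exact IH].
Qed.

Lemma expsum_entire (P : C -> Prop) (H : nat -> C -> C) (q : nat) : expsum P H -> entire (H q).
Proof.
intros HH. induction HH; [apply entire_const|].
apply entire_plus; [apply entire_scal, entire_cexpo|assumption].
Qed.

(** Geometric decay of [Phi(l)^q] beats bounded coefficients, even though the function [H q] changes
    along with the iterate. *)
Lemma expsum_orbit_small (a : nat -> C) (P : C -> Prop) (H : nat -> C -> C) : exp_type a ->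
  (forall l, P l -> Cmod (Phi_eval a l) < 1) -> expsum P H ->
  forall rho eps, 0 < eps -> exists Q, forall q z, (Q <= q)%nat -> Cmod z <= rho ->
    Cmod (Nat.iter q (PhiD a) (H q) z) <= eps.
Proof.
intros Ha HP HH rho. induction HH as [|c l H [K HK] Hl HH IH]; intros eps He.
- exists O. intros q z _ _. rewrite iter_PhiD_zero by exact Ha. rewrite Cmod_0. lra.
- destruct (IH (eps / 2) ltac:(lra)) as [Q1 H1].
  set (E := exp (Cmod l * Rabs rho)). assert (HE : 0 < E) by apply exp_pos.
  assert (HK0 : 0 <= K) by (eapply Rle_trans; [apply Cmod_ge_0|apply (HK O)]).
  assert (L : is_lim_seq (fun q => K * E * Cmod (Phi_eval a l) ^ q) 0).
  { apply is_lim_seq_scal_0. apply is_lim_seq_geom. rewrite Rabs_pos_eq by apply Cmod_ge_0. now apply HP. }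
  apply is_lim_seq_spec in L. assert (He2 : 0 < eps / 2) by lra.
  destruct (L (mkposreal _ He2)) as [Q2 H2]. simpl in H2.
  exists (Nat.max Q1 Q2). intros q z Hq Hz.
  rewrite (iter_PhiD_plus a Ha q (fun z => c q * cexpo l z)%C (H q)
    (entire_scal (c q) (cexpo l) (entire_cexpo l)) (expsum_entire P H q HH)).
  rewrite (iter_PhiD_scal a Ha q (c q) (cexpo l) (entire_cexpo l)), iter_PhiD_cexpo by exact Ha.
  eapply Rle_trans; [apply Cmod_triangle|].
  specialize (H1 q z ltac:(lia) Hz). specialize (H2 q ltac:(lia)). rewrite Rminus_0_r in H2.
  rewrite 2!Cmod_mult, Cmod_pow. pose proof (Rle_abs (K * E * Cmod (Phi_eval a l) ^ q)).
  assert (Hel : Cmod (cexpo l z) <= E).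
  { eapply Rle_trans; [apply Cmod_cexpo_le|]. apply exp_le.
    apply Rmult_le_compat_l; [apply Cmod_ge_0|]. pose proof (Rle_abs rho); lra. }
  pose proof (pow_le _ q (Cmod_ge_0 (Phi_eval a l))) as Hp. specialize (HK q).
  assert (Cmod (c q) * (Cmod (Phi_eval a l) ^ q * Cmod (cexpo l z)) <= K * (Cmod (Phi_eval a l) ^ q * E)).
  { apply Rmult_le_compat; [apply Cmod_ge_0| |exact HK|].
    - apply Rmult_le_pos; [exact Hp|apply Cmod_ge_0].
    - now apply Rmult_le_compat_l. }
  lra.
Qed.

Section WordExpansion.

Variables (N m : nat) (c : nat -> nat -> C) (lam : nat -> C).
Hypothesis c_bounded : forall i, Cbounded (c i).

Definition letter (i q : nat) (z : C) : C := (c i q * cexpo (lam i / INR m) z)%C.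

Definition is_word (k : nat) (w : list nat) : Prop :=
  length w = k /\ forall i, In i w -> (i < N)%nat.

Definition word_exponent (k : nat) (l : C) : Prop :=
  exists w, is_word k w /\ l = (wsum lam w / INR m)%C.

Definition mixed_exponent (k : nat) (l : C) : Prop :=
  exists w, is_word k w /\ (exists i j, In i w /\ In j w /\ i <> j) /\ l = (wsum lam w / INR m)%C.

Lemma wsum_cons_div (i : nat) (w : list nat) :
  (lam i / INR m + wsum lam w / INR m)%C = (wsum lam (i :: w) / INR m)%C.
Proof. simpl. unfold Cdiv. ring. Qed.

Lemma is_word_cons (k i : nat) (w : list nat) : (i < N)%nat -> is_word k w -> is_word (S k) (i :: w).
Proof.
intros Hi [H1 H2]. split; [simpl; now rewrite H1|]. intros j [<-|Hj]; auto.
Qed.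

Lemma expsum_letter_sum_pow (k : nat) :
  expsum (word_exponent k) (fun q z => psum (fun i => letter i q z) N ^ k)%C.
Proof.
induction k as [|k IH].
- apply (expsum_ext _ (fun q z => (fun _ => RtoC 1) q * cexpo 0 z + 0)%C).
  + intros q z. unfold cexpo. rewrite Cmult_0_l, Cexp_0. simpl. ring.
  + apply expsum_cons; [exists (Cmod 1); intros; lra| |apply expsum_zero].
    exists nil. split; [split; [easy|intros i []]|]. simpl. unfold Cdiv. ring.
- apply (expsum_ext _ (fun q z => psum (fun i => letter i q z * psum (fun i => letter i q z) N ^ k) N)%C).
  + intros q z. simpl Cpow. set (s := psum (fun i => letter i q z) N) in *.
    transitivity (s ^ k * s)%C; [|ring]. unfold s at 3. rewrite <- psum_scal.
    apply psum_ext. intros; ring.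
  + apply (expsum_psum _ (fun i q z => letter i q z * psum (fun i => letter i q z) N ^ k)%C). intros i Hi.
    apply (expsum_mult_term (word_exponent k)); [apply c_bounded| |exact IH].
    intros l [w [Hw ->]]. exists (i :: w). split; [now apply is_word_cons|]. apply wsum_cons_div.
Qed.

Lemma expsum_letter_pow (j k : nat) : (j < N)%nat ->
  expsum (fun l => exists w, is_word k w /\ (forall i, In i w -> i = j) /\ l = (wsum lam w / INR m)%C)
    (fun q z => letter j q z ^ k)%C.
Proof.
intros Hj. induction k as [|k IH].
- apply (expsum_ext _ (fun q z => (fun _ => RtoC 1) q * cexpo 0 z + 0)%C).
  + intros q z. unfold cexpo. rewrite Cmult_0_l, Cexp_0. simpl. ring.
  + apply expsum_cons; [exists (Cmod 1); intros; lra| |apply expsum_zero].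
    exists nil. split; [split; [easy|intros i []]|]. split; [intros i []|]. simpl. unfold Cdiv. ring.
- simpl Cpow. eapply (expsum_mult_term _ _ (c j) (lam j / INR m)%C); [apply c_bounded| |exact IH].
  intros l [w [Hw [Hj' ->]]]. exists (j :: w). split; [now apply is_word_cons|].
  split; [|apply wsum_cons_div]. intros i [<-|Hi]; auto.
Qed.

Lemma psum_diag (y : nat -> C) (i n : nat) : (i < n)%nat ->
  psum y n = (y i + psum (fun j => if (j =? i)%nat then 0 else y j) n)%C.
Proof.
induction n as [|n IH]; intros Hi; [lia|]. simpl.
destruct (Nat.eq_dec i n) as [->|E].
- rewrite Nat.eqb_refl. rewrite (psum_ext (fun j => if (j =? n)%nat then 0 else y j) y n).
  + ring.
  + intros k Hk. replace (k =? n)%nat with false; [easy|]. symmetry. apply Nat.eqb_neq. lia.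
- rewrite IH by lia. replace (n =? i)%nat with false; [ring|]. symmetry. apply Nat.eqb_neq. lia.
Qed.

(** Induction on the power: a letter times a power of a different letter is mixed, a letter times a
    mixed product stays mixed, and the diagonal products are the pure powers. *)
Lemma letter_sum_pow_split (k : nat) : exists H, expsum (mixed_exponent (S k)) H /\
  forall q z, (psum (fun i => letter i q z) N ^ S k)%C =
    (psum (fun i => letter i q z ^ S k) N + H q z)%C.
Proof.
induction k as [|k [H [HH E]]].
- exists (fun _ _ => RtoC 0). split; [apply expsum_zero|]. intros q z.
  rewrite Cpow_1_r, Cplus_0_r. apply psum_ext. intros; now rewrite Cpow_1_r.
- exists (fun q z => psum (fun i => psum (fun j => if (j =? i)%nat then 0 else letter i q z * letter j q z ^ S k) N) N
      + psum (fun i => letter i q z * H q z) N)%C. split.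
  + apply expsum_plus.
    * apply (expsum_psum _ (fun i q z => psum (fun j => if (j =? i)%nat then 0 else letter i q z * letter j q z ^ S k) N)%C).
      intros i Hi.
      apply (expsum_psum _ (fun j q z => if (j =? i)%nat then 0 else letter i q z * letter j q z ^ S k)%C).
      intros j Hj. destruct (Nat.eqb_spec j i) as [Eji|Nji]; [apply expsum_zero|].
      eapply (expsum_mult_term _ _ (c i) (lam i / INR m)%C); [apply c_bounded| |apply (expsum_letter_pow j (S k) Hj)].
      intros l [w [Hw [Hall ->]]]. exists (i :: w). split; [now apply is_word_cons|].
      split; [|apply wsum_cons_div]. exists i, j. split; [now left|]. split; [|congruence].
      right. destruct Hw as [Hl _]. destruct w as [|x w]; [easy|].
      left. apply Hall. now left.
    * apply (expsum_psum _ (fun i q z => letter i q z * H q z)%C). intros i Hi.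
      apply (expsum_mult_term (mixed_exponent (S k))); [apply c_bounded| |exact HH].
      intros l [w [Hw [[x [y [Hx [Hy Hxy]]]] ->]]]. exists (i :: w). split; [now apply is_word_cons|].
      split; [|apply wsum_cons_div]. exists x, y. split; [now right|]. split; [now right|exact Hxy].
  + intros q z. change (psum (fun i => letter i q z) N ^ S (S k))%C with
      (psum (fun i => letter i q z) N * psum (fun i => letter i q z) N ^ S k)%C.
    rewrite E, Cmult_plus_distr_l, Cplus_assoc. f_equal.
    * rewrite <- psum_plus.
      rewrite Cmult_comm, <- psum_scal. apply psum_ext. intros i Hi.
      rewrite Cmult_comm, <- psum_scal, (psum_diag _ i N Hi). reflexivity.
    * rewrite Cmult_comm, <- psum_scal. apply psum_ext. intros; ring.
Qed.

End WordExpansion.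

(** * Uniform choices and perturbation of exponents *)

Lemma psum_app (u : nat -> C) (n m : nat) :
  psum u (n + m) = (psum u n + psum (fun j => u (n + j)%nat) m)%C.
Proof.
induction m as [|m IH]; [rewrite Nat.add_0_r; simpl; ring|].
rewrite Nat.add_succ_r. simpl. rewrite IH. ring.
Qed.

Lemma common_threshold (P : nat -> nat -> Prop) (n : nat) :
  (forall k, (k < n)%nat -> exists Q, forall q, (Q <= q)%nat -> P k q) ->
  exists Q, forall k q, (k < n)%nat -> (Q <= q)%nat -> P k q.
Proof.
induction n as [|n IH]; intros H.
- exists O. intros; lia.
- destruct IH as [Q1 H1]; [auto|]. destruct (H n) as [Q2 H2]; [auto|].
  exists (Nat.max Q1 Q2). intros k q Hk Hq.
  destruct (Nat.eq_dec k n) as [->|E]; [apply H2; lia|apply H1; lia].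
Qed.

Lemma common_radius (P : nat -> R -> Prop) (n : nat) :
  (forall k d d', P k d -> 0 < d' <= d -> P k d') ->
  (forall k, (k < n)%nat -> exists d, 0 < d /\ P k d) ->
  exists d, 0 < d /\ forall k, (k < n)%nat -> P k d.
Proof.
intros Hmon. induction n as [|n IH]; intros H.
- exists 1. split; [lra|]. intros; lia.
- destruct IH as [d1 [D1 H1]]; [auto|]. destruct (H n) as [d2 [D2 H2]]; [auto|].
  exists (Rmin d1 d2). split; [now apply Rmin_glb_lt|]. intros k Hk.
  pose proof (Rmin_l d1 d2). pose proof (Rmin_r d1 d2).
  assert (0 < Rmin d1 d2) by now apply Rmin_glb_lt.
  destruct (Nat.eq_dec k n) as [->|E].
  + apply (Hmon n d2); [exact H2|lra].
  + apply (Hmon k d1); [apply H1; lia|lra].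
Qed.

(** A minimum over the finitely many words of length at most [k], organized as an induction on
    length with a minimum over the first letter at each stage. *)
Lemma common_radius_words (N k : nat) : forall P : list nat -> R -> Prop,
  (forall w d d', P w d -> 0 < d' <= d -> P w d') ->
  (forall w, exists d, 0 < d /\ P w d) ->
  exists d, 0 < d /\ forall w, (length w <= k)%nat -> (forall i, In i w -> (i < N)%nat) -> P w d.
Proof.
induction k as [|k IH]; intros P Hmon H.
- destruct (H nil) as [d [Hd HP]]. exists d. split; [exact Hd|].
  intros w Hw _. destruct w; [exact HP|simpl in Hw; lia].
- destruct (H nil) as [d0 [Hd0 HP0]].
  destruct (common_radius (fun i d => forall w, (length w <= k)%nat ->
     (forall i, In i w -> (i < N)%nat) -> P (i :: w) d) N) as [d1 [Hd1 H1]].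
  + intros i d d' Hi Hdd w Hw HN. apply (Hmon (i :: w) d); auto.
  + intros i _. apply (IH (fun w => P (i :: w))).
    * intros w d d'. apply Hmon.
    * intros w. apply H.
  + exists (Rmin d0 d1). assert (0 < Rmin d0 d1) by now apply Rmin_glb_lt.
    split; [assumption|]. pose proof (Rmin_l d0 d1). pose proof (Rmin_r d0 d1).
    intros w Hw HN. destruct w as [|i w].
    * apply (Hmon nil d0); [exact HP0|lra].
    * apply (Hmon (i :: w) d1); [|lra]. simpl in Hw. apply H1; [apply HN; now left|lia|].
      intros j Hj. apply HN. now right.
Qed.

Lemma entire_lt_nbhd (F : C -> C) (p : C) : entire F -> Cmod (F p) < 1 ->
  exists d, 0 < d /\ forall z, Cmod (z - p)%C < d -> Cmod (F z) < 1.
Proof.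
intros HF Hp. pose proof (entire_Dop F p HF) as D. rewrite Cderiv_at_eps in D.
destruct (D 1 Rlt_0_1) as [d [Hd H]].
set (L := Cmod (Dop F p) + 1). assert (HL : 1 <= L) by (pose proof (Cmod_ge_0 (Dop F p)); unfold L; lra).
exists (Rmin d ((1 - Cmod (F p)) / L)). split.
{ apply Rmin_glb_lt; [exact Hd|apply Rdiv_lt_0_compat; lra]. }
intros z Hz. pose proof (Rmin_l d ((1 - Cmod (F p)) / L)). pose proof (Rmin_r d ((1 - Cmod (F p)) / L)).
specialize (H (z - p)%C ltac:(lra)). replace (p + (z - p))%C with z in H by ring.
replace (F z) with (F p + (Dop F p * (z - p) + (F z - F p - Dop F p * (z - p))))%C by ring.
eapply Rle_lt_trans; [apply Cmod_triangle|].
assert (L * Cmod (z - p)%C < 1 - Cmod (F p)).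
{ replace (1 - Cmod (F p)) with (L * ((1 - Cmod (F p)) / L)) by (field; lra).
  apply Rmult_lt_compat_l; lra. }
assert (Cmod (Dop F p * (z - p) + (F z - F p - Dop F p * (z - p)))%C <= L * Cmod (z - p)%C); [|lra].
eapply Rle_trans; [apply Cmod_triangle|]. rewrite Cmod_mult. unfold L. lra.
Qed.

Lemma wsum_close (mu lam : nat -> C) (N : nat) (d : R) (w : list nat) :
  (forall i, (i < N)%nat -> Cmod (lam i - mu i)%C <= d) -> (forall i, In i w -> (i < N)%nat) ->
  Cmod (wsum lam w - wsum mu w)%C <= INR (length w) * d.
Proof.
intros Hd. induction w as [|i w IH]; intros HN.
- simpl. rewrite Cmod_minus_self. lra.
- change (length (i :: w)) with (S (length w)). rewrite S_INR. simpl wsum.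
  replace (lam i + wsum lam w - (mu i + wsum mu w))%C with
    ((lam i - mu i) + (wsum lam w - wsum mu w))%C by ring.
  eapply Rle_trans; [apply Cmod_triangle|].
  specialize (IH ltac:(intros j Hj; apply HN; now right)).
  specialize (Hd i ltac:(apply HN; now left)). lra.
Qed.

(** The words whose exponentials the iterates must kill: those coming from powers below [m] and the
    mixed ones of length [m]. Constant words of length [m] are treated apart, since some of them
    carry the target. *)
Definition proper_word (N m : nat) (w : list nat) : Prop :=
  w <> nil /\ (forall i, In i w -> (i < N)%nat) /\
  ((length w < m)%nat \/ (length w = m /\ exists i j, In i w /\ In j w /\ i <> j)).

(** Each strict inequality is an open condition and finitely many words are concerned. As their
    length is at most [m], dividing by [m] keeps the displacement of an exponent below that of the
    letters. *)
Lemma proper_word_perturb (F : C -> C) (N m : nat) (mu : nat -> C) : entire F -> (0 < m)%nat ->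
  (forall w, proper_word N m w -> Cmod (F (wsum mu w / INR m)%C) < 1) ->
  exists d, 0 < d /\ forall lam, (forall i, (i < N)%nat -> Cmod (lam i - mu i)%C <= d) ->
    forall w, proper_word N m w -> Cmod (F (wsum lam w / INR m)%C) < 1.
Proof.
intros HF Hm Hmu.
assert (Hm0 : 0 < INR m) by (apply lt_0_INR; lia).
destruct (common_radius_words N m (fun w d => proper_word N m w ->
  forall lam, (forall i, (i < N)%nat -> Cmod (lam i - mu i)%C <= d) ->
  Cmod (F (wsum lam w / INR m)%C) < 1)) as [d [Hd H]].
- intros w d d' H Hd Hw lam Hl. apply H; [exact Hw|]. intros i Hi. specialize (Hl i Hi). lra.
- intros w. destruct (classic (proper_word N m w)) as [Hw|Hw].
  2:{ exists 1. split; [lra|]. intros; contradiction. }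
  destruct (entire_lt_nbhd F _ HF (Hmu w Hw)) as [d [Hd H]].
  exists (d / 2). split; [lra|]. intros _ lam Hl. apply H.
  destruct Hw as [_ [HN Hlen]].
  assert (Hlm : INR (length w) <= INR m) by (apply le_INR; lia).
  pose proof (wsum_close mu lam N (d / 2) w Hl HN) as P.
  replace (wsum lam w / INR m - wsum mu w / INR m)%C with ((wsum lam w - wsum mu w) / INR m)%C
    by (unfold Cdiv; ring).
  assert (HmC : RtoC (INR m) <> 0) by (apply RtoC_neq_0; lra).
  rewrite Cmod_div, Cmod_R, Rabs_pos_eq by (assumption || lra).
  apply Rmult_lt_reg_r with (INR m); [exact Hm0|]. unfold Rdiv at 1. rewrite Rmult_assoc, Rinv_l, Rmult_1_r by lra.
  apply Rle_lt_trans with (INR m * (d / 2)); [|nra].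
  eapply Rle_trans; [exact P|]. apply Rmult_le_compat_r; lra.
- exists d. split; [exact Hd|]. intros lam Hl w Hw. apply (H w); auto.
  + destruct Hw as [_ [_ Hlen]]. lia.
  + apply Hw.
Qed.

Lemma cexpo_close (l : C) (rho eps : R) : 0 < eps -> exists d, 0 < d /\
  forall l', Cmod (l' - l)%C <= d -> forall z, Cmod z <= rho -> Cmod (cexpo l' z - cexpo l z)%C <= eps.
Proof.
intros He. set (r := Rabs rho). pose proof (Rabs_pos rho).
set (K := exp (Cmod l * r) * (exp r * r) + 1).
assert (HK : 1 <= K).
{ unfold K. pose proof (exp_pos (Cmod l * r)). pose proof (exp_pos r).
  assert (0 <= exp (Cmod l * r) * (exp r * r)); [|lra].
  apply Rmult_le_pos; [lra|]. apply Rmult_le_pos; [lra|assumption]. }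
exists (Rmin 1 (eps / K)). split; [apply Rmin_glb_lt; [lra|apply Rdiv_lt_0_compat; lra]|].
intros l' Hl z Hz0.
assert (Hz : Cmod z <= r) by (pose proof (Rle_abs rho); unfold r; lra).
pose proof (Rmin_l 1 (eps / K)). pose proof (Rmin_r 1 (eps / K)).
set (d := (l' - l)%C) in *.
pose proof (cexpo_Taylor d z 1 r ltac:(lra) Hz) as T.
replace (tpoly (fun j => d ^ j)%C 1 z) with (RtoC 1) in T by (unfold tpoly; simpl; field).
rewrite 2!pow_1 in T.
replace l' with (l + d)%C by (unfold d; ring). rewrite cexpo_plus.
replace (cexpo l z * cexpo d z - cexpo l z)%C with (cexpo l z * (cexpo d z - 1))%C by ring.
rewrite Cmod_mult.
assert (Hel : Cmod (cexpo l z) <= exp (Cmod l * r)).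
{ eapply Rle_trans; [apply Cmod_cexpo_le|]. apply exp_le.
  apply Rmult_le_compat_l; [apply Cmod_ge_0|exact Hz]. }
apply Rle_trans with (exp (Cmod l * r) * (Cmod d * (exp r * r))).
- apply Rmult_le_compat; auto using Cmod_ge_0.
- pose proof (Cmod_ge_0 d).
  apply Rle_trans with (K * Cmod d); [unfold K; lra|].
  apply Rle_trans with (K * (eps / K)); [apply Rmult_le_compat_l; lra|right; field; lra].
Qed.

Lemma cspan_close (s b : nat -> C) (N : nat) (rho eps : R) : 0 < eps -> exists d, 0 < d /\
  forall s', (forall j, (j < N)%nat -> Cmod (s' j - s j)%C <= d) ->
  forall z, Cmod z <= rho -> Cmod (cspan s' N b z - cspan s N b z)%C <= eps.
Proof.
revert eps. induction N as [|N IH]; intros eps He.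
- exists 1. split; [lra|]. intros s' _ z _. unfold cspan; simpl.
  rewrite Cmod_minus_self; lra.
- destruct (IH (eps / 2) ltac:(lra)) as [d1 [Hd1 H1]].
  pose proof (Cmod_ge_0 (b N)).
  destruct (cexpo_close (s N) rho (eps / (2 * (Cmod (b N) + 1)))) as [d2 [Hd2 H2]].
  { apply Rdiv_lt_0_compat; lra. }
  exists (Rmin d1 d2). split; [now apply Rmin_glb_lt|]. intros s' Hs z Hz.
  pose proof (Rmin_l d1 d2). pose proof (Rmin_r d1 d2).
  specialize (H1 s' ltac:(intros j Hj; specialize (Hs j ltac:(lia)); lra) z Hz).
  specialize (H2 (s' N) ltac:(specialize (Hs N ltac:(lia)); lra) z Hz).
  unfold cspan in *. simpl.
  match goal with |- Cmod ?e <= _ => replace e with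
    ((psum (fun k => b k * cexpo (s' k) z) N - psum (fun k => b k * cexpo (s k) z) N)
     + b N * (cexpo (s' N) z - cexpo (s N) z))%C by ring end.
  eapply Rle_trans; [apply Cmod_triangle|]. rewrite Cmod_mult.
  replace eps with (eps / 2 + (Cmod (b N) + 1) * (eps / (2 * (Cmod (b N) + 1)))) by (field; lra).
  apply Rplus_le_compat; [exact H1|]. apply Rmult_le_compat; auto using Cmod_ge_0; lra.
Qed.

Lemma Cmod_le_of_pow_le (z : C) (m : nat) (eta : R) : (0 < m)%nat -> 0 <= eta ->
  Cmod (z ^ m)%C <= eta ^ m -> Cmod z <= eta.
Proof.
intros Hm He H. rewrite Cmod_pow in H.
destruct (Rle_lt_dec (Cmod z) eta) as [L|L]; [exact L|exfalso].
assert (eta ^ m < Cmod z ^ m); [|lra].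
clear H. induction m as [|m IH]; [lia|].
destruct m as [|m]; [simpl; lra|].
specialize (IH ltac:(lia)). change (eta * eta ^ S m < Cmod z * Cmod z ^ S m).
pose proof (pow_le eta (S m) He). nra.
Qed.

(** In modulus [y q ^ m] decays geometrically, hence so does [y q], whichever root is chosen for
    each [q]. *)
Lemma root_sequence_vanishing (b : C) (t : C) (m : nat) (y : nat -> C) : (0 < m)%nat -> 1 < Cmod t ->
  (forall q, (y q ^ m)%C = (b / t ^ q)%C) ->
  Cbounded y /\ forall eta, 0 < eta -> exists Q, forall q, (Q <= q)%nat -> Cmod (y q) <= eta.
Proof.
intros Hm Ht Hy.
assert (Ht0 : t <> 0) by (intros ->; rewrite Cmod_0 in Ht; lra).
assert (Hmod : forall q, Cmod (y q ^ m)%C = Cmod b * (/ Cmod t) ^ q).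
{ intros q. rewrite Hy, Cmod_div, Cmod_pow by now apply Cpow_nz. unfold Rdiv. now rewrite pow_inv. }
assert (Hinv : 0 < / Cmod t < 1).
{ split; [apply Rinv_0_lt_compat; lra|]. rewrite <- Rinv_1. apply Rinv_lt_contravar; lra. }
pose proof (Cmod_ge_0 b) as Hb. split.
- exists (1 + Cmod b). intros q. apply (Cmod_le_of_pow_le _ m); [exact Hm|lra|].
  rewrite Hmod. apply Rle_trans with (1 + Cmod b).
  + assert ((/ Cmod t) ^ q <= 1) by (rewrite <- (pow1 q); apply pow_incr; lra).
    assert (0 <= (/ Cmod t) ^ q) by (apply pow_le; lra). nra.
  + rewrite <- (pow_1 (1 + Cmod b)) at 1. apply Rle_pow; [lra|lia].
- intros eta He. assert (Hem : 0 < eta ^ m) by now apply pow_lt.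
  assert (L : is_lim_seq (fun q => Cmod b * (/ Cmod t) ^ q) 0).
  { apply is_lim_seq_scal_0. apply is_lim_seq_geom. rewrite Rabs_pos_eq; lra. }
  apply is_lim_seq_spec in L. destruct (L (mkposreal _ Hem)) as [Q HQ]. simpl in HQ.
  exists Q. intros q Hq. specialize (HQ q Hq). rewrite Rminus_0_r in HQ.
  pose proof (Rle_abs (Cmod b * (/ Cmod t) ^ q)).
  apply (Cmod_le_of_pow_le _ m); [exact Hm|lra|]. rewrite Hmod. lra.
Qed.

Lemma cspan_small (s : nat -> C) (N : nat) (rho eps : R) : 0 < eps -> exists eta, 0 < eta /\
  forall y, (forall j, (j < N)%nat -> Cmod (y j) <= eta) ->
  forall z, Cmod z <= rho -> Cmod (cspan s N y z) <= eps.
Proof.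
intros He.
assert (HE : exists E, 0 < E /\ forall j z, (j < N)%nat -> Cmod z <= rho -> Cmod (cexpo (s j) z) <= E).
{ clear. induction N as [|N [E [HE H]]].
  - exists 1. split; [lra|]. intros; lia.
  - destruct (entire_bounded (cexpo (s N)) rho (entire_cexpo _)) as [B [HB HBz]].
    exists (E + B). split; [lra|]. intros j z Hj Hz.
    destruct (Nat.eq_dec j N) as [->|Hn]; [specialize (HBz z Hz); lra|].
    specialize (H j z ltac:(lia) Hz). lra. }
destruct HE as [E [HE H]]. pose proof (pos_INR N).
exists (eps / ((INR N + 1) * E)). split.
{ apply Rdiv_lt_0_compat; [exact He|]. apply Rmult_lt_0_compat; lra. }
intros y Hy z Hz. unfold cspan.
apply Rle_trans with (INR N * (eps / ((INR N + 1) * E) * E)).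
- apply Cmod_psum_le. intros k Hk. rewrite Cmod_mult.
  apply Rmult_le_compat; auto using Cmod_ge_0.
- replace (eps / ((INR N + 1) * E) * E) with (eps / (INR N + 1)) by (field; lra).
  apply Rmult_le_reg_r with (INR N + 1); [lra|]. unfold Rdiv.
  replace (INR N * (eps * / (INR N + 1)) * (INR N + 1)) with (INR N * eps) by (field; lra). nra.
Qed.

(** * Construction of the approximants *)

Lemma choice_function {X Y : Type} (P : X -> Y -> Prop) : (forall x, exists y, P x y) ->
  exists f : X -> Y, forall x, P x (f x).
Proof.
intros H. exists (fun x => proj1_sig (constructive_indefinite_description _ (H x))).
intros x. exact (proj2_sig (constructive_indefinite_description _ (H x))).
Qed.

Lemma cexpo_div_pow (l z : C) (m : nat) : (0 < m)%nat -> (cexpo (l / INR m) z ^ m)%C = cexpo l z.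
Proof.
intros Hm. unfold cexpo. rewrite Cexp_pow. f_equal. field.
apply RtoC_neq_0, not_0_INR. lia.
Qed.

Lemma iter_PhiD_cspan (a : nat -> C) (q N : nat) (s y : nat -> C) : exp_type a ->
  Nat.iter q (PhiD a) (cspan s N y) = cspan s N (fun k => Phi_eval a (s k) ^ q * y k)%C.
Proof.
intros Ha. unfold cspan.
rewrite (iter_PhiD_psum a Ha q (fun k z => y k * cexpo (s k) z)%C)
  by (intros k; apply entire_scal, entire_cexpo).
apply functional_extensionality; intros z. apply psum_ext. intros k _.
rewrite (iter_PhiD_scal a Ha q (y k) (cexpo (s k)) (entire_cexpo _)), iter_PhiD_cexpo by exact Ha.
ring.
Qed.

(** The given function [u] is approximated with exponents [bet k / m], because [g] itself must be
    near [u]; the target [v] is approximated with undivided exponents [s j], because it is the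
    [m]-th power of [g] that must reach it. *)
Lemma near_orbit_of_words (a : nat -> C) (m0 : nat) (v : C -> C) (n : nat) (u : C -> C) (r eps : R)
  (bet : nat -> C) (N1 : nat) (x : nat -> C) (s : nat -> C) (N2 : nat) (b : nat -> C) :
  let m := S m0 in let F := Phi_eval a in
  let mu := fun i => if (i <? N1)%nat then bet i else s (i - N1)%nat in
  exp_type a -> 0 < eps -> (exists w, Cmod (F w) < 1) ->
  (forall j, Cmod (F (s j)) = 1) -> (forall i, Cmod (F (bet i)) < 1) ->
  (forall w, proper_word (N1 + N2) m w -> Cmod (F (wsum mu w / INR m)%C) < 1) ->
  (forall z, Cmod z <= r -> Cmod (u z - cspan (fun k => bet k / INR m)%C N1 x z)%C <= eps / 3) ->
  (forall z, Cmod z <= INR n -> Cmod (v z - cspan s N2 b z)%C <= / INR (S n) / 4) ->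
  exists g, Hnbhd u r eps g /\ near_orbit a m v n g.
Proof.
intros m F mu Ha He [w0 Hw0] Hs Hbet Hwords Hu Hv.
assert (HF : entire F) by now apply entire_Phi_eval.
assert (Hm : (0 < m)%nat) by (unfold m; lia).
set (e0 := / INR (S n)) in *.
assert (He0 : 0 < e0) by (apply Rinv_0_lt_compat, lt_0_INR; lia).
(* Two tolerances for moving the [s j] off the arc: [d1] keeps the proper words where the modulus is
   below 1, [d2] keeps the exponential sum near the target. *)
destruct (proper_word_perturb F (N1 + N2) m mu HF Hm Hwords) as [d1 [Hd1 H1]].
destruct (cspan_close s b N2 (INR n) (e0 / 4)) as [d2 [Hd2 H2]]; [lra|].
destruct (choice_function (fun j g => Cmod (g - s j)%C < Rmin d1 d2 /\ 1 < Cmod (F g))) as [g Hg].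
{ intros j. apply entire_open_modulus; [exact HF| |apply Hs|now apply Rmin_glb_lt].
  exists w0. intros E. specialize (Hs j). rewrite <- E in Hs. lra. }
assert (Hg1 : forall j, Cmod (g j - s j)%C <= d1).
{ intros j. destruct (Hg j) as [Hj _]. pose proof (Rmin_l d1 d2). lra. }
assert (Hg2 : forall j, Cmod (g j - s j)%C <= d2).
{ intros j. destruct (Hg j) as [Hj _]. pose proof (Rmin_r d1 d2). lra. }
assert (HFg : forall j q, (F (g j) ^ q)%C <> 0).
{ intros j q. apply Cpow_nz. intros E. destruct (Hg j) as [_ Hj]. rewrite E, Cmod_0 in Hj. lra. }
(* Indexed by pairs, as the root depends on the letter [j] and on the number [q] of iterations. *)
destruct (choice_function (fun (p : nat * nat) y => (y ^ m)%C = (b (fst p) / F (g (fst p)) ^ snd p)%C))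
  as [y0 Hy0].
{ intros p. now apply Croot. }
set (y := fun j q => y0 (j, q)).
assert (Hy : forall j q, (y j q ^ m)%C = (b j / F (g j) ^ q)%C) by (intros j q; apply (Hy0 (j, q))).
assert (Hyv : forall j, Cbounded (y j) /\
  forall eta, 0 < eta -> exists Q, forall q, (Q <= q)%nat -> Cmod (y j q) <= eta).
{ intros j. apply (root_sequence_vanishing (b j) (F (g j)) m); [exact Hm|apply Hg|apply Hy]. }
set (lam := fun i => if (i <? N1)%nat then bet i else g (i - N1)%nat).
set (c := fun i q => if (i <? N1)%nat then x i else y (i - N1)%nat q).
assert (Hc : forall i, Cbounded (c i)).
{ intros i. unfold c. destruct (i <? N1)%nat; [|apply Hyv]. exists (Cmod (x i)). intros; lra. }
assert (Hlam : forall w, proper_word (N1 + N2) m w -> Cmod (F (wsum lam w / INR m)%C) < 1).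
{ apply H1. intros i _. unfold lam, mu. destruct (i <? N1)%nat; [|apply Hg1].
  rewrite Cmod_minus_self; lra. }
assert (Lam1 : forall i, (i < N1)%nat -> lam i = bet i).
{ intros i Hi. unfold lam. apply Nat.ltb_lt in Hi. now rewrite Hi. }
assert (Lam2 : forall j, lam (N1 + j)%nat = g j).
{ intros j. unfold lam. replace (N1 + j <? N1)%nat with false; [f_equal; lia|].
  symmetry; apply Nat.ltb_ge; lia. }
assert (C1 : forall i q, (i < N1)%nat -> c i q = x i).
{ intros i q Hi. unfold c. apply Nat.ltb_lt in Hi. now rewrite Hi. }
assert (C2 : forall j q, c (N1 + j)%nat q = y j q).
{ intros j q. unfold c. replace (N1 + j <? N1)%nat with false; [f_equal; lia|].
  symmetry; apply Nat.ltb_ge; lia. }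
set (f := fun q z => psum (fun i => letter m c lam i q z) (N1 + N2)).
assert (Ef : forall q z, f q z = (cspan (fun k => bet k / INR m)%C N1 x z +
   cspan (fun j => g j / INR m)%C N2 (fun j => y j q) z)%C).
{ intros q z. unfold f. rewrite psum_app. unfold cspan. f_equal; apply psum_ext; intros i Hi; unfold letter.
  - now rewrite C1, Lam1.
  - now rewrite C2, Lam2. }
assert (Hf : forall q, entire (f q)).
{ intros q. apply (entire_psum (fun i z => letter m c lam i q z)). intros k.
  apply entire_scal, entire_cexpo. }
destruct (cspan_small (fun j => g j / INR m)%C N2 r (eps / 3)) as [eta [Heta Hsm]]; [lra|].
destruct (common_threshold (fun j q => Cmod (y j q) <= eta) N2) as [Q1 HQ1].
{ intros j _. now apply Hyv. }
set (small := fun l : C => Cmod (F l) < 1).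
destruct (common_threshold (fun k q => (1 <= k)%nat -> forall z, Cmod z <= INR n ->
   Cmod (Nat.iter q (PhiD a) (fun w => f q w ^ k)%C z) <= e0 / 4) m) as [Q2 HQ2].
{ intros k Hk. destruct (Nat.eq_dec k 0) as [->|Hk0]; [exists O; intros; lia|].
  destruct (expsum_orbit_small a small (fun q z => f q z ^ k)%C Ha (fun l Hl => Hl)) with (rho := INR n) (eps := e0 / 4)
    as [Q HQ]; [|lra|exists Q; intros; now apply HQ].
  apply (expsum_weaken (word_exponent (N1 + N2) m lam k)); [|now apply expsum_letter_sum_pow].
  intros l [w [[Hw1 Hw2] ->]]. refine (Hlam w _). split; [|split; [exact Hw2|left; lia]].
  intros ->. simpl in Hw1. lia. }
destruct (letter_sum_pow_split (N1 + N2) m c lam Hc m0) as [H [HH EH]]. fold m in HH, EH.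
(* The pure powers of the first [N1] letters are not mixed, but their exponents are the [bet i],
   where the modulus is below 1; they join the remainder. *)
set (H' := fun q z => (psum (fun i => letter m c lam i q z ^ m) N1 + H q z)%C).
assert (HH' : expsum small H').
{ apply expsum_plus.
  - apply (expsum_psum small (fun i q z => letter m c lam i q z ^ m)%C). intros i Hi.
    apply (expsum_ext _ (fun q z => (c i q ^ m) * cexpo (lam i) z + 0)%C).
    + intros q z. unfold letter. rewrite Cpow_mult_l, cexpo_div_pow by exact Hm. ring.
    + apply expsum_cons; [now apply Cbounded_pow| |apply expsum_zero].
      unfold small. rewrite Lam1 by exact Hi. apply Hbet.
  - apply (expsum_weaken (mixed_exponent (N1 + N2) m lam m)); [|exact HH].
    intros l [w [[Hw1 Hw2] [Hij ->]]]. refine (Hlam w _). split; [|split; [exact Hw2|right; now split]].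
    intros ->. simpl in Hw1. lia. }
assert (Efm : forall q, (fun z => f q z ^ m)%C = (fun z => cspan g N2 (fun j => y j q ^ m)%C z + H' q z)%C).
{ intros q. apply functional_extensionality; intros z. unfold f. rewrite EH, psum_app. unfold H'.
  replace (psum (fun j => letter m c lam (N1 + j) q z ^ m)%C N2) with (cspan g N2 (fun j => y j q ^ m)%C z); [ring|].
  unfold cspan. apply psum_ext. intros j Hj. unfold letter.
  now rewrite C2, Lam2, Cpow_mult_l, cexpo_div_pow by exact Hm. }
destruct (expsum_orbit_small a small H' Ha (fun l Hl => Hl) HH' (INR n) (e0 / 4)) as [Q3 HQ3]; [lra|].
(* One [q] serves for the smallness of the [y_j], of the lower powers and of the remainder. *)
set (q := Nat.max Q1 (Nat.max Q2 Q3)).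
exists (f q). split.
- split; [apply Hf|]. intros z Hz. rewrite Ef.
  specialize (Hu z Hz).
  assert (Hy3 : Cmod (cspan (fun j => g j / INR m)%C N2 (fun j => y j q) z) <= eps / 3).
  { apply Hsm; [|exact Hz]. intros j Hj. apply HQ1; [exact Hj|unfold q; lia]. }
  set (A1 := cspan (fun k => bet k / INR m)%C N1 x z) in *.
  set (A2 := cspan (fun j => g j / INR m)%C N2 (fun j => y j q) z) in *.
  replace (A1 + A2 - u z)%C with (- (u z - A1) + A2)%C by ring.
  eapply Rle_lt_trans; [apply Cmod_triangle|]. rewrite Cmod_opp. lra.
(* Three errors of [e0 / 4]: moving [s] to [g], approximating [v], and the remainder [H']. The total
   stays strictly below [e0]. *)
- exists q, (3 * (e0 / 4)). split; [fold e0; lra|]. split.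
  + intros k z [Hk1 Hk2] Hz. specialize (HQ2 k q Hk2 ltac:(unfold q; lia) Hk1 z Hz). lra.
  + intros z Hz. rewrite Efm.
    rewrite (iter_PhiD_plus a Ha q _ _ (entire_cspan g N2 (fun j => y j q ^ m)%C) (expsum_entire small H' q HH')).
    rewrite iter_PhiD_cspan by exact Ha.
    replace (cspan g N2 (fun k => Phi_eval a (g k) ^ q * y k q ^ m)%C z) with (cspan g N2 b z).
    2:{ unfold cspan. apply psum_ext. intros j _. rewrite Hy. fold F. field. apply HFg. }
    specialize (HQ3 q z ltac:(unfold q; lia) Hz). specialize (Hv z Hz).
    specialize (H2 g ltac:(intros j _; apply Hg2) z Hz).
    set (I := Nat.iter q (PhiD a) (H' q) z) in *.
    replace (cspan g N2 b z + I - v z)%C with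
      ((cspan g N2 b z - cspan s N2 b z) + (- (v z - cspan s N2 b z) + I))%C by ring.
    eapply Rle_trans; [apply Cmod_triangle|].
    eapply Rle_trans; [apply Rplus_le_compat_l, Cmod_triangle|]. rewrite Cmod_opp. lra.
Qed.

Lemma near_orbit_dense (a : nat -> C) (G : C -> Prop) :
  exp_type a -> compact_arc G -> strictly_convex G ->
  (forall z, G z -> Cmod (Phi_eval a z) = 1) ->
  (forall z, conv (fun w => G w \/ w = RtoC 0) z -> ~ G z -> z <> RtoC 0 -> Cmod (Phi_eval a z) < 1) ->
  forall m v n, entire v -> H_dense (near_orbit a (S m) v n).
Proof.
intros Ha Harc HG HG1 HGK m0 v n Hv u Hu r eps Hr He.
destruct (arc_cone_sequence G Harc HG) as [A [B [s [l [GA [GB [HAB [Hs [Gl [Cl [Hinj [Hne Hlim]]]]]]]]]]]].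
set (m := S m0). set (F := Phi_eval a).
assert (HF : entire F) by now apply entire_Phi_eval.
assert (Hm0 : 0 < INR m) by (apply lt_0_INR; unfold m; lia).
assert (HmC : RtoC (INR m) <> 0) by (apply RtoC_neq_0; lra).
set (K := conv (fun w => G w \/ w = RtoC 0)).
assert (HK : convex K) by (intros z w t Hz Hw Ht; now apply conv_convex).
assert (GK : forall z, G z -> K z) by (intros z Hz; apply conv_subset; now left).
assert (K0 : K 0) by (apply conv_subset; now right).
assert (Hl0 : l <> 0) by now apply (cone_neq_0 A B).
assert (Hchord : exists z, open_chord (fun z => G z /\ cone A B z) z).
{ eexists. exists (s 0%nat), (s 1%nat), (/ 2). split; [apply Hs|]. split; [apply Hs|].
  split; [intros E; apply Hinj in E; lia|]. split; [lra|reflexivity]. }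
assert (Hlow : exists w, Cmod (F w) < 1).
{ destruct Hchord as [z Hz]. exists z. now apply (open_chord_lt F G A B). }
(* The points [t k * l] accumulate at [l / 2] without reaching it, as the density of exponentials
   requires; [0 < t k < 1] places them in the interior of the hull. *)
set (t := fun k => / 2 + / 4 / INR (S k)).
assert (Ht : forall k, / 2 < t k < 1).
{ intros k. assert (HSk : 1 <= INR (S k)) by (apply (le_INR 1); lia). unfold t.
  assert (0 < / 4 / INR (S k)) by (apply Rdiv_lt_0_compat; lra).
  assert (/ 4 / INR (S k) <= / 4); [|lra].
  apply Rmult_le_reg_r with (INR (S k)); [lra|]. unfold Rdiv. rewrite Rmult_assoc, Rinv_l; lra. }
set (bet := fun k => (t k * l)%C).
assert (HbetO : forall k, inter K (bet k) /\ cone A B (bet k)).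
{ intros k. specialize (Ht k). split; [apply (inter_scal K A B); auto; lra|apply cone_scal; [exact Cl|lra]]. }
assert (Hbet1 : forall k, Cmod (F (bet k)) < 1).
{ intros k. now apply (inter_hull_lt F G A B). }
destruct (cexpo_span_dense (fun k => bet k / INR m)%C (/ 2 * l / INR m)%C u) with (rho := r) (eps := eps / 3)
  as [N1 [x Hx]].
{ intros k E. specialize (Ht k).
  assert (E' : ((t k - / 2)%R * l)%C = 0).
  { rewrite RtoC_minus, RtoC_inv by lra. transitivity ((bet k / INR m - / 2 * l / INR m) * INR m)%C.
    - unfold bet. field. exact HmC.
    - rewrite E. ring. }
  apply (Cmult_neq_0 (t k - / 2)%R l); [apply RtoC_neq_0; lra|exact Hl0|exact E']. }
{ intros e Hepos.
  pose proof (is_lim_seq_scal_inv_S (/ 4 * (Cmod l / INR m))) as L. apply is_lim_seq_spec in L.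
  destruct (L (mkposreal e Hepos)) as [k Hk]. specialize (Hk k (le_n k)). simpl pos in Hk.
  rewrite Rminus_0_r in Hk. exists k. eapply Rle_lt_trans; [|exact Hk].
  eapply Rle_trans; [|apply Rle_abs]. right.
  replace (bet k / INR m - / 2 * l / INR m)%C with ((t k - / 2)%R * (l / INR m))%C.
  2:{ unfold bet. rewrite RtoC_minus, RtoC_inv by lra. field. exact HmC. }
  specialize (Ht k).
  rewrite Cmod_mult, Cmod_div, 2!Cmod_R, 2!Rabs_pos_eq by (assumption || lra).
  unfold t. field. split; [lra|]. apply not_0_INR. lia. }
{ exact Hu. }
{ lra. }
assert (He0 : 0 < / INR (S n)) by (apply Rinv_0_lt_compat, lt_0_INR; lia).
destruct (cexpo_span_dense s l v Hne Hlim Hv (INR n) (/ INR (S n) / 4)) as [N2 [b Hb]]; [lra|].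
apply (near_orbit_of_words a m0 v n u r eps bet N1 x s N2 b); auto.
- intros j. apply HG1, Hs.
- intros w [Hw [HN Hlen]].
  apply (word_lt F G A B) with (N := (N1 + N2)%nat); auto.
  + intros i Hi. destruct (Nat.ltb_spec i N1); [left; apply HbetO|right; apply Hs].
  + intros i j Hi Hj Hij Si Sj.
    (* The images of the [bet k] have modulus below 1, so these letters are never arc points;
       distinctness is at stake only among the [s j]. *)
    assert (Hex : forall k, ~ (G (bet k) /\ cone A B (bet k))).
    { intros k [Gk _]. specialize (Hbet1 k). apply HG1 in Gk. unfold F in Hbet1. lra. }
    destruct (Nat.ltb_spec i N1); [now apply Hex in Si|].
    destruct (Nat.ltb_spec j N1); [now apply Hex in Sj|].
    intros E. apply Hinj in E. lia.
Qed.

Theorem theorem3 (a : nat -> C) (Gamma1 : C -> Prop) :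
  exp_type a ->
  compact_arc Gamma1 ->
  strictly_convex Gamma1 ->
  (forall z, Gamma1 z -> Cmod (Phi_eval a z) = 1) ->
  (forall z, conv (fun w => Gamma1 w \/ w = RtoC 0) z ->
             ~ Gamma1 z -> z <> RtoC 0 -> Cmod (Phi_eval a z) < 1) ->
  H_residual (generates_hc_algebra (PhiD a)).
Proof.
intros Ha Harc Hsc Hone Hlt. apply residual_of_near_orbit_dense; [exact Ha|].
now apply near_orbit_dense with (G := Gamma1).
Qed.
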